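(* Let $\sigma\in\{-1,1\}$ and let $g:[0,T[\times\mathbb{R}^3_x\times\mathbb{R}^3_v\to\mathbb{R}$ and $\phi:[0,T[\times\mathbb{R}^3_x\to\mathbb{R}$ be sufficiently regular functions. For every $p\ge0$ there is a constant $C>0$ depending only on $p$ such that, for all $(t,x)\in[0,T[\times\mathbb{R}^3$, $$\int_{\mathbb{R}^3_v}|g|(t,x,v)\,dv\le\frac{C}{(1+|x|)^2\tau_-}\left(\sum_{|\beta|\le2}\int_{\Sigma_t}\int_{\mathbb{R}^3_v}r\,\big|\widehat\Omega^\beta(\mathbf{T}_\phi(g))\big|\frac{dv}{v^0}dx+\sum_{|\xi|\le3}\int_{\Sigma_t}\int_{\mathbb{R}^3_v}(1+|s|)\,|\widehat Z^\xi g|\,dv\,dx\right),$$ $$\int_{\mathbb{R}^3_v}|g|(t,x,v)\,dv\le\frac{C}{(1+|x|)^2\tau_-^{1+p}}\left(\sum_{|\beta|\le2}\int_{\Sigma_t}\int_{\mathbb{R}^3_v}r\,\big|z^p\,\widehat\Omega^\beta(\mathbf{T}_\phi(g))\big|\frac{dv}{v^0}dx+\sum_{|\xi|\le3}\int_{\Sigma_t}\int_{\mathbb{R}^3_v}|z^{p+1}\widehat Z^\xi g|\,dv\,dx\right),$$ where the sums run over all compositions $\widehat\Omega^\beta\in\{\widehat\Omega_{12},\widehat\Omega_{13},\widehat\Omega_{23}\}^{|\beta|}$ and $\widehat Z^\xi\in\widehat{\mathbb V}^{|\xi|}$ of the indicated lengths.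
   Context: Repeated Latin indices are summed from 1 to 3. $\mathbb{R}^3_x=\mathbb{R}^3$, $\mathbb{R}^3_v=\mathbb{R}^3\setminus\{0\}$, $v^0=|v|$, $v_i=v^i$, $r=|x|$, $\Sigma_t=\{t\}\times\mathbb{R}^3_x$, $\tau_-=\sqrt{1+(t-r)^2}$ (evaluated at the point $(t,x)$). $\mathbf{T}_\phi(g)=v^0\partial_tg+v^i\partial_ig+\sigma v^0\nabla_x\phi\cdot\nabla_vg$. Vector fields: $S=t\partial_t+x^i\partial_i$, $S_v=v^i\partial_{v^i}$, $\widehat\Omega_{ij}=x^i\partial_j-x^j\partial_i+v^i\partial_{v^j}-v^j\partial_{v^i}$, and $\widehat{\mathbb V}=\{\partial_t,\partial_1,\partial_2,\partial_3,S,S_v,\widehat\Omega_{12},\widehat\Omega_{13},\widehat\Omega_{23}\}$. Weights: $s=t-x^i\frac{v_i}{v^0}$, and $z\ge0$ is defined by $z^2=\sum_{w\in\mathbf{k}_0}w^2$, where $\mathbf{k}_0$ consists of $\frac{v^\mu}{v^0}$ ($0\le\mu\le3$), $s$, $z_{ij}=x^i\frac{v^j}{v^0}-x^j\frac{v^i}{v^0}$ ($1\le i<j\le3$) and $z_{0k}=x^k-t\frac{v^k}{v^0}$ ($1\le k\le3$). ''Sufficiently regular'' means smooth enough, and decaying enough at infinity and near $v=0$, for the expressions to make sense and for integrations by parts in $x$ and $v$ to produce no boundary terms. *)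

(* Defs.v *)
From HB Require Import structures.
From mathcomp Require Import all_boot all_order all_algebra.
From mathcomp Require Import all_classical all_reals all_analysis.

Set Implicit Arguments.
Unset Strict Implicit.
Unset Printing Implicit Defensive.

Import Order.TTheory GRing.Theory Num.Theory.
Import numFieldNormedType.Exports.

Local Open Scope classical_set_scope.
Local Open Scope ring_scope.

(* Points of R^3 are row vectors x : 'rV[R]_3, the coordinates x^1, x^2, x^3 of
   the text being x 0 0, x 0 1, x 0 2.  A function on
   [0, T[ x R^3_x x R^3_v is a total function of (t, x, v); its values outside
   the domain are irrelevant to everything below. *)

Notation phase_fun R := (R -> 'rV[R]_3 -> 'rV[R]_3 -> R) (only parsing).
Notation operator R := (phase_fun R -> phase_fun R) (only parsing).

Notation leb3 :=
  (lebesgue_measure \x lebesgue_measure \x lebesgue_measure)%E (only parsing).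

Section Definitions.
Context {R : realType}.
Implicit Types (t : R) (T : \bar R) (x v : 'rV[R]_3) (i j : 'I_3).
Implicit Types (g : phase_fun R) (phi : R -> 'rV[R]_3 -> R).

(* The library norm on 'rV[R]_3 is the sup norm, hence this definition. *)
Definition enorm x : R := Num.sqrt (\sum_i x 0 i ^+ 2).

Definition phase_domain T : set (R * 'rV[R]_3 * 'rV[R]_3) :=
  [set y | [/\ 0 <= y.1.1, (y.1.1%:E < T)%E & y.2 != 0]].

(* Partial derivatives.  The one in t is taken inside [0, +oo[: it is two-sided
   for t > 0 and one-sided at t = 0. *)

Definition basis i : 'rV[R]_3 := delta_mx 0 i.

Definition dt_quotient g t x v : R -> R :=
  fun h => h^-1 * (g (t + h) x v - g t x v).

Definition dt_filter t : set_system R :=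
  within [set h | 0 <= t + h] 0^'.

Definition dt g : phase_fun R := fun t x v =>
  lim (dt_quotient g t x v h @[h --> dt_filter t]).

Definition dx i g : phase_fun R := fun t x v =>
  'D_(basis i) (fun y => g t y v) x.

Definition dv i g : phase_fun R := fun t x v =>
  'D_(basis i) (fun w => g t x w) v.

Definition has_partials g t x v : Prop :=
  [/\ cvg (dt_quotient g t x v h @[h --> dt_filter t]),
      forall i, derivable (fun y => g t y v) x (basis i) &
      forall i, derivable (fun w => g t x w) v (basis i)].

Fixpoint Ck T (k : nat) g : Prop :=
  {within phase_domain T, continuous (fun y => g y.1.1 y.1.2 y.2)} /\
  if k is k'.+1 then
    [/\ forall t x v, phase_domain T (t, x, v) -> has_partials g t x v,
        Ck T k' (dt g),
        forall i, Ck T k' (dx i g) &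
        forall i, Ck T k' (dv i g)]
  else True.

(* Lebesgue measure and integration over D, a subset of R^3; the integrands are
   nonnegative, so that the integrals always make sense in [0, +oo]. *)

Definition vec3 (y : R * R * R) : 'rV[R]_3 :=
  \row_i nth 0 [:: y.1.1; y.1.2; y.2] i.

Definition int3 (D : set 'rV[R]_3) (f : 'rV[R]_3 -> \bar R) : \bar R :=
  (\int[leb3]_(y in vec3 @^-1` D) f (vec3 y))%E.

Definition int_x (f : 'rV[R]_3 -> \bar R) : \bar R := int3 [set: 'rV[R]_3] f.

Definition int_v (f : 'rV[R]_3 -> \bar R) : \bar R := int3 [set v | v != 0] f.

(* g and (1 + |v|) times its v-gradient are dominated by an integrable function
   of v, locally uniformly in x.  This gives the integrability in v, and the
   absence of boundary terms at v = 0 and v = oo, which integrations by parts in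
   v require.  No decay in x is imposed: when g does not decay, the right-hand
   sides of the estimates are allowed to be +oo. *)
Definition v_dominated T g : Prop :=
  forall t (rho : R), 0 <= t -> (t%:E < T)%E ->
  exists h : 'rV[R]_3 -> R,
    leb3.-integrable [set: R * R * R] (fun y => (h (vec3 y))%:E) /\
    forall x v, enorm x <= rho -> v != 0 ->
      `|g t x v| + (1 + enorm v) * (\sum_i `|dv i g t x v|) <= h v.

(* C^3 is what is needed to apply two vector fields to T_phi(g) and three to
   g. *)
Definition sufficiently_regular T g phi : Prop :=
  [/\ Ck T 3 g, Ck T 3 (fun t x _ => phi t x) & v_dominated T g].

Definition Tphi (sigma : R) phi g : phase_fun R := fun t x v =>
  enorm v * dt g t x v + \sum_i v 0 i * dx i g t x v
  + sigma * enorm v * (\sum_i 'D_(basis i) (phi t) x * dv i g t x v).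

Definition S_field : operator R := fun g t x v =>
  t * dt g t x v + \sum_i x 0 i * dx i g t x v.

Definition Sv_field : operator R := fun g t x v =>
  \sum_i v 0 i * dv i g t x v.

Definition Omega_hat i j : operator R := fun g t x v =>
  x 0 i * dx j g t x v - x 0 j * dx i g t x v
  + v 0 i * dv j g t x v - v 0 j * dv i g t x v.

Definition rotations : seq (operator R) :=
  [:: Omega_hat 0 1; Omega_hat 0 2; Omega_hat 1 2].

Definition V_hat : seq (operator R) :=
  [:: dt; dx 0; dx 1; dx 2; S_field; Sv_field] ++ rotations.

(* All compositions of k elements of F, indexed by the words of length k. *)
Fixpoint compositions (F : seq (operator R)) (k : nat) : seq (operator R) :=
  if k is k'.+1 then [seq Z \o W | Z <- F, W <- compositions F k']
  else [:: id].

Definition tau_minus t x : R := Num.sqrt (1 + (t - enorm x) ^+ 2).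

Definition s_weight t x v : R := t - \sum_i x 0 i * (v 0 i / enorm v).

Definition z_rot i j x v : R :=
  x 0 i * (v 0 j / enorm v) - x 0 j * (v 0 i / enorm v).

Definition z_boost i t x v : R := x 0 i - t * (v 0 i / enorm v).

Definition k0 t x v : seq R :=
  [:: enorm v / enorm v; v 0 0 / enorm v; v 0 1 / enorm v; v 0 2 / enorm v;
      s_weight t x v;
      z_rot 0 1 x v; z_rot 0 2 x v; z_rot 1 2 x v;
      z_boost 0 t x v; z_boost 1 t x v; z_boost 2 t x v].

Definition z_weight t x v : R := Num.sqrt (\sum_(w <- k0 t x v) w ^+ 2).

End Definitions.

(* Main.v *)
(* Everything happens at a fixed time t.  For a weight w(x, v) which is invariant under the
   simultaneous rotations of x and v and varies slowly in x, a Sobolev inequality for the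
   velocity average of w |g| bounds (1 + |x|)^2 times this average by the integrals of
   w |Z^xi g|, |xi| <= 3: translate along the ray through x, then rotate twice.  The velocity
   average need not be differentiated, since |g| is estimated along the lifted flows on the
   phase space.  With w = z^(p+1) and tau_- <= z this is the second estimate; with
   w = 1 + |s| and tau_- <= 2 (1 + |s|) it is the first one for |x| <= t + 1.

   For r = |x| > t + 1 one compares the average at radius r with those at the radii in
   [r, 2r - t].  The identity
     (rho^2 - t^2) d_rho = rho S - t rho T_0 / |v| - t s d_rho + t (v^i / |v|) om^j Omega_ji,
   where T_0 is the free transport operator, expresses the radial derivative through
   T_phi(g), the fields Z g weighted by 1 + |s|, and v-derivatives, which are integrated by
   parts after |g| is replaced by sqrt(g^2 + eps^2) - eps.  Only two rotations are needed to
   control each resulting term on the sphere of radius rho, which leaves two derivatives on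
   T_phi(g).  Every integral is that of a nonnegative function: the signed terms are split
   into positive and negative parts, so that no integrability of the derivatives in x is
   used. *)
Require Import Defs.
From HB Require Import structures.
From mathcomp Require Import all_boot all_order all_algebra.
From mathcomp Require Import ring lra.
From mathcomp Require Import all_classical all_reals all_analysis measurable_realfun.
Set Implicit Arguments.
Unset Strict Implicit.
Unset Printing Implicit Defensive.
Import Order.TTheory GRing.Theory Num.Theory.
Import numFieldNormedType.Exports.
Local Open Scope classical_set_scope.
Local Open Scope ring_scope.

(** * Change of variables and rotations of R^3 *)

Section Measure.
Context {R : realType}.
Implicit Types (D A : set R) (m : R).
Local Notation leb := (@lebesgue_measure R).

(** Only upper bounds are needed, so changes of variables become inequalities on the line: a map
    expanding distances by [m] pulls measure back with a factor at most [1 / m]. This covers shears,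
    rotations as products of shears, and polar coordinates one coordinate at a time.

    In the exterior, [s] vanishes for some directions of [v], so the weight [1 + |s|] cannot produce
    [tau_-]. The gain comes from [rho^2 - t^2 >= (r - t) rho] for [rho >= r]. The comparison
    interval has length [r - t] because averaging over it then costs [1 / (r - t)], exactly what the
    division by [rho^2 - t^2] costs.

    The [v]-derivatives in the radial identity carry the gradient of [phi], on which no uniform
    bound is available, while the final constant must not see it. They have to disappear exactly,
    not be estimated. They do, as derivatives of fields bounded by [(1 + |v|) H] with [H]
    integrable: on almost every line the boundary terms become small along some sequence, since
    otherwise [H] would dominate a multiple of [1 / (1 + |x|)] there. *)

Lemma lebesgue_le_diam D d : measurable D -> 0 <= d ->
  (forall x y, D x -> D y -> y - x <= d) -> (leb D <= d%:E)%E.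
Proof.
move=> mD d0 Dd.
have [->|/set0P[x0 Dx0]] := eqVneq D set0; first by rewrite measure0 lee_fin.
have ubD : has_ubound D by exists (x0 + d) => y Dy; have := Dd _ _ Dx0 Dy; lra.
have lbD : has_lbound D by exists (x0 - d) => y Dy; have := Dd _ _ Dy Dx0; lra.
have sD : sup D - inf D <= d.
  rewrite lerBlDr; apply: sup_le_ub; first by exists x0.
  move=> y Dy; rewrite -lerBlDl; apply: lb_le_inf; first by exists x0.
  by move=> z Dz; have := Dd _ _ Dz Dy; lra.
have sub : D `<=` `[inf D, sup D].
  by move=> y Dy; rewrite /= in_itv /= ge_inf //= ub_le_sup.
apply: (@le_trans _ _ (leb `[inf D, sup D])).
  by apply: le_measure; rewrite ?inE //; exact: measurable_itv.
rewrite lebesgue_measure_itv /=; case: ifP => _; last by rewrite lee_fin.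
by rewrite -EFinB lee_fin.
Qed.

Definition expanding_on D (m : R) (gam : R -> R) :=
  forall x y, D x -> D y -> m * `|x - y| <= `|gam x - gam y|.

(** Lebesgue measure is an infimum over countable covers by intervals. The part of [D] sent into an
    interval of length [l] has diameter at most [l / m], hence measure at most [l / m]; summing over
    a cover of [A] gives the bound. *)
Lemma lebesgue_preimage_expanding D m (gam : R -> R) A :
  measurable D -> measurable A -> measurable_fun [set: R] gam -> 0 < m ->
  expanding_on D m gam ->
  (leb (gam @^-1` A `&` D) <= m^-1%:E * leb A)%E.
Proof.
move=> mD mA mg m0 ex.
have mpre B : measurable B -> measurable (gam @^-1` B `&` D).
  by move=> mB; apply: measurableI => //; rewrite -[X in measurable X]setTI; exact: mg.
rewrite muleC -lee_pdivrMr ?invr_gt0 // invrK.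
rewrite [leRHS]/lebesgue_measure /lebesgue_stieltjes_measure /measure_extension.
apply: le_ereal_inf_tmp => _ [F [mF AF] <-].
rewrite muleC -lee_pdivlMl //.
have mF' k : measurable (F k : set R).
  by have [ab _ <-] := mF k; exact: measurable_itv.
apply: (@le_trans _ _ (\sum_(0 <= k <oo) leb (gam @^-1` (F k) `&` D))%E).
  apply: measure_sigma_subadditive; [by move=> k; exact: mpre|exact: mpre|].
  by move=> x [/AF[k _ Fk] Dx]; exists k.
rewrite -nneseriesZl; last first.
  by move=> k _; have [ab _ <-] := mF k; exact: wlength_ge0.
apply: lee_nneseries => [k _ _|k _]; first by rewrite measure_ge0.
have mFk := mF k.
move: (mF' k) mFk; move=> mFk [[a b] _ /= abE].
rewrite -abE wlength_itv /=.
have [ab|ab] := ltP (a%:E) (b%:E).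
  rewrite -EFinB -EFinM; apply: lebesgue_le_diam.
  - by apply: mpre; exact: measurable_itv.
  - by rewrite mulr_ge0 ?invr_ge0 ?(ltW m0) // subr_ge0 -lee_fin ltW.
  move=> x y [/= + Dx] [/= + Dy]; rewrite !in_itv /= => /andP[ax xb] /andP[ay yb].
  have := ex _ _ Dx Dy; rewrite -ler_pdivlMl // => h.
  apply: (le_trans (ler_norm _)); rewrite distrC; apply: le_trans h _.
  rewrite ler_pM2l ?invr_gt0 //; rewrite ler_norml; apply/andP; split; lra.
rewrite set_itv_ge ?preimage_set0 ?set0I ?measure0 ?mule0 //.
by rewrite -leNgt; rewrite bnd_simp -lee_fin.
Qed.

(** The push-forward by [gam] of Lebesgue measure restricted to [D] is at most [m^-1] times Lebesgue
    measure. The changes of variables below are instances, [D] being a range on which the map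
    expands. *)
Lemma integral_expanding D m (gam : R -> R) (H : R -> \bar R) :
  measurable D -> measurable_fun [set: R] gam -> 0 < m -> expanding_on D m gam ->
  measurable_fun [set: R] H -> (forall x, 0 <= H x)%E ->
  (\int[leb]_(x in D) H (gam x) <= m^-1%:E * \int[leb]_x H x)%E.
Proof.
move=> mD mg m0 ex mH H0.
have m1 : 0 <= m^-1 by rewrite invr_ge0 ltW.
pose k : {nonneg R} := NngNum m1.
rewrite -(@ge0_integral_mscale _ _ _ leb setT measurableT k) //.
have -> : (\int[leb]_(x in D) H (gam x) = \int[mrestr leb mD]_(x in D) H (gam x))%E.
  apply: eq_measure_integral => A mA AD.
  by change (leb A = leb (A `&` D)); rewrite setIidl.
apply: (@le_trans _ _ (\int[mrestr leb mD]_x H (gam x))%E).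
  by apply: ge0_subset_integral => //; exact: measurableT_comp.
pose lD : {measure set (measurableTypeR R) -> \bar R} := mrestr leb mD.
have := @ge0_integral_pushforward _ _ (measurableTypeR R) (measurableTypeR R) R gam mg lD setT H measurableT mH (fun x _ => H0 x).
rewrite preimage_setT => <-.
apply: (@ge0_le_measure_integral _ (measurableTypeR R) R _ _ _ H setT) => // A mA.
exact: lebesgue_preimage_expanding.
Qed.
End Measure.

(** * Powers of Lebesgue measure; nonnegative integrals without measurability *)

Section SigmaFiniteProduct.
Local Open Scope ereal_scope.

(** The integral of a nonnegative function is a supremum over the simple functions below it, hence
    monotone for arbitrary functions. This spares the measurability of many inner integrals. *)
Lemma ge0_le_integral_nomeas d (T : measurableType d) (R : realType)
    (mu : {measure set T -> \bar R}) (D : set T) (f g : T -> \bar R) :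
  (forall x, D x -> 0 <= f x) -> (forall x, D x -> f x <= g x) ->
  \int[mu]_(x in D) f x <= \int[mu]_(x in D) g x.
Proof.
move=> f0 fg.
have g0 x : D x -> 0 <= g x by move=> Dx; exact: le_trans (f0 x Dx) (fg x Dx).
rewrite !ge0_integralE //; apply: ge_ereal_sup => _ [h /= hf <-].
apply: ereal_sup_ubound; exists h => // x; apply: le_trans (hf x) _.
by rewrite /patch; case: ifPn => // /set_mem; exact: fg.
Qed.

Lemma product_sigma_finite d1 d2 (T1 : measurableType d1)
    (T2 : measurableType d2) (R : realType)
    (m1 : {sigma_finite_measure set T1 -> \bar R})
    (m2 : {sigma_finite_measure set T2 -> \bar R}) :
  sigma_finite setT (m1 \x m2).
Proof.
have /sigma_finiteP[F [TF ndF Foo]] := sigma_finiteT m1.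
have /sigma_finiteP[G [TG ndG Goo]] := sigma_finiteT m2.
exists (fun n => F n `*` G n).
  rewrite -setXTT TF TG predeqE => -[x y]; split; last first.
    by move=> [n _ []/= ? ?]; split; exists n.
  move=> [/= [n _ Fnx] [k _ Gky]]; exists (maxn n k) => //; split.
  - by move: x Fnx; exact/subsetPset/ndF/leq_maxl.
  - by move: y Gky; exact/subsetPset/ndG/leq_maxr.
move=> k; have [mF Fk] := Foo k; have [mG Gk] := Goo k.
split; first exact: measurableX.
by rewrite product_measure1E// lte_mul_pinfty// ge0_fin_numE.
Qed.

Context {R : realType}.
Local Notation leb := (@lebesgue_measure R).
Local Notation X := (measurableTypeR R).

(** A named copy of the product that can carry a sigma-finite structure: Tonelli's theorem is then
    iterated with [lebesgue2] and [lebesgue3] as factors. *)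
Definition lebesgue2 : set (X * X)%type -> \bar R := leb \x leb.
HB.instance Definition _ := Measure.copy lebesgue2 (leb \x leb).
HB.instance Definition _ := Measure_isSigmaFinite.Build _ _ _ lebesgue2
  (product_sigma_finite leb leb).

Definition lebesgue3 : set (X * X * X)%type -> \bar R := lebesgue2 \x leb.
HB.instance Definition _ := Measure.copy lebesgue3 (lebesgue2 \x leb).
HB.instance Definition _ := Measure_isSigmaFinite.Build _ _ _ lebesgue3
  (product_sigma_finite lebesgue2 leb).
End SigmaFiniteProduct.

Section ScaleNoMeas.
Local Open Scope ereal_scope.
Import HBNNSimple.

(** Simple functions scale, so [k * int h <= int (k * h)] for every [k > 0]; the converse is the
    same inequality for [c^-1]. *)
Lemma ge0_integralZl_nomeas d (T : measurableType d) (R : realType)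
    (mu : {measure set T -> \bar R}) (D : set T) (f : T -> \bar R) (c : R) :
  (0 < c)%R -> (forall x, D x -> 0 <= f x) ->
  \int[mu]_(x in D) (c%:E * f x) = c%:E * \int[mu]_(x in D) f x.
Proof.
move=> c0 f0.
suff le1 (k : R) (h : T -> \bar R) : (0 < k)%R -> (forall x, D x -> 0 <= h x) ->
    k%:E * \int[mu]_(x in D) h x <= \int[mu]_(x in D) (k%:E * h x).
  apply/eqP; rewrite eq_le le1 // andbT.
  have ci : (0 < c^-1)%R by rewrite invr_gt0.
  rewrite -(@lee_pmul2l _ (c^-1)%:E) // muleA -EFinM mulVf ?gt_eqF // mul1e.
  apply: (le_trans (le1 _ (fun x => c%:E * f x) ci _)).
    by move=> x Dx; rewrite mule_ge0 ?f0 // lee_fin ltW.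
  rewrite le_eqVlt; apply/orP; left; apply/eqP; apply: eq_integral => x _.
  by rewrite muleA -EFinM mulVf ?gt_eqF // mul1e.
move=> k0 h0.
have kh0 x : D x -> 0 <= k%:E * h x by move=> Dx; rewrite mule_ge0 ?h0 // lee_fin ltW.
rewrite -lee_pdivlMl // [X in X <= _]ge0_integralE //.
apply: ge_ereal_sup => _ [s /= hs <-]; rewrite lee_pdivlMl //.
rewrite [leRHS]ge0_integralE //.
apply: ereal_sup_ubound; exists (scale_nnsfun s (ltW k0)) => /=.
  move=> x; rewrite EFinM /patch; have := hs x; rewrite /patch.
  case: ifP => _; last by rewrite lee_fin => sx; rewrite -EFinM lee_fin pmulr_rle0.
  by move=> hx; apply: lee_wpmul2l => //; rewrite lee_fin ltW.
by rewrite sintegralrM.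
Qed.

(** The sum of simple functions below [f] and [g] is below [f + g]. Only this direction survives for
    arbitrary functions, and it is the one that merges several bounds into a single integral. *)
Lemma ge0_integralD_nomeas d (T : measurableType d) (R : realType)
    (mu : {measure set T -> \bar R}) (D : set T) (f g : T -> \bar R) :
  (forall x, D x -> 0 <= f x) -> (forall x, D x -> 0 <= g x) ->
  \int[mu]_(x in D) f x + \int[mu]_(x in D) g x <= \int[mu]_(x in D) (f x + g x).
Proof.
move=> f0 g0.
have add_sup (A B : set (\bar R)) (Z : \bar R) : A 0 -> B 0 ->
    (forall a, A a -> 0 <= a) -> (forall b, B b -> 0 <= b) ->
    (forall a b, A a -> B b -> a + b <= Z) -> ereal_sup A + ereal_sup B <= Z.
  move=> A0 B0 Age Bge h.
  have Z0 : 0 <= Z by have := h _ _ A0 B0; rewrite adde0.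
  case: Z Z0 h => [z|_ _|] //; last by rewrite leey.
  move=> z0 h.
  have fin (C : set (\bar R)) c : C c -> (forall c, C c -> 0 <= c) ->
      (forall c, C c -> c <= z%:E) -> c \is a fin_num.
    move=> Cc C0 Cz; rewrite ge0_fin_numE ?C0 //; exact: le_lt_trans (Cz _ Cc) (ltry _).
  have Az a : A a -> a <= z%:E by move=> Aa; have := h _ _ Aa B0; rewrite adde0.
  have Bz b : B b -> b <= z%:E by move=> Bb; have := h _ _ A0 Bb; rewrite add0e.
  have sA b : B b -> ereal_sup A <= z%:E - b.
    move=> Bb; apply: ge_ereal_sup => a Aa; rewrite leeBrDr ?(fin _ _ Bb) //; exact: h.
  have sA0 : 0 <= ereal_sup A by exact: ereal_sup_ubound.
  have fA : ereal_sup A \is a fin_num.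
    rewrite ge0_fin_numE //; apply: le_lt_trans (sA _ B0) _; by rewrite sube0 ltry.
  rewrite addeC -leeBrDr //; apply: ge_ereal_sup => b Bb.
  rewrite leeBrDr // addeC -leeBrDr ?(fin _ _ Bb) //; exact: sA.
have fg0 x : D x -> 0 <= f x + g x by move=> Dx; rewrite adde_ge0 ?f0 ?g0.
have z0 (h : T -> \bar R) : (forall x, D x -> 0 <= h x) -> forall x, (@nnsfun0 _ T R x)%:E <= (h \_ D) x.
  by move=> h0 x; rewrite /patch; case: ifPn => // /set_mem; exact: h0.
rewrite (ge0_integralE _ f0) (ge0_integralE _ g0) (ge0_integralE _ fg0).
apply: add_sup.
- by exists (@nnsfun0 _ T R); [exact: z0|rewrite sintegral0].
- by exists (@nnsfun0 _ T R); [exact: z0|rewrite sintegral0].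
- by move=> _ [s _ <-]; exact: sintegral_ge0.
- by move=> _ [s _ <-]; exact: sintegral_ge0.
move=> _ _ [s1 /= h1 <-] [s2 /= h2 <-]; rewrite -sintegralD //.
apply: ereal_sup_ubound; exists (add_nnsfun s1 s2) => //= x.
have := h1 x; have := h2 x; rewrite /patch; case: ifP => _ a b; rewrite EFinD.
  exact: leeD.
by rewrite -[leRHS]adde0; exact: leeD.
Qed.
End ScaleNoMeas.

(** * Iterated integrals over R^3 with a distinguished axis *)

Section Space.
Context {R : realType}.
Local Notation leb := (@lebesgue_measure R).
Local Notation V := 'rV[R]_3.
Local Notation E := (R * R * R)%type.
Implicit Types (F : V -> \bar R).

Definition measurable3 F := measurable_fun [set: E] (fun y : E => F (vec3 y)).

Definition unvec3 (x : V) : E := (x 0 0, x 0 1, x 0 2%R).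

Lemma vec3K : cancel (@vec3 R) unvec3.
Proof. by case=> [[a b] c]; rewrite /unvec3 /vec3 !mxE. Qed.

Lemma unvec3K : cancel unvec3 (@vec3 R).
Proof.
move=> x; apply/rowP => i; rewrite /vec3 /unvec3 !mxE /=.
by case: i => [] [|[|[|//]]] p /=; congr (x 0 _); apply/val_inj.
Qed.

Lemma measurable_unvec3 d (T : measurableType d) (f : T -> V) :
  (forall i, measurable_fun [set: T] (fun s => f s 0 i)) ->
  measurable_fun [set: T] (fun s => unvec3 (f s)).
Proof.
by move=> mf; apply: measurable_fun_pair => //; exact: measurable_fun_pair.
Qed.

Lemma measurable3_comp d (T : measurableType d) F (f : T -> V) :
  measurable3 F -> (forall i, measurable_fun [set: T] (fun s => f s 0 i)) ->
  measurable_fun [set: T] (fun s => F (f s)).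
Proof.
move=> mF mf.
rewrite (_ : (fun s => F (f s)) = (fun y : E => F (vec3 y)) \o (fun s => unvec3 (f s))).
  exact: measurableT_comp (measurable_unvec3 mf).
by apply/funext => s /=; rewrite unvec3K.
Qed.

(** Axis [k] is singled out and the two others keep their order, so that shears, polar coordinates
    and integrations by parts are treated once for all three axes. *)
Definition insert3 (k : 'I_3) (a b c : R) : V :=
  \row_l (if l == k then c else if l == lift k ord0 then a else b).

Lemma insert3_k k a b c : insert3 k a b c 0 k = c.
Proof. by rewrite mxE eqxx. Qed.

Lemma insert3_i k a b c : insert3 k a b c 0 (lift k ord0) = a.
Proof. by rewrite mxE eq_sym (negbTE (neq_lift _ _)) eqxx. Qed.

Lemma insert3_j k a b c : insert3 k a b c 0 (lift k ord_max) = b.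
Proof.
by rewrite mxE eq_sym (negbTE (neq_lift _ _)) (inj_eq lift_inj).
Qed.

Lemma insert3E k (x : V) : x = insert3 k (x 0 (lift k ord0)) (x 0 (lift k ord_max)) (x 0 k).
Proof.
apply/rowP => l; rewrite mxE; case: eqVneq => [->//|lk].
case: eqVneq => [->//|li]; congr (x 0 _).
by move: k l lk li => [] [|[|[|//]]] p [] [|[|[|//]]] q //= _ _; exact/val_inj.
Qed.

Lemma sum3E (k : 'I_3) (h : 'I_3 -> R) :
  \sum_i h i = h k + h (lift k ord0) + h (lift k ord_max).
Proof. by rewrite (bigD1_ord k) //= big_ord_recl big_ord1 addrA; congr (_ + h (lift k _)); exact/val_inj. Qed.

Lemma measurable_insert3 d (T : measurableType d) k (a b c : T -> R) F :
  measurable3 F -> measurable_fun [set: T] a -> measurable_fun [set: T] b ->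
  measurable_fun [set: T] c ->
  measurable_fun [set: T] (fun s => F (insert3 k (a s) (b s) (c s))).
Proof.
move=> mF ma mb mc; apply: measurable3_comp => // i.
rewrite (_ : (fun s => _) =
  if i == k then c else if i == lift k ord0 then a else b).
  by case: ifP => // _; case: ifP.
by apply/funext => s; rewrite mxE; case: ifP => // _; case: ifP.
Qed.

Local Open Scope ereal_scope.

Lemma tonelli2 (G : R -> R -> \bar R) :
  measurable_fun [set: R * R] (fun q : R * R => G q.1 q.2) ->
  (forall a b, 0 <= G a b) ->
  \int[leb]_a \int[leb]_b G a b = \int[leb]_b \int[leb]_a G a b.
Proof.
move=> mG G0.
exact: (@fubini_tonelli _ _ (measurableTypeR R) (measurableTypeR R) R leb leb
  (fun q => G q.1 q.2) mG (fun q => G0 q.1 q.2)).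
Qed.

Lemma measurable_int_snd d (T : measurableType d) (G : T -> R -> \bar R) :
  measurable_fun [set: T * R] (fun q : T * R => G q.1 q.2) ->
  (forall a b, 0 <= G a b) ->
  measurable_fun [set: T] (fun s => \int[leb]_b G s b).
Proof.
move=> mG G0.
exact: (@measurable_fun_fubini_tonelli_F _ _ T (measurableTypeR R) R leb
  (fun q => G q.1 q.2) mG (fun q => G0 q.1 q.2)).
Qed.

Lemma int3E F : measurable3 F -> (forall x, 0 <= F x) ->
  int3 setT F = \int[leb]_a \int[leb]_b \int[leb]_c F (vec3 (a, b, c)).
Proof.
move=> mF F0; rewrite /int3 preimage_setT.
transitivity (\int[@lebesgue2 R]_q \int[leb]_c F (vec3 (q, c))).
  change (\int[lebesgue2 \x leb]_y F (vec3 y) = \int[lebesgue2]_q \int[leb]_c F (vec3 (q, c))).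
  exact: (@fubini_tonelli1 _ _ (measurableTypeR R * measurableTypeR R)%type
    (measurableTypeR R) R (@lebesgue2 R) leb (fun y : E => F (vec3 y)) mF
    (fun y => F0 (vec3 y))).
have mG : measurable_fun [set: R * R] (fun q : R * R => \int[leb]_c F (vec3 (q, c))).
  by apply: (measurable_int_snd (G := fun q c => F (vec3 (q, c)))).
have G0 q : 0 <= \int[leb]_c F (vec3 (q, c)) by exact: integral_ge0.
exact: (@fubini_tonelli1 _ _ (measurableTypeR R) (measurableTypeR R) R leb leb
  (fun q => \int[leb]_c F (vec3 (q, c))) mG G0).
Qed.

Lemma measurable_coord d (T : measurableType d) (f : T -> V) i :
  measurable_fun [set: T] (fun s => unvec3 (f s)) ->
  measurable_fun [set: T] (fun s => f s 0%R i).
Proof.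
move=> mf.
rewrite (_ : (fun s => _) = (fun y : E => nth 0%R [:: y.1.1; y.1.2; y.2] i)
   \o (fun s => unvec3 (f s))); last first.
  by apply/funext => s /=; rewrite -[in LHS](unvec3K (f s)) mxE.
apply: measurableT_comp mf.
move: i => [] [|[|[|//]]] p /=.
- exact: measurableT_comp measurable_fst measurable_fst.
- exact: measurableT_comp measurable_snd measurable_fst.
- exact: measurable_snd.
Qed.

Lemma measurable_vec3 i : measurable_fun [set: E] (fun y : E => vec3 y 0%R i).
Proof.
apply: measurable_coord; rewrite (_ : (fun _ => _) = id) //.
by apply/funext => y; rewrite vec3K.
Qed.

Lemma ordE3 (i : 'I_3) : [\/ i = 0%R, i = 1%R | i = 2%R].
Proof.
by case: i => [] [|[|[|//]]] p; [constructor 1|constructor 2|constructor 3];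
  exact/val_inj.
Qed.

Lemma int3_insert k F : measurable3 F -> (forall x, 0 <= F x) ->
  int3 setT F = \int[leb]_a \int[leb]_b \int[leb]_c F (insert3 k a b c).
Proof.
move=> mF F0.
have mI (f : R -> R -> R -> R * R * R) :
   measurable_fun [set: E] (fun q : E => f q.1.1 q.1.2 q.2) ->
   measurable_fun [set: E] (fun q : E => F (vec3 (f q.1.1 q.1.2 q.2))).
  move=> mf; exact: (measurableT_comp mF mf).
have m1 : measurable_fun [set: E] (fun q : E => q.1.1).
  exact: measurableT_comp measurable_fst measurable_fst.
have m2 : measurable_fun [set: E] (fun q : E => q.1.2).
  exact: measurableT_comp measurable_snd measurable_fst.
have m3 : measurable_fun [set: E] (fun q : E => q.2) by exact: measurable_snd.
rewrite (int3E mF F0).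
have insE (l : 'I_3) a b c : insert3 l a b c =
  vec3 (if l == 0%R then (c, a, b) else if l == 1%R then (a, c, b) else (a, b, c)).
  apply/rowP => i; rewrite /vec3 !mxE.
  by move: l i => [] [|[|[|//]]] p [] [|[|[|//]]] q.
have sw23 a : \int[leb]_b \int[leb]_c F (vec3 (a, b, c)) =
    \int[leb]_c \int[leb]_b F (vec3 (a, b, c)).
  apply: (tonelli2 (G := fun b c => F (vec3 (a, b, c)))) => //.
  apply: (measurableT_comp mF).
  apply: measurable_fun_pair => //; apply: measurable_fun_pair => //.
have [->|->|->] := ordE3 k.
- transitivity (\int[leb]_a \int[leb]_c \int[leb]_b F (vec3 (a, b, c))).
    by apply: eq_integral => a _; exact: sw23.
  rewrite [LHS](tonelli2 (G := fun a b => \int[leb]_c F (vec3 (a, c, b)))); last 2 first.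
  + apply: (measurable_int_snd (G := fun q c => F (vec3 (q.1, c, q.2)))) => //.
    apply: (mI (fun a b c => (a, c, b))).
    by apply: measurable_fun_pair => //; apply: measurable_fun_pair.
  + by move=> a b; exact: integral_ge0.
  have sw12 b : \int[leb]_a \int[leb]_c F (vec3 (a, c, b)) =
      \int[leb]_c \int[leb]_a F (vec3 (a, c, b)).
    apply: (tonelli2 (G := fun a c => F (vec3 (a, c, b)))) => //.
    apply: (measurableT_comp mF).
    by apply: measurable_fun_pair => //; apply: measurable_fun_pair.
  transitivity (\int[leb]_b \int[leb]_c \int[leb]_a F (vec3 (a, c, b))).
    by apply: eq_integral => b _; exact: sw12.
  rewrite [LHS](tonelli2 (G := fun b a => \int[leb]_c F (vec3 (c, a, b)))); last 2 first.
  + apply: (measurable_int_snd (G := fun q c => F (vec3 (c, q.2, q.1)))) => //.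
    apply: (mI (fun a b c => (c, b, a))).
    by apply: measurable_fun_pair => //; apply: measurable_fun_pair.
  + by move=> a b; exact: integral_ge0.
  by do 3![apply: eq_integral => ? _]; rewrite insE.
- apply: eq_integral => a _; rewrite sw23.
  by apply: eq_integral => b _; apply: eq_integral => c _; rewrite insE.
- apply: eq_integral => a _; apply: eq_integral => b _.
  by apply: eq_integral => c _; rewrite insE.
Qed.

Lemma le_int3_insert k F G : measurable3 F -> (forall x, 0 <= F x) ->
  measurable3 G -> (forall x, 0 <= G x) ->
  (forall a b, \int[leb]_c F (insert3 k a b c) <= \int[leb]_c G (insert3 k a b c)) ->
  int3 setT F <= int3 setT G.
Proof.
move=> mF F0 mG G0 FG.
rewrite (int3_insert k mF F0) (int3_insert k mG G0).
have mi H : measurable3 H -> measurable_fun [set: E]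
    (fun q : E => H (insert3 k q.1.1 q.1.2 q.2)).
  move=> mH; apply: measurable_insert3 => //.
  - exact: measurableT_comp measurable_fst measurable_fst.
  - exact: measurableT_comp measurable_snd measurable_fst.
have mc H a : measurable3 H -> (forall x, 0 <= H x) -> measurable_fun [set: R]
    (fun b => \int[leb]_c H (insert3 k a b c)).
  move=> mH H0; apply: measurable_int_snd => //.
  exact: measurable_insert3.
have mbc H : measurable3 H -> (forall x, 0 <= H x) -> measurable_fun [set: R]
    (fun a => \int[leb]_b \int[leb]_c H (insert3 k a b c)).
  move=> mH H0; apply: measurable_int_snd => [|a b]; last exact: integral_ge0.
  by apply: (measurable_int_snd (G := fun q c => H (insert3 k q.1 q.2 c))); [exact: mi|].
apply: ge0_le_integral; first exact: measurableT.
- by move=> a _; apply: integral_ge0 => b _; exact: integral_ge0.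
- exact: mbc.
- exact: mbc.
move=> a _; apply: ge0_le_integral; first exact: measurableT.
- by move=> b _; exact: integral_ge0.
- exact: mc.
- exact: mc.
- by move=> b _; exact: FG.
Qed.

(** On each line parallel to axis [k] the map is a translation, whatever the dependence of [phi] on
    the two other coordinates. *)
Lemma int3_shift (k : 'I_3) (phi : R -> R -> R) F :
  measurable3 F -> (forall x, 0 <= F x) ->
  measurable_fun [set: R * R] (fun q : R * R => phi q.1 q.2) ->
  int3 setT (fun x => F (x + phi (x 0 (lift k ord0)) (x 0 (lift k ord_max)) *: delta_mx 0 k)%R)
    <= int3 setT F.
Proof.
move=> mF F0 mphi.
have mX := measurable_vec3.
apply: (@le_int3_insert k) => //.
    apply: (measurable3_comp mF) => i.
  rewrite (_ : (fun _ => _) = (fun y : E => vec3 y 0 i +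
      phi (vec3 y 0 (lift k ord0)) (vec3 y 0 (lift k ord_max)) *
      (delta_mx 0 k : V) 0 i)%R); last first.
    by apply/funext => y; rewrite mxE [X in (_ + X)%R]mxE.
  apply: measurable_funD; first exact: mX.
  apply: measurable_funM; last exact: measurable_cst.
  exact: (measurableT_comp mphi
    (measurable_fun_pair (mX (lift k ord0)) (mX (lift k ord_max)))).
move=> a b.
have := @integral_expanding R setT 1 (fun c => c + phi a b)%R (fun c => F (insert3 k a b c)).
rewrite invr1 mul1e => h; apply: le_trans (h _ _ _ _ _ _) => //.
- rewrite le_eqVlt; apply/orP; left; apply/eqP; apply: eq_integral => c _; congr F.
  rewrite insert3_i insert3_j; apply/rowP => i; rewrite !mxE eqxx /=.
  by case: eqVneq => [|ik]; rewrite ?mulr1 ?mulr0 ?addr0.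
- exact: measurable_funD.
- by move=> x y _ _; rewrite mul1r opprD addrACA subrr addr0.
- exact: measurable_insert3.
Qed.
End Space.

(** * Rotations as products of shears *)

Section Rotations.
Context {R : realType}.
Local Notation V := 'rV[R]_3.
Implicit Types (F : V -> \bar R) (i j : 'I_3).

Definition shear i j (alpha : R) (x : V) : V :=
  x + (alpha * x 0 j) *: delta_mx 0 i.

Definition prot i j (c s : R) (x : V) : V :=
  \row_l (if l == i then c * x 0 i - s * x 0 j
          else if l == j then s * x 0 i + c * x 0 j else x 0 l).

Lemma shear_id i j alpha x l : l != i -> shear i j alpha x 0 l = x 0 l.
Proof. by move=> li; rewrite !mxE (negbTE li) /= mulr0 addr0. Qed.

Lemma shear_eq i j alpha x : shear i j alpha x 0 i = x 0 i + alpha * x 0 j.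
Proof. by rewrite !mxE !eqxx /= mulr1. Qed.

(** [s / (1 + c)] is the tangent of the half angle, so only the half turn [c = -1] escapes this
    factorisation. Rotations therefore do not increase integrals because translations of lines do
    not. *)
Lemma rot_shear i j (c s : R) x : i != j -> c ^+ 2 + s ^+ 2 = 1 -> c != -1 ->
  prot i j c s x =
  shear i j (- (s / (1 + c))) (shear j i s (shear i j (- (s / (1 + c))) x)).
Proof.
move=> ij cs c1; have c0 : 1 + c != 0 by rewrite addrC addr_eq0.
have ji : j != i by rewrite eq_sym.
set t := s / (1 + c).
have ts : t * s = 1 - c.
  rewrite /t mulrAC -expr2; apply: (mulIf c0); rewrite mulfVK //.
  by have -> : s ^+ 2 = 1 - c ^+ 2; [rewrite -cs; ring|ring].
have tc : t = s - t * c by have : t * (1 + c) = s; [rewrite /t mulfVK|move=> <-; ring].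
apply/rowP => l; rewrite mxE.
case: (eqVneq l i) => [->|li].
  rewrite shear_eq [shear j i _ _ _ i]shear_id // shear_eq.
  rewrite [shear j i _ _ _ j]shear_eq shear_eq shear_id //.
  have -> : x 0 i + - t * x 0 j + - t * (x 0 j + s * (x 0 i + - t * x 0 j)) =
     (1 - t * s) * x 0 i - (t + t - t * s * t) * x 0 j by ring.
  rewrite ts (_ : 1 - (1 - c) = c) //; last by ring.
  by congr (_ - _ * _); rewrite {1}tc; ring.
case: (eqVneq l j) => [->|lj]; rewrite shear_id //.
  rewrite shear_eq shear_eq shear_id //.
  have -> : x 0 j + s * (x 0 i + - t * x 0 j) = s * x 0 i + (1 - t * s) * x 0 j by ring.
  by rewrite ts; congr (_ + _ * _); ring.
by rewrite shear_id // shear_id.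
Qed.

Lemma measurable3_shear i j alpha F :
  measurable3 F -> measurable3 (fun x => F (shear i j alpha x)).
Proof.
move=> mF.
have mX := @measurable_vec3 R.
apply: (measurable3_comp mF) => k.
rewrite (_ : (fun _ => _) = (fun y => vec3 y 0 k + alpha * vec3 y 0 j * (delta_mx 0 i : V) 0 k)).
  apply: measurable_funD; first exact: mX.
  by apply: measurable_funM => //; apply: measurable_funM.
by apply/funext => y; rewrite mxE [X in (_ + X)%R]mxE.
Qed.

Lemma int3_shear i j alpha F : i != j -> measurable3 F ->
  (forall x, 0 <= F x)%E ->
  (int3 setT (fun x => F (shear i j alpha x)) <= int3 setT F)%E.
Proof.
move=> ij mF F0.
have mphi : measurable_fun [set: R * R] (fun q : R * R =>
    alpha * (if j == lift i ord0 then q.1 else q.2)).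
  apply: measurable_funM; first exact: measurable_cst.
  by case: (j == _); [exact: measurable_fst|exact: measurable_snd].
have := @int3_shift R i (fun a b => alpha * (if j == lift i ord0 then a else b)) F
  mF F0 mphi.
apply: le_trans; rewrite le_eqVlt; apply/orP; left; apply/eqP.
congr int3; apply/funext => x; congr F; rewrite /shear; congr (_ + (_ * _) *: _).
case: eqVneq => [->//|jl]; congr (x 0 _).
by move: i j ij jl {mphi} => [] [|[|[|//]]] p [] [|[|[|//]]] q //= _ _; exact/val_inj.
Qed.

Lemma int3_rot i j c s F : i != j -> c ^+ 2 + s ^+ 2 = 1 -> c != -1 ->
  measurable3 F -> (forall x, 0 <= F x)%E ->
  (int3 setT (fun x => F (prot i j c s x)) <= int3 setT F)%E.
Proof.
move=> ij cs c1 mF F0.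
have ji : j != i by rewrite eq_sym.
have -> : (fun x => F (prot i j c s x)) = fun x => F (shear i j (- (s / (1 + c))) (shear j i s (shear i j (- (s / (1 + c))) x))).
  by apply/funext => x; rewrite rot_shear.
set t := - _.
apply: le_trans (int3_shear t ij mF F0).
have mF1 := measurable3_shear i j t mF.
apply: le_trans (int3_shear s ji mF1 _) => //.
have mF2 := measurable3_shear j i s mF1.
exact: le_trans (int3_shear t ij mF2 _) _.
Qed.

Lemma enorm_sqr (x : V) : enorm x ^+ 2 = \sum_i x 0 i ^+ 2.
Proof. by rewrite sqr_sqrtr //; apply: sumr_ge0 => i _; exact: sqr_ge0. Qed.

Lemma sum_pair i j (h : 'I_3 -> R) : i != j ->
  \sum_l h l = h i + h j + \sum_(l | (l != i) && (l != j)) h l.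
Proof. by move=> ij; rewrite (bigD1 i) //= (bigD1 j) 1?eq_sym //= addrA. Qed.

Lemma rot_dot i j c s (x y : V) : i != j -> c ^+ 2 + s ^+ 2 = 1 ->
  \sum_l prot i j c s x 0 l * prot i j c s y 0 l = \sum_l x 0 l * y 0 l.
Proof.
move=> ij cs; rewrite !(sum_pair _ ij); congr (_ + _); last first.
  by apply: eq_bigr => l /andP[/negbTE li /negbTE lj]; rewrite !mxE li lj.
rewrite !mxE !eqxx eq_sym (negbTE ij).
have -> : x 0 i * y 0 i + x 0 j * y 0 j =
  (c ^+ 2 + s ^+ 2) * (x 0 i * y 0 i + x 0 j * y 0 j) by rewrite cs mul1r.
by ring.
Qed.

Lemma enorm_rot i j c s x : i != j -> c ^+ 2 + s ^+ 2 = 1 ->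
  enorm (prot i j c s x) = enorm x.
Proof.
move=> ij cs; rewrite /enorm; congr Num.sqrt.
by under eq_bigr do rewrite expr2; rewrite rot_dot //; under eq_bigr do rewrite -expr2.
Qed.

End Rotations.

(** * Polar coordinates as an inequality *)

Section Polar.
Context {R : realType}.

Lemma norm_sqr1 (e : R) : e ^+ 2 = 1 -> `|e| = 1.
Proof.
by move=> ee; apply/eqP; rewrite -(@eqrXn2 _ 2) // real_normK ?num_real // ee expr1n.
Qed.

Local Notation leb := (@lebesgue_measure R).
Local Notation V := 'rV[R]_3.

(** The sign [s] treats increasing and decreasing maps at once. *)
Lemma expanding_of_derive (f df : R -> R) (a b m s : R) :
  (forall x : R, is_derive x 1 f (df x)) -> s ^+ 2 = 1 ->
  (forall x, x \in `[a, b] -> m <= s * df x) ->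
  expanding_on `[a, b] m f.
Proof.
move=> fdf s1 mdf.
have sn := norm_sqr1 s1.
suff h x y : x <= y -> x \in `[a, b] -> y \in `[a, b] ->
    m * `|x - y| <= `|f x - f y|.
  move=> x y /= xab yab; have [xy|/ltW yx] := leP x y; first exact: h.
  by rewrite distrC [leRHS]distrC; exact: h.
move=> xy xab yab.
have [|c cxy fE] := @MVT_segment R f df x y xy.
  apply: continuous_subspaceT => z; apply/differentiable_continuous/derivable1_diffP.
  by have [] := fdf z.
rewrite distrC [leRHS]distrC fE normrM ler_wpM2r //.
have cab : c \in `[a, b].
  move: cxy xab yab; rewrite !in_itv /= => /andP[xc cy] /andP[ax _] /andP[_ yb].
  by rewrite (le_trans ax xc) (le_trans cy yb).
apply: le_trans (mdf _ cab) _.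
by rewrite -[`|df c|]mul1r -sn -normrM ler_norm.
Qed.

Lemma lipschitz_of_derive (f df : R -> R) (m : R) :
  (forall x : R, is_derive x 1 f (df x)) -> (forall x, `|df x| <= m) ->
  forall x y, `|f x - f y| <= m * `|x - y|.
Proof.
move=> fdf dfm.
suff h x y : x <= y -> `|f x - f y| <= m * `|x - y|.
  move=> x y; have [xy|/ltW yx] := leP x y; first exact: h.
  by rewrite distrC [`|x - y|]distrC; exact: h.
move=> xy.
have [|c cxy fE] := @MVT_segment R f df x y xy.
  apply: continuous_subspaceT => z; apply/differentiable_continuous/derivable1_diffP.
  by have [] := fdf z.
by rewrite distrC [`|x - y|]distrC fE normrM ler_wpM2r.
Qed.

Lemma sin_le x : `|sin x : R| <= `|x|.
Proof.
have := @lipschitz_of_derive sin cos 1 (@is_derive_sin R) (@cos_max R) x 0.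
by rewrite sin0 !subr0 mul1r.
Qed.

Lemma cos_ge x : 1 - `|x| <= (cos x : R).
Proof.
have h y : `|- sin y : R| <= 1 by rewrite normrN sin_max.
have := @lipschitz_of_derive cos (fun x => - sin x) 1 (@is_derive_cos R) h x 0.
rewrite cos0 subr0 mul1r => /ler_normlP[+ _]; lra.
Qed.

(** The third coordinate of the point of the sphere of radius [rho] whose two others are [a] and
    [b], in the hemisphere of sign [sg]. *)
Definition sqrt_complement (sg rho a b : R) : R :=
  sg * Num.sqrt (rho ^+ 2 - a ^+ 2 - b ^+ 2).

Lemma sqrt_complement_expanding (sg a b al be : R) : sg ^+ 2 = 1 -> 0 < al ->
  expanding_on [set rho | rho \in `[al, be] /\ a ^+ 2 + b ^+ 2 < rho ^+ 2] 1
    (fun rho => sqrt_complement sg rho a b).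
Proof.
move=> sg1 al0 x y /= [+ xab] [+ yab]; rewrite !in_itv /= => /andP[ax _] /andP[ay _].
rewrite mul1r /sqrt_complement -mulrBr normrM.
rewrite (norm_sqr1 sg1) mul1r.
have x0 : 0 < x by apply: lt_le_trans ax.
have y0 : 0 < y by apply: lt_le_trans ay.
set p := Num.sqrt _; set q := Num.sqrt _.
have p0 : 0 < p by rewrite sqrtr_gt0; lra.
have q0 : 0 < q by rewrite sqrtr_gt0; lra.
have p2 : p ^+ 2 = x ^+ 2 - a ^+ 2 - b ^+ 2 by rewrite sqr_sqrtr //; lra.
have q2 : q ^+ 2 = y ^+ 2 - a ^+ 2 - b ^+ 2 by rewrite sqr_sqrtr //; lra.
have a0 := sqr_ge0 a; have b0 := sqr_ge0 b.
have px : p <= x.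
  rewrite -(@ler_pXn2r _ 2) ?nnegrE ?(ltW p0) ?(ltW x0) //.
  rewrite p2.
  lra.
have qy : q <= y by rewrite -(@ler_pXn2r _ 2) ?nnegrE ?(ltW q0) ?(ltW y0) // q2; lra.
have e : (x - y) * (x + y) = (p - q) * (p + q).
  by rewrite -!subr_sqr p2 q2; ring.
have := congr1 Num.norm e; rewrite !normrM.
rewrite (ger0_norm (_ : 0 <= x + y)); last by lra.
rewrite (ger0_norm (_ : 0 <= p + q)); last by lra.
move=> e'; rewrite -(@ler_pM2r _ (x + y)); last by lra.
by rewrite e' ler_wpM2l //; lra.
Qed.

(* [Rf th] is the rotation of angle [e * th] in the plane of the axes k and i. *)
Definition planar (k i : 'I_3) (e : R) (Rf : R -> V -> V) :=
  forall th x, [/\ Rf th x 0 k = cos th * x 0 k - e * sin th * x 0 i,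
    Rf th x 0 i = cos th * x 0 i + e * sin th * x 0 k &
    forall l, l != k -> l != i -> Rf th x 0 l = x 0 l].

Lemma planar_sqr k i e Rf th x : k != i -> e ^+ 2 = 1 -> planar k i e Rf ->
  \sum_l Rf th x 0 l ^+ 2 = \sum_l x 0 l ^+ 2.
Proof.
move=> ki e1 pR; rewrite !(sum_pair _ ki); congr (_ + _); last first.
  apply: eq_bigr => l /andP[lk li]; have [_ _ ->] := pR th x; by [].
have [-> -> _] := pR th x.
have cs := cos2Dsin2 th.
transitivity ((cos th ^+ 2 + e ^+ 2 * sin th ^+ 2) * (x 0 k ^+ 2 + x 0 i ^+ 2)); first by ring.
by rewrite e1 mul1r cs mul1r.
Qed.

Lemma planar_coord_derive (A B e rho x : R) : e ^+ 2 = 1 ->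
  is_derive x 1 (fun th => rho * (cos th * A + e * sin th * B))
    (rho * (e * (cos x * B - e * sin x * A))).
Proof.
move=> e1; apply: is_derive_eq.
rewrite /GRing.scale /=.
transitivity (rho * (e ^+ 2 * (A * - sin x) + B * (e * cos x))); last by ring.
by rewrite e1 mul1r; ring.
Qed.

Local Open Scope ereal_scope.

Lemma measurable_comp3 (K : R -> R -> R -> \bar R) d (T : measurableType d)
    (f1 f2 f3 : T -> R) :
  measurable_fun [set: R * R * R] (fun q : R * R * R => K q.1.1 q.1.2 q.2) ->
  measurable_fun [set: T] f1 -> measurable_fun [set: T] f2 ->
  measurable_fun [set: T] f3 ->
  measurable_fun [set: T] (fun s => K (f1 s) (f2 s) (f3 s)).
Proof.
move=> mK m1 m2 m3.
exact: (measurableT_comp mK (measurable_fun_pair (measurable_fun_pair m1 m2) m3)).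
Qed.

(** Cartesian coordinates are introduced one at a time: [th'] is traded for coordinate [j], [th] for
    coordinate [i], [rho] for coordinate [k]. While coordinate [k] of the direction is at least 1/4
    in absolute value, each angular map expands by [rho / 4], and the two factors [4 / rho] turn the
    weight [rho^2] into 16; the radial map expands by 1. *)
Lemma polar_bound (k : 'I_3) (e1 e2 sg al be : R) (R1 R2 : R -> V -> V)
    (om : V) (H : V -> \bar R) :
  let i := lift k ord0 in let j := lift k ord_max in
  (e1 ^+ 2 = 1)%R -> (e2 ^+ 2 = 1)%R -> (sg ^+ 2 = 1)%R -> (0 < al)%R ->
  planar k i e1 R1 -> planar k j e2 R2 ->
  (\sum_l om 0 l ^+ 2 = 1)%R -> (1 / 2 <= sg * om 0 k)%R ->
  measurable3 H -> (forall x, 0 <= H x) ->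
  \int[leb]_(rho in `[al, be]) ((rho ^+ 2)%:E * \int[leb]_(th in `[0%R, (1 / 16)%R])
     \int[leb]_(th' in `[0%R, (1 / 16)%R]) H (rho *: R2 th' (R1 th om))%R)
  <= 16%:E * int3 setT H.
Proof.
move=> i j e11 e21 sg1 al0 p1 p2 om1 omk mH H0.
have ki : k != i by exact: neq_lift.
have kj : k != j by exact: neq_lift.
have ij : i != j by rewrite (inj_eq lift_inj).
have om_le1 (x : V) l : (\sum_l x 0 l ^+ 2 = 1)%R -> (`|x 0%R l| <= 1)%R.
  move=> x1; rewrite -(@ler_pXn2r _ 2) ?nnegrE // real_normK ?num_real // expr1n -x1.
  by rewrite (bigD1 l) //= lerDl; apply: sumr_ge0 => *; exact: sqr_ge0.
have sgn := norm_sqr1 sg1.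
(* A rotation by at most 1/16 moves coordinate [k] of a unit vector by at most
   [(1 - cos th) + |sin th| <= 1/8]. Two of them bring the initial 1/2 down to 3/8 and then to
   1/4. *)
have step e (l : 'I_3) (Rf : R -> V -> V) th (x : V) : (e ^+ 2 = 1)%R -> planar k l e Rf ->
    (\sum_l x 0 l ^+ 2 = 1)%R -> th \in `[0%R, (1 / 16)%R] ->
    (sg * x 0 k - 1 / 8 <= sg * Rf th x 0 k)%R.
  move=> ee pl x1 /[!in_itv] /= /andP[th0 th1].
  have [-> _ _] := pl th x.
  have thn : (`|th| <= 1 / 16)%R by rewrite ger0_norm.
  have c1 := cos_ge th; have c2 := cos_le1 th; have s1 := sin_le th.
  rewrite -subr_ge0.
  have -> : (sg * (cos th * x 0 k - e * sin th * x 0 l) - (sg * x 0 k - 1 / 8) =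
    1 / 8 - (sg * ((1 - cos th) * x 0 k + e * sin th * x 0 l)))%R by ring.
  rewrite subr_ge0; apply: (le_trans (ler_norm _)).
  rewrite normrM sgn [X in (X <= _)%R]mul1r; apply: (le_trans (ler_normD _ _)).
  rewrite !normrM (norm_sqr1 ee) [X in (_ + X * _ <= _)%R]mul1r.
  have -> : (1 / 8 = 1 / 16 * 1 + 1 / 16 * 1 :> R)%R by field.
  apply: lerD; apply: ler_pM => //; try exact: om_le1.
  - by rewrite ger0_norm; lra.
  - by lra.
(* [H] at the point of the sphere with coordinates [a] and [b] along the axes [i] and [j], in the
   hemisphere [sg], and 0 off the disc [a^2 + b^2 < rho^2]. *)
pose K (rho a b : R) : \bar R := if (a ^+ 2 + b ^+ 2 < rho ^+ 2)%R then
   H (insert3 k a b (sqrt_complement sg rho a b)) else 0.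
have K0 rho a b : 0 <= K rho a b by rewrite /K; case: ifP.
have mK : measurable_fun [set: R * R * R]
    (fun q : R * R * R => K q.1.1 q.1.2 q.2).
  have m1 : measurable_fun [set: R * R * R] (fun q : R * R * R => q.1.1).
    exact: measurableT_comp measurable_fst measurable_fst.
  have m2 : measurable_fun [set: R * R * R] (fun q : R * R * R => q.1.2).
    exact: measurableT_comp measurable_snd measurable_fst.
  have m3 : measurable_fun [set: R * R * R] (fun q : R * R * R => q.2).
    exact: measurable_snd.
  apply: measurable_fun_ifT; last exact: measurable_cst.
    apply: measurable_fun_ltr; last exact: measurable_funX.
    by apply: measurable_funD; exact: measurable_funX.
  apply: measurable_insert3 => //.
  apply: measurable_funM; first exact: measurable_cst.
  apply: (measurableT_comp (continuous_measurable_fun (@sqrt_continuous R))).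
  by apply: measurable_funB; [apply: measurable_funB|]; exact: measurable_funX.
have c1P th : th \in `[0%R, (1 / 16)%R] -> (3 / 8 <= sg * R1 th om 0 k)%R.
  by move=> /(step _ _ _ _ om e11 p1 om1); lra.
have R1om th : (\sum_l R1 th om 0 l ^+ 2 = 1)%R.
  by rewrite (planar_sqr _ _ ki e11 p1).
have c2P th th' : th \in `[0%R, (1 / 16)%R] -> th' \in `[0%R, (1 / 16)%R] ->
    (1 / 4 <= sg * R2 th' (R1 th om) 0 k)%R.
  move=> /c1P h /(step _ _ _ _ _ e21 p2 (R1om th)); lra.
have HK rho th th' : (0 < rho)%R -> th \in `[0%R, (1 / 16)%R] -> th' \in `[0%R, (1 / 16)%R] ->
    H (rho *: R2 th' (R1 th om))%R =
    K rho (rho * R1 th om 0 i)%R (rho * R2 th' (R1 th om) 0 j)%R.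
  move=> rho0 hth hth'; set y := R2 th' (R1 th om).
  (* The second rotation, in the plane of [k] and [j], fixes coordinate [i]: this coordinate depends
     on [th] alone, and the two angular integrals can be bounded one after the other. *)
  have yi : R1 th om 0%R i = y 0%R i.
    by have [_ _ ->] := p2 th' (R1 th om); rewrite // eq_sym.
  have yk := c2P _ _ hth hth'; rewrite -/y in yk.
  have y1 : (y 0 k ^+ 2 + y 0 i ^+ 2 + y 0 j ^+ 2 = 1)%R.
    by rewrite -(sum3E k (fun l => y 0 l ^+ 2)%R) (planar_sqr _ _ kj e21 p2).
  have yk2 : (0 < y 0 k ^+ 2)%R.
    have -> : (y 0 k ^+ 2 = (sg * y 0 k) ^+ 2)%R by rewrite exprMn sg1 mul1r.
    by rewrite exprn_gt0 //; lra.
  rewrite /K yi ifT; last first.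
    rewrite -subr_gt0.
    have -> : (rho ^+ 2 - ((rho * y 0 i) ^+ 2 + (rho * y 0 j) ^+ 2) =
      rho ^+ 2 * (y 0 k ^+ 2 + y 0 i ^+ 2 + y 0 j ^+ 2) -
      ((rho * y 0 i) ^+ 2 + (rho * y 0 j) ^+ 2))%R by rewrite y1 mulr1.
    by rewrite (_ : (_ - _ = rho ^+ 2 * y 0 k ^+ 2)%R); [rewrite mulr_gt0 // exprn_gt0|ring].
  congr H; rewrite [LHS](insert3E k) !mxE -/i -/j; congr insert3.
  rewrite /sqrt_complement.
  have -> : (rho ^+ 2 - (rho * y 0 i) ^+ 2 - (rho * y 0 j) ^+ 2 =
      (rho * (sg * y 0 k)) ^+ 2)%R.
    transitivity (rho ^+ 2 * (y 0 k ^+ 2 + y 0 i ^+ 2 + y 0 j ^+ 2) -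
      ((rho * y 0 i) ^+ 2 + (rho * y 0 j) ^+ 2))%R.
      by rewrite y1 mulr1; ring.
    rewrite !exprMn sg1; ring.
  rewrite sqrtr_sqr ger0_norm; last by rewrite mulr_ge0 //; lra.
  transitivity (sg ^+ 2 * (rho * y 0 k))%R; [by rewrite sg1 mul1r|ring].
have mi : measurable [set` `[0%R, (1 / 16 : R)%R]] by exact: measurable_itv.
have inner rho th : (al <= rho)%R -> th \in `[0%R, (1 / 16)%R] ->
    \int[leb]_(th' in `[0%R, (1 / 16)%R]) H (rho *: R2 th' (R1 th om))%R <=
    (4 / rho)%:E * \int[leb]_b K rho (rho * R1 th om 0 i)%R b.
  move=> rhoal hth; have rho0 : (0 < rho)%R by apply: lt_le_trans rhoal.
  pose gam th' := (rho * (cos th' * R1 th om 0 j + e2 * sin th' * R1 th om 0 k))%R.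
  have gamE th' : (rho * R2 th' (R1 th om) 0 j)%R = gam th'.
    by rewrite /gam; have [_ -> _] := p2 th' (R1 th om).
  have -> : \int[leb]_(th' in `[0%R, (1 / 16)%R]) H (rho *: R2 th' (R1 th om))%R =
      \int[leb]_(th' in `[0%R, (1 / 16)%R]) K rho (rho * R1 th om 0 i)%R (gam th').
    by apply: eq_integral => th' /set_mem hth'; rewrite -gamE HK.
  have dg := fun x : R => planar_coord_derive (R1 th om 0 j)%R (R1 th om 0 k)%R rho x e21.
  have -> : (4 / rho)%:E = (rho / 4)^-1%:E by rewrite invf_div.
  apply: integral_expanding => //.
  - apply: continuous_measurable_fun => z; apply/differentiable_continuous/derivable1_diffP.
    by have [] := dg z.
  - by rewrite divr_gt0.
  - apply: (expanding_of_derive (s := (e2 * sg)%R) dg); first by rewrite exprMn e21 sg1 mulr1.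
    move=> x hx; have := c2P _ _ hth hx.
    have [-> _ _] := p2 x (R1 th om) => h.
    (* Under the rotation, coordinate [j] has derivative [e2] times coordinate [k], and the sign
       [e2 * sg] makes it at least 1/4 before the scaling by [rho]. *)
    have -> : (e2 * sg * (rho * (e2 * (cos x * R1 th om 0 k - e2 * sin x * R1 th om 0 j))) =
      e2 ^+ 2 * (rho * (sg * (cos x * R1 th om 0 k - e2 * sin x * R1 th om 0 j))))%R by ring.
    rewrite e21 mul1r; rewrite ler_pM2l //; lra.
  - exact: (measurable_comp3 mK (measurable_cst rho)
      (measurable_cst (rho * R1 th om 0 i)%R) (@measurable_id _ R setT)).
have mK2 rho : measurable_fun [set: R] (fun a => \int[leb]_b K rho a b).
  apply: (measurable_int_snd (G := fun a b => K rho a b)) => //.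
  exact: (measurable_comp3 mK (measurable_cst rho) measurable_fst measurable_snd).
have outer rho : (al <= rho)%R ->
    \int[leb]_(th in `[0%R, (1 / 16)%R]) \int[leb]_b K rho (rho * R1 th om 0 i)%R b <=
    (4 / rho)%:E * \int[leb]_a \int[leb]_b K rho a b.
  move=> rhoal; have rho0 : (0 < rho)%R by apply: lt_le_trans rhoal.
  pose gam th := (rho * (cos th * om 0 i + e1 * sin th * om 0 k))%R.
  have gamE th : (rho * R1 th om 0 i)%R = gam th.
    by rewrite /gam; have [_ -> _] := p1 th om.
  have -> : \int[leb]_(th in `[0%R, (1 / 16)%R]) \int[leb]_b K rho (rho * R1 th om 0 i)%R b =
      \int[leb]_(th in `[0%R, (1 / 16)%R]) \int[leb]_b K rho (gam th) b.
    by apply: eq_integral => th _; rewrite -gamE.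
  have dg := fun x : R => planar_coord_derive (om 0 i)%R (om 0 k)%R rho x e11.
  have -> : (4 / rho)%:E = (rho / 4)^-1%:E by rewrite invf_div.
  apply: (@integral_expanding R _ _ gam (fun a => \int[leb]_b K rho a b)) => //.
  - apply: continuous_measurable_fun => z; apply/differentiable_continuous/derivable1_diffP.
    by have [] := dg z.
  - by rewrite divr_gt0.
  - apply: (expanding_of_derive (s := (e1 * sg)%R) dg); first by rewrite exprMn e11 sg1 mulr1.
    move=> x hx; have := c1P _ hx.
    have [-> _ _] := p1 x om => h.
    have -> : (e1 * sg * (rho * (e1 * (cos x * om 0 k - e1 * sin x * om 0 i))) =
      e1 ^+ 2 * (rho * (sg * (cos x * om 0 k - e1 * sin x * om 0 i))))%R by ring.
    rewrite e11 mul1r; rewrite ler_pM2l //; lra.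
  - by move=> a; exact: integral_ge0.
have mKr : measurable_fun [set: R * R] (fun q : R * R => \int[leb]_b K q.1 q.2 b).
  by apply: measurable_int_snd.
have mKrr : measurable_fun [set: R] (fun rho => \int[leb]_a \int[leb]_b K rho a b).
  apply: (measurable_int_snd (G := fun rho a => \int[leb]_b K rho a b)) => // a b.
  exact: integral_ge0.
have K1 rho : 0 <= \int[leb]_a \int[leb]_b K rho a b.
  by apply: integral_ge0 => a _; exact: integral_ge0.
apply: (@le_trans _ _ (\int[leb]_(rho in `[al, be]) (16%:E * \int[leb]_a \int[leb]_b K rho a b))).
  apply: ge0_le_integral_nomeas => rho /=; rewrite in_itv /= => /andP[rhoal _].
    rewrite mule_ge0 ?lee_fin ?sqr_ge0 //.
    by apply: integral_ge0 => a _; exact: integral_ge0.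
  have rho0 : (0 < rho)%R by apply: lt_le_trans rhoal.
  have q0 : (0 <= 4 / rho)%R by rewrite divr_ge0 // ltW.
  apply: (@le_trans _ _ ((rho ^+ 2)%:E * \int[leb]_(th in `[0%R, (1 / 16)%R])
      ((4 / rho)%:E * \int[leb]_b K rho (rho * R1 th om 0 i)%R b))).
    apply: lee_wpmul2l; first by rewrite lee_fin sqr_ge0.
    apply: ge0_le_integral_nomeas => th hth; first exact: integral_ge0.
    exact: inner.
  have mKth : measurable_fun ([set` `[0%R, (1 / 16)%R]] : set R) (fun th : R => \int[leb]_b K rho (rho * R1 th om 0 i)%R b).
    apply: measurable_funTS; apply: (measurableT_comp (mK2 rho)).
    rewrite (_ : (fun _ => _) = fun th => (rho * (cos th * om 0 i + e1 * sin th * om 0 k))%R); last first.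
      by apply/funext => th; have [_ -> _] := p1 th om.
    apply: continuous_measurable_fun => z; apply/differentiable_continuous/derivable1_diffP.
    by have [] := planar_coord_derive (om 0 i)%R (om 0 k)%R rho z e11.
  rewrite ge0_integralZl //; last by move=> *; exact: integral_ge0.
  rewrite muleA -EFinM.
  apply: (@le_trans _ _ ((rho ^+ 2 * (4 / rho))%:E * ((4 / rho)%:E * \int[leb]_a \int[leb]_b K rho a b))).
    apply: lee_wpmul2l; first by rewrite lee_fin mulr_ge0 // sqr_ge0.
    exact: outer.
  rewrite muleA -EFinM (_ : (rho ^+ 2 * (4 / rho) * (4 / rho) = 16)%R) //.
  by field; rewrite gt_eqF.
rewrite ge0_integralZl //; last exact: measurable_funTS.
apply: lee_wpmul2l; first by rewrite lee_fin.
(* The constraint on [rho] moves into the integrand, so that [rho] can be exchanged with [a] and [b]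
   and become the innermost variable. *)
pose K' rho a b := if rho \in `[al, be] then K rho a b else 0.
have K'0 rho a b : 0 <= K' rho a b by rewrite /K'; case: ifP.
have mK' : measurable_fun [set: R * R * R] (fun q : R * R * R => K' q.1.1 q.1.2 q.2).
  apply: measurable_fun_ifT => //.
  rewrite (_ : (fun _ => _) = fun q : R * R * R => (al <= q.1.1) && (q.1.1 <= be))%R; last first.
    by apply/funext => q; rewrite in_itv.
  have m1 : measurable_fun [set: R * R * R] (fun q : R * R * R => q.1.1).
    exact: measurableT_comp measurable_fst measurable_fst.
  by apply: measurable_and; apply: measurable_fun_ler.
have -> : \int[leb]_(rho in `[al, be]) \int[leb]_a \int[leb]_b K rho a b =
    \int[leb]_rho \int[leb]_a \int[leb]_b K' rho a b.
  rewrite integral_mkcond; apply: eq_integral => rho _; rewrite /patch /K' mem_setE.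
  by case: ifP => // _; rewrite [RHS]integral0_eq // => a _; exact: integral0_eq.
rewrite (tonelli2 (G := fun rho a => \int[leb]_b K' rho a b)); last 2 first.
- exact: measurable_int_snd.
- by move=> *; exact: integral_ge0.
rewrite (int3_insert k mH H0).
apply: ge0_le_integral_nomeas => a _.
  by apply: integral_ge0 => b _; exact: integral_ge0.
rewrite (tonelli2 (G := fun rho b => K' rho a b)); last 2 first.
- exact: (measurable_comp3 mK' measurable_fst (measurable_cst a) measurable_snd).
- by [].
apply: ge0_le_integral_nomeas => b _; first exact: integral_ge0.
pose D := [set rho | rho \in `[al, be] /\ (a ^+ 2 + b ^+ 2 < rho ^+ 2)%R].
have mD : measurable D.
  apply: measurableI; first exact: measurable_itv.
  have := measurable_fun_ltr (measurable_cst (a ^+ 2 + b ^+ 2)%R)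
    (measurable_funX 2 (@measurable_id _ R setT)).
  by move=> /(_ measurableT [set true] I); rewrite setTI.
have -> : \int[leb]_rho K' rho a b =
    \int[leb]_(rho in D) H (insert3 k a b (sqrt_complement sg rho a b)).
  rewrite [RHS]integral_mkcond; apply: eq_integral => rho _.
  rewrite /patch /K' /K; case: ifP => [h1|h1].
    case: ifP => [h2|h2]; first by rewrite mem_set.
    by rewrite memNset // => -[_]; rewrite h2.
  by rewrite memNset // => -[]; rewrite h1.
have := @integral_expanding R D 1 (fun rho => sqrt_complement sg rho a b)
  (fun c => H (insert3 k a b c)) mD.
rewrite invr1 mul1e; apply => //.
- apply: measurable_funM; first exact: measurable_cst.
  apply: (measurableT_comp (continuous_measurable_fun (@sqrt_continuous R))).
  by apply: measurable_funB => //; apply: measurable_funB => //; exact: measurable_funX.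
- exact: sqrt_complement_expanding.
- exact: measurable_insert3.
Qed.
End Polar.

(** * Functions on the phase space *)

Section OpenMeasurable.
Context {R : realType}.

(* [nb] is the neighborhood filter of a topology with a countable base
   consisting of measurable sets *)
Definition measurable_nbhs d (T : measurableType d) (nb : T -> set (set T)) :=
  exists B : nat -> set T, (forall n, measurable (B n)) /\
  forall x U, nb x U -> exists n, B n x /\ B n `<=` U.

Lemma measurable_nbhs_open d (T : measurableType d) nb (U : set T) :
  measurable_nbhs nb -> (forall x, U x -> nb x U) -> measurable U.
Proof.
move=> [B [mB hB]] oU.
rewrite (_ : U = \bigcup_(n in [set n | B n `<=` U]) B n).
  by apply: bigcup_measurable.
apply/seteqP; split => [x Ux|x [n /= BU Bx]]; last exact: BU.
by have [n [Bx BU]] := hB _ _ (oU _ Ux); exists n.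
Qed.

Lemma measurable_nbhs_real : measurable_nbhs (fun x : R => nbhs x).
Proof.
pose Bq (q : rat * rat) : set R := ball (ratr q.1 : R) (ratr q.2 : R).
exists (fun n => if unpickle n is Some q then Bq q else set0); split.
  by move=> n; case: unpickle => // q; exact: measurable_ball.
move=> x U; rewrite nbhsE => -[W [oW /mem_set Wx] WU].
have [c [r [/set_mem cx cO]]] := open_subball_rat oW Wx.
by exists (pickle (c, r)); rewrite pickleK; split => // y /cO /WU.
Qed.

Lemma measurable_nbhs_prod d1 d2 (T1 : measurableType d1)
    (T2 : measurableType d2) nb1 nb2 :
  measurable_nbhs (nb1 : T1 -> _) -> measurable_nbhs (nb2 : T2 -> _) ->
  measurable_nbhs (fun x : T1 * T2 => filter_prod (nb1 x.1) (nb2 x.2)).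
Proof.
move=> [B1 [mB1 hB1]] [B2 [mB2 hB2]].
exists (fun n => if unpickle n is Some (a, b) then B1 a `*` B2 b else set0); split.
  by move=> n; case: unpickle => // -[a b]; exact: measurableX.
move=> [x y] U [[P Q] /= [Px Qy] PQU].
have [a [Ba aP]] := hB1 _ _ Px; have [b [Bb bQ]] := hB2 _ _ Qy.
exists (pickle (a, b)); rewrite pickleK; split => // -[u v] [/= /aP Pu /bQ Qv].
exact: PQU.
Qed.

(** The countable base puts the open sets of a product topology into the product sigma-algebra. The
    hypothesis is continuity on an open set [D], in the application the part of the phase space
    where [v] is nonzero. *)
Lemma measurable_fun_nbhs d (T : measurableType d) nb (D : set T) (f : T -> R) :
  measurable_nbhs nb ->
  (forall x (O : set R), open O -> D x -> O (f x) -> nb x (D `&` f @^-1` O)) ->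
  measurable_fun D f.
Proof.
move=> mnb cf mD; apply: (measurability _ (RGenOpens.measurableE R)) => //.
move=> _ [_ [a [b ->] <-]].
by apply: (measurable_nbhs_open mnb) => x [Dx fx]; apply: cf.
Qed.

Local Notation E := (R * R * R)%type.

Lemma measurable_nbhs_space : measurable_nbhs (fun x : E => nbhs x).
Proof.
exact: measurable_nbhs_prod (measurable_nbhs_prod measurable_nbhs_real measurable_nbhs_real) measurable_nbhs_real.
Qed.

Lemma measurable_nbhs_phase : measurable_nbhs (fun x : E * E => nbhs x).
Proof. exact: measurable_nbhs_prod measurable_nbhs_space measurable_nbhs_space. Qed.

End OpenMeasurable.

(** * Continuous partial derivatives and the chain rule *)

Section ChainRule.
Context {R : realType}.

Lemma line_is_derive (W : normedModType R) (F : W -> R) (q e : W) (tau : R) :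
  derivable F (q + tau *: e) e ->
  is_derive tau 1 (fun s : R => F (q + s *: e)) ('D_e F (q + tau *: e)).
Proof.
move=> dF.
have fE : (fun h : R => h^-1 *: (F (h *: e + (q + tau *: e)) - F (q + tau *: e))) =
    (fun h : R => h^-1 *: (F (q + (h *: (1 : R^o) + tau) *: e) - F (q + tau *: e))).
  apply/funext => h; rewrite (_ : h *: (1 : R^o) = h); last exact: mulr1.
  by rewrite scalerDl addrCA.
have -> : 'D_e F (q + tau *: e) = 'D_1 (fun s : R => F (q + s *: e)) tau.
  by rewrite /derive; move: fE => /= ->.
by apply/derivableP; move: dF; rewrite /derivable; move: fE => /= ->.
Qed.

Lemma line_MVT (W : normedModType R) (F : W -> R) (q e : W) (c : R) :
  (forall s : R, `|s| <= `|c| -> derivable F (q + s *: e) e) ->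
  exists2 s, `|s| <= `|c| & F (q + c *: e) - F q = c * 'D_e F (q + s *: e).
Proof.
move=> dF.
have der s : `|s| <= `|c| -> is_derive s (1 : R) (fun s : R => F (q + s *: e)) ('D_e F (q + s *: e)).
  by move=> sc; apply: line_is_derive; exact: dF.
have cont (a b : R) : (forall s, s \in `[a, b] -> `|s| <= `|c|) ->
    {within `[a, b], continuous (fun s : R => F (q + s *: e))}.
  move=> h; apply: derivable_within_continuous => s sab.
  by have [] := der s (h s sab).
have [c0|c0] := leP 0 c.
  have h s : s \in `[0, c] -> `|s| <= `|c|.
    by rewrite in_itv /= => /andP[s0 sc]; rewrite !ger0_norm.
  have [|s sc] := @MVT_segment R (fun s : R => F (q + s *: e))
      (fun s => 'D_e F (q + s *: e)) 0 c c0 _ (cont _ _ h).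
    move=> s /subset_itv_oo_cc sc; exact: der (h _ sc).
  by rewrite scale0r addr0 subr0 mulrC => ->; exists s => //; exact: h.
have h s : s \in `[c, 0] -> `|s| <= `|c|.
  rewrite in_itv /= => /andP[s0 sc]; rewrite !ler0_norm //; first by rewrite lerN2.
  exact: ltW.
have [|s sc] := @MVT_segment R (fun s : R => F (q + s *: e))
    (fun s => 'D_e F (q + s *: e)) c 0 (ltW c0) _ (cont _ _ h).
  move=> s /subset_itv_oo_cc sc; exact: der (h _ sc).
rewrite scale0r addr0 sub0r mulrN => Eq; exists s; first exact: h.
by rewrite -opprB Eq opprK mulrC.
Qed.

Lemma cvg_sumr n T (A : set_system T) {FA : Filter A} (f : 'I_n -> T -> R) (l : 'I_n -> R) :
  (forall i, f i x @[x --> A] --> l i) ->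
  \sum_i f i x @[x --> A] --> \sum_i l i.
Proof. by move=> fl; apply: cvg_big => [|i _]; [exact: add_continuous|exact: fl]. Qed.

(** The directions are added one at a time; the mean value theorem bounds the error of each
    increment by the oscillation of a single partial derivative near [p]. *)
Lemma partials_expansion (W : normedModType R) n (e : 'I_n -> W) (F : W -> R) (p : W) :
  (forall i, \forall q \near p, derivable F q (e i)) ->
  (forall i, {for p, continuous (fun q => 'D_(e i) F q)}) ->
  forall eps : R, 0 < eps -> exists2 delta : R, 0 < delta &
  forall c : 'I_n -> R, (forall i, `|c i| <= delta) ->
  `|F (p + \sum_i c i *: e i) - F p - \sum_i c i * 'D_(e i) F p|
     <= eps * \sum_i `|c i|.
Proof.
elim: n e => [|n IH] e dF cF eps eps0.
  by exists 1 => // c _; rewrite !big_ord0 addr0 !subrr normr0 mulr0.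
pose e' i := e (widen_ord (leqnSn n) i).
have [d1 d10 hd1] := IH e' (fun i => dF _) (fun i => cF _) _ eps0.
have : \forall q \near p, derivable F q (e ord_max) /\
    `|'D_(e ord_max) F p - 'D_(e ord_max) F q| < eps.
  near=> q; split; first by near: q; exact: dF.
  by near: q; have /cvgrPdist_lt := cF ord_max; apply.
move=> /nbhs_ballP[r /= r0 hr].
(* With [|c i| <= r / 2 / M] the broken line from [p] stays in the ball of radius [r]; the 1 in [M]
   avoids a division by 0. *)
pose M := 1 + \sum_i `|e i|.
have M0 : 0 < M by rewrite ltr_wpDr // sumr_ge0.
exists (Num.min d1 (r / 2 / M)).
  by rewrite lt_min d10 divr_gt0 // divr_gt0.
move=> c hc.
have cd1 i : `|c i| <= d1 by apply: le_trans (hc i) _; rewrite ge_min lexx.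
have cr i : `|c i| <= r / 2 / M.
  by apply: le_trans (hc i) _; rewrite ge_min lexx orbT.
pose c' i := c (widen_ord (leqnSn n) i).
pose q := p + \sum_i c' i *: e' i.
have near_p (s : R) : `|s| <= `|c ord_max| -> ball p r (q + s *: e ord_max).
  move=> sc; rewrite -ball_normE /= /q opprD addrA opprD addNKr -opprD normrN.
  apply: le_lt_trans (ler_normD _ _) _; rewrite normrZ.
  apply: (@le_lt_trans _ _ (r / 2 / M * \sum_i `|e i|)).
    rewrite big_ord_recr /= mulrDr; apply: lerD; last first.
      by rewrite ler_wpM2r //; exact: le_trans sc (cr _).
    apply: le_trans (ler_norm_sum _ _ _) _; rewrite mulr_sumr; apply: ler_sum => i _.
    by rewrite normrZ; apply: ler_wpM2r => //; exact: cr.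
  apply: (@le_lt_trans _ _ (r / 2)); last by rewrite ltr_pdivrMr // mulr_natr mulr2n ltrDl.
  rewrite -[leRHS](@divfK _ M) ?gt_eqF // ler_wpM2l //.
    by rewrite divr_ge0 // ltW // divr_gt0.
  by rewrite /M lerDr.
have [|s sc Es] := @line_MVT W F q (e ord_max) (c ord_max).
  by move=> s sc; have [] := hr _ (near_p _ sc).
rewrite [X in F (p + X)]big_ord_recr [X in _ - _ - X]big_ord_recr [X in eps * X]big_ord_recr /=.
rewrite addrA -/q.
have -> : F (q + c ord_max *: e ord_max) - F p -
   (\sum_(i < n) c (widen_ord (leqnSn n) i) * 'D_(e (widen_ord (leqnSn n) i)) F p
      + c ord_max * 'D_(e ord_max) F p) =
   (F q - F p - \sum_i c' i * 'D_(e' i) F p) +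
   (F (q + c ord_max *: e ord_max) - F q - c ord_max * 'D_(e ord_max) F p).
  by rewrite /c' /e'; ring.
apply: le_trans (ler_normD _ _) _; rewrite mulrDr; apply: lerD.
  by apply: (hd1 c') => i; exact: cd1.
rewrite Es -mulrBr normrM mulrC ler_wpM2r //; apply: ltW.
by rewrite distrC; have [] := hr _ (near_p _ sc).
Unshelve. all: by end_near. Qed.

(** The difference quotient of [F] is linear in those of the [c i], up to an error of at most
    [eps / 2 / M] times the sum of their sizes, and this sum is eventually below [M]. *)
Lemma curve_is_derive (W : normedModType R) n (e : 'I_n -> W) (F : W -> R)
    (gam : R -> W) (c : 'I_n -> R -> R) (dc : 'I_n -> R) (x : R) :
  (forall i, \forall q \near gam x, derivable F q (e i)) ->
  (forall i, {for gam x, continuous (fun q => 'D_(e i) F q)}) ->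
  (forall y, gam y = gam x + \sum_i (c i y - c i x) *: e i) ->
  (forall i, is_derive x 1 (c i) (dc i)) ->
  is_derive x (1 : R) (F \o gam) (\sum_i dc i * 'D_(e i) F (gam x)).
Proof.
move=> dF cF gamE dcE.
have cvgc i : h^-1 *: (c i (h *: (1 : R^o) + x) - c i x) @[h --> (0 : R)^'] --> dc i.
  have [h1 h2] := dcE i; rewrite -h2; exact: h1.
suff H : h^-1 *: ((F \o gam) (h *: (1 : R^o) + x) - (F \o gam) x) @[h --> (0 : R)^'] -->
    \sum_i dc i * 'D_(e i) F (gam x).
  split; first by apply/cvg_ex; eexists; exact: H.
  exact/cvg_lim/H.
apply/cvgrPdist_le => eps eps0.
pose L := \sum_i dc i * 'D_(e i) F (gam x).
pose M := 1 + \sum_i `|dc i|.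
have M0 : 0 < M by rewrite ltr_wpDr // sumr_ge0.
have e0 : 0 < eps / 2 / M by rewrite divr_gt0 // divr_gt0.
have [delta d0 hd] := partials_expansion dF cF e0.
have cvgL : \sum_i (h^-1 *: (c i (h *: (1 : R^o) + x) - c i x)) * 'D_(e i) F (gam x)
    @[h --> (0 : R)^'] --> L.
  by apply: cvg_sumr => i; apply: cvgMl; exact: cvgc.
have cvgA : \sum_i `|h^-1 *: (c i (h *: (1 : R^o) + x) - c i x)|
    @[h --> (0 : R)^'] --> \sum_i `|dc i|.
  by apply: cvg_sumr => i; apply: cvg_norm; exact: cvgc.
have cvg0 i : c i (h *: (1 : R^o) + x) - c i x @[h --> (0 : R)^'] --> (0 : R).
  rewrite -[X in _ --> X](mul0r (dc i)).
  apply: (@cvg_trans _ (h * (h^-1 *: (c i (h *: (1 : R^o) + x) - c i x)) @[h --> (0 : R)^'])).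
    apply: near_eq_cvg; near=> h; rewrite /GRing.scale /= mulVKf //.
    by near: h; exact: nbhs_dnbhs_neq.
  by apply: cvgM => //; exact: cvg_within.
have cvg0' : \forall h \near (0 : R)^', forall i, `|c i (h *: (1 : R^o) + x) - c i x| <= delta.
  apply: filter_forall => i; have /cvgrPdist_le/(_ _ d0) := cvg0 i.
  by apply: filterS => h; rewrite sub0r normrN.
near=> h.
have h0 : h != 0 by near: h; exact: nbhs_dnbhs_neq.
have A1 : `|L - \sum_i (h^-1 *: (c i (h *: (1 : R^o) + x) - c i x)) * 'D_(e i) F (gam x)| <= eps / 2.
  by near: h; move/cvgrPdist_le : cvgL; apply; rewrite divr_gt0.
have A2 : \sum_i `|h^-1 *: (c i (h *: (1 : R^o) + x) - c i x)| <= M.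
  near: h; have /cvgrPdist_le/(_ 1 ltr01) := cvgA.
  by apply: filterS => h; rewrite distrC => /ler_normlP[_]; rewrite lerBlDr /M.
have A3 : forall i, `|c i (h *: (1 : R^o) + x) - c i x| <= delta by near: h.
have := hd _ A3; rewrite -gamE => A4.
rewrite /= [X in _ - X](_ : _ =
  \sum_i (h^-1 *: (c i (h *: (1 : R^o) + x) - c i x)) * 'D_(e i) F (gam x) +
  h^-1 * (F (gam (h *: (1 : R^o) + x)) - F (gam x) -
   \sum_i (c i (h *: (1 : R^o) + x) - c i x) * 'D_(e i) F (gam x))); last first.
  rewrite [in RHS]mulrBr mulr_sumr [RHS]addrC -addrA [X in _ = _ + X](_ : _ = 0) ?addr0 //.
  rewrite -sumrN -big_split /= big1 // => i _; rewrite /GRing.scale /=; ring.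
rewrite opprD addrA; apply: le_trans (ler_normB _ _) _.
rewrite [leRHS](splitr eps); apply: lerD; first exact: A1.
rewrite normrM; apply: le_trans (ler_wpM2l _ A4) _ => //.
rewrite mulrCA mulr_sumr.
apply: (@le_trans _ _ (eps / 2 / M * M)); last by rewrite divfK ?gt_eqF.
rewrite ler_wpM2l ?(ltW e0) //; apply: le_trans A2.
by apply: ler_sum => i _; rewrite normrM /GRing.scale /= -normrM.
Unshelve. all: by end_near. Qed.

End ChainRule.

(** * Calculus of C^k functions of x and v, away from v = 0 *)

Section PhaseFunctions.
Context {R : realType}.
Local Notation V := 'rV[R]_3.
Implicit Types (f g : V -> V -> R) (y v : V).

Definition pdx (i : 'I_3) f y v : R := 'D_(delta_mx 0 i : V) (fun z => f z v) y.
Definition pdv (i : 'I_3) f y v : R := 'D_(delta_mx 0 i : V) (f y) v.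

Definition phase_continuous f := forall y v, v != 0 ->
  {for (y, v), continuous (fun p : V * V => f p.1 p.2)}.

(* C^k on the phase space, away from v = 0 *)
Fixpoint Sk (k : nat) f : Prop :=
  phase_continuous f /\
  if k is k'.+1 then
    [/\ forall y v i, v != 0 -> derivable (fun z => f z v) y (delta_mx 0 i : V),
        forall y v i, v != 0 -> derivable (f y) v (delta_mx 0 i : V),
        forall i, Sk k' (pdx i f) & forall i, Sk k' (pdv i f)]
  else True.

Lemma Sk_cont k f : Sk k f -> phase_continuous f.
Proof. by case: k => [|k] []. Qed.

Lemma SkS k f : Sk k.+1 f -> Sk k f.
Proof.
elim: k f => [|k IH] f; first by move=> [cf _]; split.
move=> [cf [h1 h2 h3 h4]]; split => //.
by split => // i; apply: IH; [exact: h3|exact: h4].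
Qed.

Lemma open_nonzero : open [set v : V | v != 0].
Proof.
rewrite (_ : [set v | _] = ~` [set 0]); last first.
  by apply/seteqP; split => v /= /eqP.
exact/closed_openC/accessible_closed_set1/hausdorff_accessible/norm_hausdorff.
Qed.

Lemma near_nonzero v : v != 0 -> \forall w \near v, w != 0.
Proof. by move=> v0; have := open_nonzero; rewrite openE; exact. Qed.

Lemma near_nonzero2 y v : v != 0 -> \forall p \near (y, v), p.2 != 0.
Proof.
move=> v0; exists ([set: V], [set w : V | w != 0]) => /=.
  by split; [exact: filterT|exact: near_nonzero].
by move=> [z w] [].
Qed.

Lemma phase_continuous_ext f g : (forall y v, v != 0 -> f y v = g y v) ->
  phase_continuous f -> phase_continuous g.
Proof.
move=> fg cf y v v0; have := cf y v v0.
rewrite /prop_for /continuous_at /= fg // => h.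
apply: cvg_trans h; apply: near_eq_cvg.
by apply: filterS (near_nonzero2 y v0) => -[z w] /= w0; rewrite fg.
Qed.

(** Nonzero velocities form an open set, so values at [v = 0] affect no derivative elsewhere. *)
Lemma Sk_ext k f g : (forall y v, v != 0 -> f y v = g y v) -> Sk k f -> Sk k g.
Proof.
elim: k f g => [|k IH] f g fg /=.
  by move=> [cf _]; split => //; exact: phase_continuous_ext cf.
move=> [cf [h1 h2 h3 h4]]; split; first exact: phase_continuous_ext cf.
have e1 v : v != 0 -> (fun z => f z v) = (fun z => g z v).
  by move=> v0; apply/funext => z; exact: fg.
have e2 y v : v != 0 -> \forall w \near v, f y w = g y w.
  by move=> v0; apply: filterS (near_nonzero v0) => w w0; exact: fg.
split.
- by move=> y v i v0; rewrite -(e1 v v0); exact: h1.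
- by move=> y v i v0; exact: (near_eq_derivable (e2 y v v0) (h2 y v i v0)).
- by move=> i; apply: IH (h3 i) => y v v0; rewrite /pdx e1.
- move=> i; apply: IH (h4 i) => y v v0; rewrite /pdv.
  exact: (near_eq_derive _ (e2 y v v0)).
Qed.

Lemma Sk_add k f g : Sk k f -> Sk k g -> Sk k (fun y v => f y v + g y v).
Proof.
elim: k f g => [|k IH] f g /= [cf] hf [cg] hg; (split; first by
  move=> y v v0; apply: cvgD; [exact: cf|exact: cg]) => //.
case: hf => f1 f2 f3 f4; case: hg => g1 g2 g3 g4; split.
- by move=> y v i v0; apply: derivableD; [exact: f1|exact: g1].
- by move=> y v i v0; apply: derivableD; [exact: f2|exact: g2].
- move=> i; apply: Sk_ext (IH _ _ (f3 i) (g3 i)) => y v v0.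
  by rewrite /pdx deriveD //; [exact: f1|exact: g1].
- move=> i; apply: Sk_ext (IH _ _ (f4 i) (g4 i)) => y v v0.
  by rewrite /pdv deriveD //; [exact: f2|exact: g2].
Qed.

Lemma Sk_mul k f g : Sk k f -> Sk k g -> Sk k (fun y v => f y v * g y v).
Proof.
elim: k f g => [|k IH] f g /= Hf Hg.
  case: Hf => cf _; case: Hg => cg _; split => // y v v0.
  by apply: cvgM; [exact: cf|exact: cg].
have Sf := SkS Hf; have Sg := SkS Hg.
case: Hf => cf [f1 f2 f3 f4]; case: Hg => cg [g1 g2 g3 g4]; split.
  by move=> y v v0; apply: cvgM; [exact: cf|exact: cg].
split.
- by move=> y v i v0; apply: derivableM; [exact: f1|exact: g1].
- by move=> y v i v0; apply: derivableM; [exact: f2|exact: g2].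
- move=> i; apply: Sk_ext (Sk_add (IH _ _ Sf (g3 i)) (IH _ _ Sg (f3 i))) => y v v0.
  by rewrite /pdx deriveM //; [exact: f1|exact: g1].
- move=> i; apply: Sk_ext (Sk_add (IH _ _ Sf (g4 i)) (IH _ _ Sg (f4 i))) => y v v0.
  by rewrite /pdv deriveM //; [exact: f2|exact: g2].
Qed.

Lemma Sk_cst k (c : R) : Sk k (fun _ _ => c).
Proof.
elim: k c => [|k IH] c /=; (split; first by move=> y v _; exact: cvg_cst) => //.
split.
- by move=> y v i _; exact: derivable_cst.
- by move=> y v i _; exact: derivable_cst.
- move=> i; apply: Sk_ext (IH 0) => y v _.
  by rewrite /pdx (derive_cst c).
- move=> i; apply: Sk_ext (IH 0) => y v _.
  by rewrite /pdv (derive_cst c).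
Qed.

Lemma Sk_opp k f : Sk k f -> Sk k (fun y v => - f y v).
Proof.
move=> Sf; apply: Sk_ext (Sk_mul (Sk_cst k (-1)) Sf) => y v _.
by rewrite mulN1r.
Qed.

Lemma Sk_sub k f g : Sk k f -> Sk k g -> Sk k (fun y v => f y v - g y v).
Proof. by move=> Sf Sg; apply: Sk_add => //; exact: Sk_opp. Qed.

Lemma Sk_sum k (F : 'I_3 -> V -> V -> R) :
  (forall i, Sk k (F i)) -> Sk k (fun y v => \sum_i F i y v).
Proof.
move=> SF; apply: (@Sk_ext k (fun y v => F 0 y v + F 1 y v + F 2%R y v)).
  move=> y v _; rewrite (sum3E 0); congr (_ + F _ y v + F _ y v); exact/val_inj.
by apply: Sk_add => //; exact: Sk_add.
Qed.

Lemma coord_is_derive (y : V) (i j : 'I_3) :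
  is_derive y (delta_mx 0 i : V) (fun z : V => z 0 j) ((i == j)%:R : R).
Proof.
have e : (fun h : R => h^-1 *: ((h *: (delta_mx 0 i : V) + y) 0 j - y 0 j)) @ 0^' --> ((i == j)%:R : R).
  apply: cvg_near_cst; near=> h.
  rewrite !mxE eqxx /= addrK (eq_sym j i) /GRing.scale /= mulKf //.
  by near: h; exact: nbhs_dnbhs_neq.
split; first by apply/cvg_ex; exists ((i == j)%:R : R); exact: e.
exact/cvg_lim/e.
Unshelve. all: by end_near. Qed.

Lemma Sk_x k j : Sk k (fun y v => y 0 j).
Proof.
have c : phase_continuous (fun y v => y 0 j).
  move=> y v _; apply: (@continuous_comp _ _ _ fst (fun z : V => z 0 j)).
    exact: cvg_fst.
  exact: coord_continuous.
case: k => [|k]; split => //; split.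
- by move=> y v i _; have [] := coord_is_derive y i j.
- by move=> y v i _; exact: derivable_cst.
- move=> i; apply: Sk_ext (Sk_cst k (i == j)%:R) => y v _.
  by have [_ <-] := coord_is_derive y i j.
- move=> i; apply: Sk_ext (Sk_cst k 0) => y v _.
  by rewrite /pdv (derive_cst (y 0 j)).
Qed.

Lemma Sk_v k j : Sk k (fun y v => v 0 j).
Proof.
have c : phase_continuous (fun y v => v 0 j).
  move=> y v _; apply: (@continuous_comp _ _ _ snd (fun z : V => z 0 j)).
    exact: cvg_snd.
  exact: coord_continuous.
case: k => [|k]; split => //; split.
- by move=> y v i _; exact: derivable_cst.
- by move=> y v i _; have [] := coord_is_derive v i j.
- move=> i; apply: Sk_ext (Sk_cst k 0) => y v _.
  by rewrite /pdx (derive_cst (v 0 j)).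
- move=> i; apply: Sk_ext (Sk_cst k (i == j)%:R) => y v _.
  by have [_ <-] := coord_is_derive v i j.
Qed.

Lemma enorm_gt0 v : v != 0 -> 0 < enorm v.
Proof.
move=> v0; rewrite /enorm sqrtr_gt0 lt_neqAle eq_sym sumr_ge0 ?andbT; last first.
  by move=> i _; exact: sqr_ge0.
apply: contra v0; rewrite psumr_eq0; last by move=> i _; exact: sqr_ge0.
move=> /allP h; apply/eqP/rowP => i; rewrite mxE; apply/eqP.
by rewrite -sqrf_eq0; apply: h; rewrite mem_index_enum.
Qed.

Lemma enorm_continuous : continuous (@enorm R).
Proof.
move=> v; apply: (@continuous_comp _ _ _ (fun x : V => \sum_i x 0 i ^+ 2) Num.sqrt).
  apply: (@cvg_sumr R 3 V (nbhs v) _ (fun i (x : V) => x 0 i ^+ 2)) => i.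
  by apply: cvgM; exact: coord_continuous.
exact: sqrt_continuous.
Qed.

Lemma is_derive_line (W : normedModType R) (F : W -> R) (q e : W) (d : R) :
  is_derive (0 : R) (1 : R) (fun s : R => F (q + s *: e)) d -> is_derive q e F d.
Proof.
have fE : (fun h : R => h^-1 *: (F (h *: e + q) - F q)) =
    (fun h : R => h^-1 *: (F (q + (h *: (1 : R^o) + 0) *: e) - F (q + (0 : R) *: e))).
  apply/funext => h; rewrite (_ : h *: (1 : R^o) = h); last exact: mulr1.
  by rewrite addr0 scale0r addr0 [q + _]addrC.
move=> [h1 h2]; split; first by move: h1; rewrite /derivable; move: fE => /= ->.
by rewrite -h2 /derive; move: fE => /= ->.
Qed.

Lemma comp_is_derive (W : normedModType R) (F : W -> R) (phi : R -> R)
    (q e : W) (d d' : R) :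
  is_derive q e F d -> is_derive (F q) (1 : R) phi d' ->
  is_derive q e (phi \o F) (d' * d).
Proof.
move=> [h1 h2] hphi; apply: is_derive_line.
have hl : is_derive (0 : R) (1 : R) (fun s : R => F (q + s *: e)) d.
  have q0 : q + (0 : R) *: e = q by rewrite scale0r addr0.
  have := @line_is_derive R W F q e 0; rewrite q0 => /(_ h1).
  by rewrite h2.
have hphi' : is_derive (F (q + (0 : R) *: e)) (1 : R) phi d'.
  by rewrite scale0r addr0.
exact: (@is_derive1_comp R phi (fun s : R => F (q + s *: e)) 0 d' d hphi' hl).
Qed.

Lemma enorm_is_derive v i : v != 0 ->
  is_derive v (delta_mx 0 i : V) (@enorm R) (v 0 i / enorm v).
Proof.
move=> v0; have n0 := enorm_gt0 v0.
have sq : is_derive v (delta_mx 0 i : V) (fun x : V => \sum_j x 0 j ^+ 2) (2 * v 0 i).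
  have -> : (fun x : V => \sum_j x 0 j ^+ 2) = \sum_(j < 3) (fun x : V => x 0 j ^+ 2).
    by apply/funext => x; rewrite fct_sumE.
  have dj j : is_derive v (delta_mx 0 i : V) (fun x : V => x 0 j ^+ 2) (2 * v 0 j * (i == j)%:R).
    have [c1 c2] := coord_is_derive v i j.
    split; first by apply: derivableM.
    have -> : (fun x : V => x 0 j ^+ 2) = (fun x : V => x 0 j) * (fun x : V => x 0 j) by [].
    by rewrite deriveM // c2 /GRing.scale /=; ring.
  split; first by apply: derivable_sum => j; have [] := dj j.
  rewrite derive_sum; last by move=> j; have [] := dj j.
  rewrite (bigD1 i) //= big1 ?addr0; last first.
    by move=> j ji; have [_ ->] := dj j; rewrite eq_sym (negbTE ji) mulr0.
  by have [_ ->] := dj i; rewrite eqxx mulr1.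
have s0 : 0 < \sum_j v 0 j ^+ 2 by move: n0; rewrite /enorm sqrtr_gt0.
have := comp_is_derive sq (is_derive1_sqrt s0).
rewrite -/(enorm v) (_ : _ * _ = v 0 i / enorm v) //.
by field; rewrite gt_eqF.
Qed.

(** The partial derivatives of [1 / |v|] are [- v_i |v|^-3], again products of a coordinate and
    powers of [1 / |v|], so the induction closes under [Sk_mul]. *)
Lemma Sk_inorm k : Sk k (fun y v => (enorm v)^-1).
Proof.
have c : phase_continuous (fun y v => (enorm v)^-1).
  move=> y v v0; apply: (@continuous_comp _ _ _ snd (fun z : V => (enorm z)^-1)).
    exact: cvg_snd.
  exact: (cvgV (lt0r_neq0 (enorm_gt0 v0)) (@enorm_continuous v)).
have d v i : v != 0 -> is_derive v (delta_mx 0 i : V) (fun z => (enorm z)^-1)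
    (- (v 0 i * ((enorm v)^-1 * ((enorm v)^-1 * (enorm v)^-1)))).
  move=> v0; have n0 := enorm_gt0 v0; have [d1 d2] := enorm_is_derive i v0.
  split; first by apply: derivableV => //; rewrite gt_eqF.
  rewrite (@deriveV _ _ (@enorm R) v) ?gt_eqF //  d2 /GRing.scale /=.
  by field; rewrite gt_eqF.
elim: k => [|k IH]; split => //; split.
- by move=> y v i _; exact: derivable_cst.
- by move=> y v i v0; have [] := d v i v0.
- move=> i; apply: Sk_ext (Sk_cst k 0) => y v _.
  by rewrite /pdx (derive_cst ((enorm v)^-1)).
- move=> i; apply: Sk_ext (Sk_opp (Sk_mul (Sk_v k i) (Sk_mul IH (Sk_mul IH IH)))) => y v v0.
  by rewrite /pdv; have [_ ->] := d v i v0.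
Qed.

Lemma Sk_norm k : Sk k (fun y v => enorm v).
Proof.
apply: Sk_ext (Sk_mul (Sk_sum (fun i => Sk_mul (Sk_v k i) (Sk_v k i))) (Sk_inorm k)) => y v v0.
under eq_bigr do rewrite -expr2.
by rewrite -enorm_sqr expr2 mulfK // gt_eqF // enorm_gt0.
Qed.

(** [curve_is_derive] in [V * V] for the six directions [(e_i, 0)] and [(0, e_i)], indexed by
    ['I_(3 + 3)]. Translations, lifted rotations, rays in [x] and lines in [v] are all
    differentiated through it. *)
Lemma phase_curve_is_derive f (a b : R -> V) (da db : 'I_3 -> R) (x : R) :
  Sk 1 f -> b x != 0 ->
  (forall i, is_derive x (1 : R) (fun s => a s 0 i) (da i)) ->
  (forall i, is_derive x (1 : R) (fun s => b s 0 i) (db i)) ->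
  is_derive x (1 : R) (fun s => f (a s) (b s))
    (\sum_i da i * pdx i f (a x) (b x) + \sum_i db i * pdv i f (a x) (b x)).
Proof.
move=> [cf [f1 f2 f3 f4]] b0 ha hb.
pose W := (V * V)%type.
pose F (p : V * V) := f p.1 p.2.
pose e (l : 'I_(3 + 3)) : V * V := match fintype.split l with
  | inl i => (delta_mx 0 i, 0) | inr i => (0, delta_mx 0 i) end.
pose c (l : 'I_(3 + 3)) (s : R) : R := match fintype.split l with
  | inl i => a s 0 i | inr i => b s 0 i end.
pose dc (l : 'I_(3 + 3)) : R := match fintype.split l with
  | inl i => da i | inr i => db i end.
have el i : e (lshift 3 i) = (delta_mx 0 i, 0) by rewrite /e (unsplitK (inl _ i)).
have er i : e (rshift 3 i) = (0, delta_mx 0 i) by rewrite /e (unsplitK (inr _ i)).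
have cl i : c (lshift 3 i) = fun s => a s 0 i.
  by apply/funext => s; rewrite /c (unsplitK (inl _ i)).
have cr i : c (rshift 3 i) = fun s => b s 0 i.
  by apply/funext => s; rewrite /c (unsplitK (inr _ i)).
have dcl i : dc (lshift 3 i) = da i by rewrite /dc (unsplitK (inl _ i)).
have dcr i : dc (rshift 3 i) = db i by rewrite /dc (unsplitK (inr _ i)).
have splitP' (l : 'I_(3 + 3)) : (exists i, l = lshift 3 i) \/ (exists i, l = rshift 3 i).
  by case: (split_ordP l) => i ->; [left|right]; exists i.
have qx i (p : V * V) : (fun h : R => h^-1 *: (F (h *: e (lshift 3 i) + p) - F p)) =
   (fun h : R => h^-1 *: (f (h *: (delta_mx 0 i : V) + p.1) p.2 - f p.1 p.2)).
  by apply/funext => h; rewrite el /F /= scaler0 add0r.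
have qv i (p : V * V) : (fun h : R => h^-1 *: (F (h *: e (rshift 3 i) + p) - F p)) =
   (fun h : R => h^-1 *: (f p.1 (h *: (delta_mx 0 i : V) + p.2) - f p.1 p.2)).
  by apply/funext => h; rewrite er /F /= scaler0 add0r.
have Dx i p : 'D_(e (lshift 3 i)) F p = pdx i f p.1 p.2.
  by rewrite /pdx /derive; move: (qx i p) => /= ->.
have Dv i p : 'D_(e (rshift 3 i)) F p = pdv i f p.1 p.2.
  by rewrite /pdv /derive; move: (qv i p) => /= ->.
have E : \sum_l dc l * 'D_(e l) F (a x, b x) =
    \sum_i da i * pdx i f (a x) (b x) + \sum_i db i * pdv i f (a x) (b x).
  by rewrite big_split_ord; congr (_ + _); apply: eq_bigr => i _; rewrite ?Dx ?dcl ?Dv ?dcr.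
rewrite -E.
apply: (@curve_is_derive R (V * V)%type _ e F (fun s => (a s, b s)) c dc x).
- move=> l; apply: filterS (near_nonzero2 (a x) b0) => p p0.
  have [[i ->]|[i ->]] := splitP' l.
    by have := f1 p.1 p.2 i p0; rewrite /derivable; move: (qx i p) => /= ->.
  by have := f2 p.1 p.2 i p0; rewrite /derivable; move: (qv i p) => /= ->.
- move=> l; have [[i ->]|[i ->]] := splitP' l.
    rewrite (_ : (fun q => _) = fun p => pdx i f p.1 p.2); last by apply/funext.
    by have [c3 _] := f3 i; exact: c3.
  rewrite (_ : (fun q => _) = fun p => pdv i f p.1 p.2); last by apply/funext.
  by have [c4 _] := f4 i; exact: c4.
- move=> s; rewrite big_split_ord /=; apply/pair_equal_spec.
  have s1 (u : 'I_3 -> V * V) : (\sum_i u i).1 = \sum_i (u i).1.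
    exact: (big_morph fst (fun _ _ => erefl) erefl).
  have s2 (u : 'I_3 -> V * V) : (\sum_i u i).2 = \sum_i (u i).2.
    exact: (big_morph snd (fun _ _ => erefl) erefl).
  split; rewrite /= ?s1 ?s2; apply/rowP => j; rewrite !mxE !summxE.
    under eq_bigr do rewrite el cl /= !mxE eqxx /=.
    under [X in _ + (_ + X)]eq_bigr do rewrite er /= scaler0 mxE.
    rewrite big1_eq addr0 (bigD1 j) //= eqxx mulr1 big1 ?addr0 ?subrKC //.
    by move=> i ij; rewrite eq_sym (negbTE ij) mulr0.
  under eq_bigr do rewrite el /= scaler0 mxE.
  under [X in _ + (_ + X)]eq_bigr do rewrite er cr /= !mxE eqxx /=.
  rewrite big1_eq add0r (bigD1 j) //= eqxx mulr1 big1 ?addr0 ?subrKC //.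
  by move=> i ij; rewrite eq_sym (negbTE ij) mulr0.
- by move=> l; have [[i ->]|[i ->]] := splitP' l; rewrite ?cl ?cr ?dcl ?dcr.
Qed.

Lemma Sk_pdx k f i : Sk k.+1 f -> Sk k (pdx i f).
Proof. by case=> _ [_ _ h _]; exact: h. Qed.

Lemma Sk_pdv k f i : Sk k.+1 f -> Sk k (pdv i f).
Proof. by case=> _ [_ _ _ h]; exact: h. Qed.

End PhaseFunctions.

(** * Measurability and iterated integrals on the phase space *)

Section PhaseIntegrals.
Context {R : realType}.
Local Notation leb := (@lebesgue_measure R).
Local Notation V := 'rV[R]_3.
Local Notation E := (R * R * R)%type.

Lemma mx_cvg_coord T (A : set_system T) {FA : Filter A} (f : T -> V) (l : V) :
  (forall i, f s 0 i @[s --> A] --> l 0 i) -> f s @[s --> A] --> l.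
Proof.
move=> fl U [P /= Pl PU].
have : \forall s \near A, forall i, P 0 i (f s 0 i).
  by apply: filter_forall => i; apply: fl; exact: Pl.
by apply: filterS => s Ps; apply: PU => i j /=; rewrite (ord1 i).
Qed.

Lemma pair_cvg (U W : topologicalType) T (A : set_system T) {FA : Filter A}
    (f : T -> U) (g : T -> W) (l : U) (m : W) :
  f s @[s --> A] --> l -> g s @[s --> A] --> m ->
  (f s, g s) @[s --> A] --> (l, m).
Proof.
move=> fl gm B [[P Q] /= [Pl Qm] PQB].
have h1 : A (f @^-1` P) := fl _ Pl.
have h2 : A (g @^-1` Q) := gm _ Qm.
change (A ((fun s => (f s, g s)) @^-1` B)).
by apply: filterS (filterI h1 h2) => s [Ps Qs]; exact: PQB.
Qed.

Lemma vec3_continuous : continuous (@vec3 R).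
Proof.
move=> q; apply: mx_cvg_coord => i.
have -> : (fun s : E => vec3 s 0 i) = fun s : E => nth 0 [:: s.1.1; s.1.2; s.2] i.
  by apply/funext => s; rewrite mxE.
rewrite mxE; case: i => [] [|[|[|//]]] p /=.
- by apply: (@continuous_comp _ _ _ fst fst); exact: cvg_fst.
- by apply: (@continuous_comp _ _ _ fst snd); [exact: cvg_fst|exact: cvg_snd].
- exact: cvg_snd.
Qed.

Definition measurable33 (H : V -> V -> \bar R) :=
  measurable_fun [set: E * E] (fun p : E * E => H (vec3 p.1) (vec3 p.2)).

Lemma measurable33_comp d (T : measurableType d) H (a b : T -> V) :
  measurable33 H -> (forall i, measurable_fun [set: T] (fun s => a s 0 i)) ->
  (forall i, measurable_fun [set: T] (fun s => b s 0 i)) ->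
  measurable_fun [set: T] (fun s => H (a s) (b s)).
Proof.
move=> mH ma mb.
rewrite (_ : (fun s => H (a s) (b s)) =
   (fun p : E * E => H (vec3 p.1) (vec3 p.2)) \o (fun s => (unvec3 (a s), unvec3 (b s)))).
  apply: (measurableT_comp mH); apply: measurable_fun_pair; exact: measurable_unvec3.
by apply/funext => s /=; rewrite !unvec3K.
Qed.

Lemma measurable33_add H G : measurable33 H -> measurable33 G ->
  measurable33 (fun y v => H y v + G y v)%E.
Proof. exact: emeasurable_funD. Qed.

(* extension by 0 at v = 0, so that integrals can be taken over the whole space *)
Definition off0 (F : V -> \bar R) (v : V) : \bar R := if v == 0 then 0%E else F v.

Lemma int_v_off0 (F : V -> \bar R) : int_v F = int3 setT (off0 F).
Proof.
rewrite /int_v /int3 integral_mkcond [RHS]integral_mkcond; congr integral.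
apply/funext => q; rewrite /patch /off0 preimage_setT in_setT.
case: eqVneq => [e|ne].
  by rewrite memNset //= e eqxx.
by rewrite mem_set.
Qed.

Definition wabs (w f : V -> V -> R) y : V -> \bar R :=
  off0 (fun v => (w y v * `|f y v|)%:E).

Lemma measurable33_cont (h : V -> V -> R) : phase_continuous h ->
  measurable33 (fun y => off0 (fun v => (h y v)%:E)).
Proof.
move=> ch; rewrite /measurable33 /off0.
have mnz : measurable_fun [set: E * E] (fun p : E * E => vec3 p.2 == 0 :> V).
  have mv : measurable [set q : E | vec3 q != 0 :> V].
    apply: (measurable_nbhs_open measurable_nbhs_space) => q q0.
    exact: (@vec3_continuous q _ (near_nonzero q0)).
  apply: (measurable_fun_bool true).
  rewrite setTI (_ : _ @^-1` _ = [set: E] `*` ~` [set q : E | vec3 q != 0 :> V]).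
    by apply: measurableX => //; exact: measurableC.
  apply/seteqP; split => [[p q] /= e|[p q] /= [_ /negP]].
    by split => //; rewrite e.
  by rewrite negbK.
apply: measurable_fun_if => //.
set D := _ `&` _.
have DE : D = [set p : E * E | vec3 p.2 != 0 :> V].
  apply/seteqP; split => [p [_ /= e]|p /= e]; first by apply/negP; rewrite e.
  by split => //=; exact/negbTE.
apply/measurable_EFinP; apply: (measurable_fun_nbhs measurable_nbhs_phase).
move=> p O oO; rewrite DE /= => p0 Op.
have cp : (vec3 q.1 : V, vec3 q.2 : V) @[q --> p] --> (vec3 p.1 : V, vec3 p.2 : V).
  move: p {p0 Op} => [p1 p2]; apply: pair_cvg.
    by apply: (@cvg_comp _ _ _ fst (@vec3 R) _ (nbhs p1)); [exact: cvg_fst|exact: vec3_continuous].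
  by apply: (@cvg_comp _ _ _ snd (@vec3 R) _ (nbhs p2)); [exact: cvg_snd|exact: vec3_continuous].
apply: filterI; first exact: (cp _ (near_nonzero2 (vec3 p.1) p0)).
have c2 := cvg_comp _ _ cp (ch _ _ p0).
exact: (c2 O (open_nbhs_nbhs (conj oO Op))).
Qed.

Lemma phase_continuous_wabs (w f : V -> V -> R) : phase_continuous w -> phase_continuous f ->
  phase_continuous (fun y v => w y v * `|f y v|).
Proof.
move=> cw cf y v v0; apply: cvgM; first exact: cw.
by apply: cvg_norm; exact: cf.
Qed.

Lemma measurable33_wabs (w f : V -> V -> R) : phase_continuous w -> phase_continuous f ->
  measurable33 (wabs w f).
Proof. by move=> cw cf; apply: measurable33_cont; exact: phase_continuous_wabs. Qed.

Lemma wabs_ge0 (w f : V -> V -> R) y v : (forall y v, 0 <= w y v) -> (0 <= wabs w f y v)%E.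
Proof. by move=> w0; rewrite /wabs /off0; case: ifP => // _; rewrite lee_fin mulr_ge0. Qed.

Local Open Scope ereal_scope.

Lemma int3_ge0 (F : V -> \bar R) : (forall x, 0 <= F x) -> 0 <= int3 setT F.
Proof. by move=> F0; apply: integral_ge0 => q _; exact: F0. Qed.

Lemma le_int3 (F G : V -> \bar R) : (forall x, 0 <= F x) ->
  (forall x, F x <= G x) -> int3 setT F <= int3 setT G.
Proof.
by move=> F0 FG; apply: ge0_le_integral_nomeas => q _; [exact: F0|exact: FG].
Qed.

Lemma int3D (F G : V -> \bar R) : measurable3 F -> measurable3 G ->
  (forall x, 0 <= F x) -> (forall x, 0 <= G x) ->
  int3 setT (fun x => F x + G x) = int3 setT F + int3 setT G.
Proof.
by move=> mF mG F0 G0; rewrite /int3 preimage_setT; apply: ge0_integralD.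
Qed.

Lemma int3Zl (k : R) (F : V -> \bar R) : measurable3 F -> (forall x, 0 <= F x) ->
  (0 <= k)%R -> int3 setT (fun x => k%:E * F x) = k%:E * int3 setT F.
Proof.
move=> mF F0 k0; rewrite /int3 preimage_setT; exact: ge0_integralZl.
Qed.

Lemma measurable_int3 d (T : measurableType d) (G : T -> V -> \bar R) :
  measurable_fun [set: T * E] (fun q : T * E => G q.1 (vec3 q.2)) ->
  (forall s v, 0 <= G s v) ->
  measurable_fun [set: T] (fun s => int3 setT (G s)).
Proof.
move=> mG G0.
rewrite (_ : (fun s => _) = fun s => \int[@lebesgue3 R]_q G s (vec3 q)).
  exact: (@measurable_fun_fubini_tonelli_F _ _ T (measurableTypeR R * measurableTypeR R * measurableTypeR R)%type
    R (@lebesgue3 R) (fun q => G q.1 (vec3 q.2)) mG (fun q => G0 q.1 (vec3 q.2))).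
by apply/funext => s; rewrite /int3 preimage_setT.
Qed.

Lemma tonelli_int3 (G : R -> V -> \bar R) :
  measurable_fun [set: R * E] (fun q : R * E => G q.1 (vec3 q.2)) ->
  (forall s v, 0 <= G s v) ->
  int3 setT (fun v => \int[leb]_s G s v) = \int[leb]_s int3 setT (G s).
Proof.
move=> mG G0; rewrite /int3 !preimage_setT.
exact: (esym (@fubini_tonelli _ _ (measurableTypeR R)
  (measurableTypeR R * measurableTypeR R * measurableTypeR R)%type
    R leb (@lebesgue3 R) (fun q => G q.1 (vec3 q.2)) mG (fun q => G0 q.1 (vec3 q.2)))).
Qed.

Lemma measurable_int_itv d (T : measurableType d) (a b : R) (G : T -> R -> \bar R) :
  measurable_fun [set: T * R] (fun q : T * R => G q.1 q.2) ->
  (forall s r, 0 <= G s r) ->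
  measurable_fun [set: T] (fun s => \int[leb]_(r in `[a, b]) G s r).
Proof.
move=> mG G0.
pose G' s r := if r \in `[a, b] then G s r else 0.
rewrite (_ : (fun s => _) = fun s => \int[leb]_r G' s r); last first.
  apply/funext => s; rewrite integral_mkcond; apply: eq_integral => r _.
  by rewrite /patch /G' mem_setE.
apply: measurable_int_snd; last by move=> s r; rewrite /G'; case: ifP.
apply: measurable_fun_ifT => //.
rewrite (_ : (fun _ => _) = fun q : T * R => (a <= q.2) && (q.2 <= b))%R; last first.
  by apply/funext => q; rewrite in_itv.
by apply: measurable_and; apply: measurable_fun_ler => //; exact: measurable_snd.
Qed.

Lemma tonelli_int3_itv (a b : R) (G : R -> V -> \bar R) :
  measurable_fun [set: R * E] (fun q : R * E => G q.1 (vec3 q.2)) ->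
  (forall s v, 0 <= G s v) ->
  int3 setT (fun v => \int[leb]_(s in `[a, b]) G s v) =
  \int[leb]_(s in `[a, b]) int3 setT (G s).
Proof.
move=> mG G0.
pose G' s v := if s \in `[a, b] then G s v else 0.
have mG' : measurable_fun [set: R * E] (fun q : R * E => G' q.1 (vec3 q.2)).
  apply: measurable_fun_ifT => //.
  rewrite (_ : (fun _ => _) = fun q : R * E => (a <= q.1) && (q.1 <= b))%R; last first.
    by apply/funext => q; rewrite in_itv.
  by apply: measurable_and; apply: measurable_fun_ler => //; exact: measurable_fst.
have G'0 s v : 0 <= G' s v by rewrite /G'; case: ifP.
transitivity (int3 setT (fun v => \int[leb]_s G' s v)).
  congr int3; apply/funext => v; rewrite integral_mkcond; apply: eq_integral => s _.
  by rewrite /patch /G' mem_setE.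
rewrite (tonelli_int3 mG' G'0) [RHS]integral_mkcond; apply: eq_integral => s _.
rewrite /patch /G' mem_setE; case: ifP => // _.
by apply: integral0_eq.
Qed.

Lemma measurable3_int3 (H : V -> V -> \bar R) : measurable33 H ->
  (forall y v, 0 <= H y v) -> measurable3 (fun y => int3 setT (H y)).
Proof.
move=> mH H0; rewrite /measurable3.
apply: (measurable_int3 (G := fun (q : E) v => H (vec3 q) v)) => //.
Qed.

Lemma integral_cst_itv (a b : R) (c : \bar R) : (a < b)%R ->
  \int[leb]_(s in `[a, b]) c = (b - a)%:E * c.
Proof.
move=> ab; transitivity (c * leb [set` `[a, b]]).
  by apply: integral_cst; exact: measurable_itv.
by rewrite lebesgue_measure_itv /= lte_fin ab -EFinB muleC.
Qed.

(** [|phi 0| <= |phi s| + int |phi'|], averaged over [s]: the one-dimensional Sobolev inequality, to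
    be used along a flow starting from each fixed point of the phase space. *)
Lemma ftc_average (phi dphi : R -> R) (delta : R) : (0 < delta)%R ->
  (forall x : R, is_derive x 1%R phi (dphi x)) -> continuous dphi ->
  `|phi 0%R|%:E <= (delta^-1)%:E * \int[leb]_(s in `[0%R, delta]) `|phi s|%:E +
     \int[leb]_(s in `[0%R, delta]) `|dphi s|%:E.
Proof.
move=> d0 dp cd; set M := \int[leb]_(s in `[0%R, delta]) `|dphi s|%:E.
have M0 : 0 <= M by exact: integral_ge0.
have cp : continuous phi.
  move=> x; apply/differentiable_continuous/derivable1_diffP; by have [] := dp x.
have mphi (D : set R) : measurable_fun D (fun s : R => `|phi s|%:E).
  apply/measurable_EFinP; apply: measurable_funTS; apply: continuous_measurable_fun.
  by move=> x; apply: cvg_norm; exact: cp.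
have mdphi (D : set R) : measurable_fun D (fun s : R => (dphi s)%:E).
  by apply/measurable_EFinP; apply: measurable_funTS; exact: continuous_measurable_fun.
have mdphi' (D : set R) : measurable_fun D (fun s : R => `|dphi s|%:E).
  apply/measurable_EFinP; apply: measurable_funTS; apply: continuous_measurable_fun.
  by move=> x; apply: cvg_norm; exact: cd.
have step s : s \in `[0%R, delta] -> `|phi 0%R|%:E <= `|phi s|%:E + M.
  rewrite in_itv /= => /andP[s0 sd].
  move: s0; rewrite le_eqVlt => /orP[/eqP <-|s0]; first by rewrite leeDl.
  have ftc : \int[leb]_(x in `[0%R, s]) (dphi x)%:E = (phi s)%:E - (phi 0%R)%:E.
    apply: continuous_FTC2 => //.
    - exact: continuous_subspaceT.
    - split; first by move=> x _; have [] := dp x.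
      + exact: (cvg_at_right_filter (cp 0%R)).
      + exact: (cvg_at_left_filter (cp s)).
    - by move=> x _; rewrite derive1E; have [_ ->] := dp x.
  have : `|(phi s)%:E - (phi 0%R)%:E| <= M.
    rewrite -ftc; apply: (@le_trans _ _ (\int[leb]_(x in `[0%R, s]) `|(dphi x)%:E|)).
      by apply: le_abse_integral => //; exact: mdphi.
    apply: ge0_subset_integral => //; first exact: mdphi'.
    by apply: subset_itvl; rewrite bnd_simp.
  rewrite -EFinB /= => h.
  apply: (@le_trans _ _ (`|phi s|%:E + `|phi s - phi 0|%R%:E)).
    rewrite -EFinD lee_fin -[X in (`|X| <= _)%R](subKr (phi s)); exact: ler_normB.
  by rewrite leeD2l.
have key : delta%:E * `|phi 0%R|%:E <= \int[leb]_(s in `[0%R, delta]) `|phi s|%:E + delta%:E * M.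
  have -> : delta%:E * `|phi 0%R|%:E = \int[leb]_(s in `[0%R, delta]) `|phi 0%R|%:E.
    by rewrite integral_cst_itv // subr0.
  have -> : delta%:E * M = \int[leb]_(s in `[0%R, delta]) M.
    by rewrite integral_cst_itv // subr0.
  rewrite -ge0_integralD //; try exact: mphi.
  by apply: ge0_le_integral_nomeas => s // /step.
rewrite -(@lee_pmul2l _ delta%:E) // muleDr ?ge0_adde_def ?inE //; last first.
  by rewrite mule_ge0 ?lee_fin ?invr_ge0 ?(ltW d0) // integral_ge0.
by rewrite muleA (_ : delta%:E * (delta^-1)%:E = 1) ?mul1e // -EFinM divff ?gt_eqF.
Qed.

End PhaseIntegrals.

(** * Weighted Sobolev inequalities *)

Section FlowEstimates.
Context {R : realType}.
Local Notation leb := (@lebesgue_measure R).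
Local Notation V := 'rV[R]_3.
Local Notation E := (R * R * R)%type.
Implicit Types (f w : V -> V -> R) (i j l : 'I_3).

Definition Rot i j (th : R) (x : V) : V := prot i j (cos th) (sin th) x.

Definition om i j f : V -> V -> R := fun y v =>
  y 0 i * pdx j f y v - y 0 j * pdx i f y v + v 0 i * pdv j f y v - v 0 j * pdv i f y v.

Lemma Sk_om k i j f : Sk k.+1 f -> Sk k (om i j f).
Proof.
move=> [_ [_ _ f3 f4]].
exact: (Sk_sub (Sk_add (Sk_sub (Sk_mul (Sk_x _ _) (f3 _)) (Sk_mul (Sk_x _ _) (f3 _)))
  (Sk_mul (Sk_v _ _) (f4 _))) (Sk_mul (Sk_v _ _) (f4 _))).
Qed.

Lemma sum_two i j (a b : R) (p : 'I_3 -> R) : i != j ->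
  \sum_l (if l == i then a else if l == j then b else 0) * p l = a * p i + b * p j.
Proof.
move=> ij; rewrite (sum_pair _ ij) eqxx eq_sym (negbTE ij) eqxx big1 ?addr0 //.
by move=> l /andP[/negbTE -> /negbTE ->]; rewrite mul0r.
Qed.

Lemma Rot0 i j x : Rot i j 0 x = x.
Proof.
apply/rowP => l; rewrite /Rot cos0 sin0 mxE !mul1r !mul0r subr0 add0r.
by case: eqVneq => [->//|_]; case: eqVneq => [->|].
Qed.

Lemma Rot_neq0 i j th (v : V) : i != j -> v != 0 -> Rot i j th v != 0.
Proof.
move=> ij v0; have h : enorm (Rot i j th v) = enorm v.
  by rewrite enorm_rot // cos2Dsin2.
apply/eqP => e; have := enorm_gt0 v0; rewrite -h e /enorm big1 ?sqrtr0 ?ltxx // => l _.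
by rewrite mxE expr0n.
Qed.

Lemma Rot_coord_derive i j (x : V) l (th : R) : i != j ->
  is_derive th (1 : R) (fun s => Rot i j s x 0 l)
    (if l == i then - Rot i j th x 0 j else if l == j then Rot i j th x 0 i else 0).
Proof.
move=> ij; have ji : (j == i) = false by rewrite eq_sym (negbTE ij).
case: (eqVneq l i) => [->|li].
  rewrite (_ : (fun s => _) = fun s => cos s * x 0 i - sin s * x 0 j); last first.
    by apply/funext => s; rewrite mxE eqxx.
  apply: is_derive_eq; rewrite /GRing.scale /= mxE eqxx ji; ring.
case: (eqVneq l j) => [->|lj].
  rewrite (_ : (fun s => _) = fun s => sin s * x 0 i + cos s * x 0 j); last first.
    by apply/funext => s; rewrite mxE ji eqxx.
  apply: is_derive_eq; rewrite /GRing.scale /= mxE eqxx; ring.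
rewrite (_ : (fun s => _) = cst (x 0 l)); last first.
  by apply/funext => s; rewrite mxE (negbTE li) (negbTE lj).
exact: is_derive_cst.
Qed.

Lemma Rot_continuous i j (x : V) : i != j -> continuous (fun s => Rot i j s x).
Proof.
move=> ij th; apply: mx_cvg_coord => l.
apply/differentiable_continuous/derivable1_diffP.
by have [] := Rot_coord_derive x l th ij.
Qed.

(** The simultaneous rotation of [y] and [v] is the flow of the lifted rotation field; no isolated
    [v]-derivative appears. *)
Lemma om_curve_derive i j f (y v : V) (th : R) : i != j -> Sk 1 f -> v != 0 ->
  is_derive th (1 : R) (fun s => f (Rot i j s y) (Rot i j s v))
    (om i j f (Rot i j th y) (Rot i j th v)).
Proof.
move=> ij Sf v0.
have := phase_curve_is_derive Sf (Rot_neq0 th ij v0)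
  (fun l => Rot_coord_derive y l th ij) (fun l => Rot_coord_derive v l th ij).
rewrite !(sum_two _ _ _ ij); set A := _ + _; suff -> : A = om i j f (Rot i j th y) (Rot i j th v) by [].
rewrite /A /om; set a := pdx _ _ _ _; set b := pdx _ _ _ _; set c := pdv _ _ _ _; set d := pdv _ _ _ _.
ring.
Qed.

Definition rot_invariant w := forall i j (c s : R) (y v : V), i != j ->
  c ^+ 2 + s ^+ 2 = 1 -> v != 0 -> w (prot i j c s y) (prot i j c s v) = w y v.

Local Open Scope ereal_scope.

Definition Iv w f (y : V) : \bar R := int3 setT (wabs w f y).

Lemma Iv_ge0 w f y : (forall y v, 0 <= w y v)%R -> 0 <= Iv w f y.
Proof. by move=> w0; apply: int3_ge0 => v; exact: wabs_ge0. Qed.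

Lemma measurable3_Iv w f : phase_continuous w -> phase_continuous f ->
  (forall y v, 0 <= w y v)%R -> measurable3 (Iv w f).
Proof.
move=> cw cf w0; apply: measurable3_int3; first exact: measurable33_wabs.
by move=> y v; exact: wabs_ge0.
Qed.

(** The weight at the starting point enters the integral of [ftc_average] at the cost of a factor
    [K], so it is compared along the flow and never differentiated. *)
Lemma wabs_average w f (g : V -> V -> R) (y v : V) (a b : R -> V) (K delta : R) : (0 < delta)%R ->
  (1 <= K)%R ->
  (forall y v, 0 <= w y v)%R -> phase_continuous f -> phase_continuous g ->
  v != 0%R -> (forall s, b s != 0%R) -> a 0%R = y -> b 0%R = v ->
  continuous a -> continuous b ->
  (forall s : R, is_derive s 1%R (fun s => f (a s) (b s)) (g (a s) (b s))) ->
  phase_continuous w ->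
  (forall s, s \in `[0%R, delta] -> w y v <= K * w (a s) (b s))%R ->
  wabs w f y v <= (K * (1 + delta^-1))%:E * \int[leb]_(s in `[0%R, delta])
     (wabs w f (a s) (b s) + wabs w g (a s) (b s)).
Proof.
move=> d0 K1 w0 cf cg v0 b0 a0 b00 ca cb der cw wK.
have K0 : (0 <= K)%R by apply: le_trans K1.
have cont h : phase_continuous h -> continuous (fun s => h (a s) (b s)).
  by move=> ch s; apply: (cvg_comp _ _ (pair_cvg (ca s) (cb s)) (ch _ _ (b0 s))).
have wE h s : wabs w h (a s) (b s) = (w (a s) (b s) * `|h (a s) (b s)|)%:E.
  by rewrite /wabs /off0 (negbTE (b0 s)).
have cn h : phase_continuous h -> continuous (fun s => `|h (a s) (b s)|)%R.
  by move=> ch s; apply: cvg_norm; exact: cont.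
have mn h : phase_continuous h -> measurable_fun ([set` `[0%R, delta]] : set R)
    (fun s => `|h (a s) (b s)|%:E).
  move=> ch; apply/measurable_EFinP; apply: measurable_funTS.
  by apply: continuous_measurable_fun; exact: cn.
have mw h : phase_continuous h -> measurable_fun ([set` `[0%R, delta]] : set R)
    (fun s => wabs w h (a s) (b s)).
  move=> ch; rewrite (_ : (fun s => _) = fun s => (w (a s) (b s) * `|h (a s) (b s)|)%:E); last first.
    by apply/funext => s; exact: wE.
  apply/measurable_EFinP; apply: measurable_funTS; apply: continuous_measurable_fun => s.
  by apply: cvgM; [exact: cont|exact: cn].
have bound h : phase_continuous h ->
    (w y v)%:E * \int[leb]_(s in `[0%R, delta]) `|h (a s) (b s)|%:E <=
    K%:E * \int[leb]_(s in `[0%R, delta]) wabs w h (a s) (b s).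
  move=> ch.
  have w1 s : [set` `[0%R, delta]] s -> 0 <= wabs w h (a s) (b s) by move=> _; exact: wabs_ge0.
  have w2 s : [set` `[0%R, delta]] s -> 0 <= `|h (a s) (b s)|%:E by [].
  have mD : measurable ([set` `[0%R, delta]] : set R) by exact: measurable_itv.
  rewrite -(ge0_integralZl leb mD (mn h ch) w2) ?lee_fin //.
  rewrite -(ge0_integralZl leb mD (mw h ch) w1) ?lee_fin //.
  apply: ge0_le_integral_nomeas => s sd; first by rewrite mule_ge0 ?lee_fin.
  rewrite wE -!EFinM lee_fin mulrA ler_wpM2r //; exact: wK.
have := ftc_average d0 der (cont g cg); rewrite a0 b00 => h.
have -> : wabs w f y v = (w y v)%:E * `|f y v|%:E by rewrite /wabs /off0 (negbTE v0).
apply: le_trans (lee_wpmul2l _ h) _; first by rewrite lee_fin.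
set I1 := \int[leb]_(s in _) _; set I2 := \int[leb]_(s in _) _.
have I10 : 0 <= I1 by exact: integral_ge0.
have I20 : 0 <= I2 by exact: integral_ge0.
have d1 : (0 <= delta^-1)%R by rewrite invr_ge0 ltW.
rewrite ge0_integralD //; first last.
- exact: mw.
- by move=> s _; exact: wabs_ge0.
- exact: mw.
- by move=> s _; exact: wabs_ge0.
set J1 := \int[leb]_(s in _) wabs w f _ _; set J2 := \int[leb]_(s in _) wabs w g _ _.
have J10 : 0 <= J1 by apply: integral_ge0 => s _; exact: wabs_ge0.
have J20 : 0 <= J2 by apply: integral_ge0 => s _; exact: wabs_ge0.
have dI1 : 0 <= (delta^-1)%:E * I1 by apply: mule_ge0; rewrite ?lee_fin.
rewrite (ge0_muleDr _ dI1 I20) (ge0_muleDr _ J10 J20) muleCA.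
apply: leeD.
  apply: (@le_trans _ _ (delta^-1%:E * (K%:E * J1))).
    by apply: lee_wpmul2l; [rewrite lee_fin|exact: bound].
  rewrite muleA -EFinM lee_wpmul2r // lee_fin mulrC ler_wpM2l // lerDr //.
apply: le_trans (bound g cg) _.
by rewrite lee_wpmul2r // lee_fin ler_peMr // lerDl.
Qed.

(** For each [v] the bound is taken along the lifted flow, which also rotates [v]. Once the
    integrals are exchanged, the rotation invariance of [dv] undoes this, and only the base point
    [y] still moves. *)
Lemma Iv_rotation w f i j y : i != j ->
  (forall y v, 0 <= w y v)%R -> phase_continuous w -> rot_invariant w -> Sk 1 f ->
  Iv w f y <= 17%:E * \int[leb]_(th in `[0%R, (1 / 16)%R])
     (Iv w f (Rot i j th y) + Iv w (om i j f) (Rot i j th y)).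
Proof.
move=> ij w0 cw iw Sf.
have cf := Sk_cont Sf; have cg := Sk_cont (Sk_om i j Sf).
pose G y v := wabs w f y v + wabs w (om i j f) y v.
have G0 y' v : 0 <= G y' v by rewrite adde_ge0 // wabs_ge0.
have mG : measurable33 G.
  by apply: measurable33_add; exact: measurable33_wabs.
have mR (z : R * E -> V) l : (forall l, measurable_fun [set: R * E] (fun q => z q 0%R l)) ->
    measurable_fun [set: R * E] (fun q : R * E => Rot i j q.1 (z q) 0%R l).
  move=> mz.
  have mc : measurable_fun [set: R * E] (fun q : R * E => cos q.1).
    apply: measurableT_comp measurable_fst.
    by apply: continuous_measurable_fun; exact: continuous_cos.
  have ms : measurable_fun [set: R * E] (fun q : R * E => sin q.1).
    apply: measurableT_comp measurable_fst.
    by apply: continuous_measurable_fun; exact: continuous_sin.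
  rewrite (_ : (fun q => _) = fun q : R * E => if l == i then
     (cos q.1 * z q 0 i - sin q.1 * z q 0 j)%R else if l == j then
     (sin q.1 * z q 0 i + cos q.1 * z q 0 j)%R else z q 0%R l); last first.
    by apply/funext => q; rewrite mxE.
  case: (l == i); first by apply: measurable_funB; apply: measurable_funM.
  by case: (l == j) => //; apply: measurable_funD; apply: measurable_funM.
have mGR : measurable_fun [set: R * E]
    (fun q : R * E => G (Rot i j q.1 y) (Rot i j q.1 (vec3 q.2))).
  apply: (measurable33_comp mG) => l; apply: mR => m; first exact: measurable_cst.
  exact: (measurableT_comp (@measurable_vec3 R m) measurable_snd).
have GR0 s v : 0 <= G (Rot i j s y) (Rot i j s v) by exact: G0.
have step v : wabs w f y v <= 17%:E * \int[leb]_(th in `[0%R, (1 / 16)%R])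
    G (Rot i j th y) (Rot i j th v).
  have [->|v0] := eqVneq v 0%R.
    rewrite {1}/wabs /off0 eqxx mule_ge0 //; apply: integral_ge0 => s _; exact: G0.
  (* The interval has length 1/16, and [17 = 1 + 16]. *)
  have -> : 17%:E = (1 * (1 + (1 / 16)^-1) : R)%R%:E by congr EFin; field.
  apply: (@wabs_average w f (om i j f) y v (fun s => Rot i j s y) (fun s => Rot i j s v)) => //.
  - by move=> s; exact: Rot_neq0.
  - exact: Rot0.
  - exact: Rot0.
  - exact: Rot_continuous.
  - exact: Rot_continuous.
  - by move=> s; exact: om_curve_derive.
  - by move=> s _; rewrite mul1r /Rot iw // cos2Dsin2.
apply: le_trans (le_int3 _ step) _; first by move=> v; exact: wabs_ge0.
have mGR' : measurable_fun [set: E * R]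
    (fun q : E * R => G (Rot i j q.2 y) (Rot i j q.2 (vec3 q.1))).
  exact: (measurableT_comp mGR (measurable_fun_pair measurable_snd measurable_fst)).
rewrite int3Zl //; last 2 first.
- apply: (@measurable_int_itv R _ E 0%R (1 / 16)%R (fun q s => G (Rot i j s y) (Rot i j s (vec3 q)))) => //.
- by move=> v; apply: integral_ge0 => s _; exact: G0.
apply: lee_wpmul2l; first by rewrite lee_fin.
rewrite tonelli_int3_itv //.
apply: ge0_le_integral_nomeas => s sd; first by apply: int3_ge0 => v; exact: G0.
have m3 h : phase_continuous h -> measurable3 (wabs w h (Rot i j s y)).
  move=> ch; apply: (measurable33_comp (measurable33_wabs cw ch)) => l.
    exact: measurable_cst.
  exact: measurable_vec3.
have h0 h v : 0 <= wabs w h (Rot i j s y) v by exact: wabs_ge0.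
have -> : Iv w f (Rot i j s y) + Iv w (om i j f) (Rot i j s y) = int3 setT (G (Rot i j s y)).
  by rewrite [RHS](int3D (m3 _ cf) (m3 _ cg) (h0 f) (h0 _)).
apply: (@int3_rot R i j (cos s) (sin s) (G (Rot i j s y))) => //.
- exact: cos2Dsin2.
(* An angle of at most 1/16 is far from the half turn excluded in [int3_rot]. *)
- move: sd; rewrite /= in_itv /= => /andP[s0 s1].
  have := cos_ge s; rewrite ger0_norm // => h; apply/eqP => e; move: h; rewrite e; lra.
- by apply: emeasurable_funD; exact: m3.
Qed.

Lemma Iv_translation w f (y e : V) (K : R) : (1 <= K)%R ->
  (forall y v, 0 <= w y v)%R -> phase_continuous w -> Sk 1 f ->
  (forall (s : R) v, s \in `[0%R, 1%R] -> v != 0%R -> w y v <= K * w (y + s *: e) v)%R ->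
  Iv w f y <= (2 * K)%:E * \int[leb]_(s in `[0%R, 1%R])
     (Iv w f (y + s *: e)%R +
      Iv w (fun y v => \sum_i e 0 i * pdx i f y v)%R (y + s *: e)%R).
Proof.
move=> K1 w0 cw Sf wK.
set g := (fun y v => \sum_i e 0 i * pdx i f y v)%R.
have cf := Sk_cont Sf.
have Sg : Sk 0 g.
  case: Sf => _ [_ _ f3 _]; apply: Sk_sum => i; apply: Sk_mul; last exact: f3.
  exact: Sk_cst.
have cg := Sk_cont Sg.
pose G y v := wabs w f y v + wabs w g y v.
have G0 y' v : 0 <= G y' v by rewrite adde_ge0 // wabs_ge0.
have mG : measurable33 G.
  by apply: measurable33_add; exact: measurable33_wabs.
have mGR : measurable_fun [set: R * E] (fun q : R * E => G (y + q.1 *: e)%R (vec3 q.2)).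
  apply: (measurable33_comp mG) => l; last first.
    exact: (measurableT_comp (@measurable_vec3 R l) measurable_snd).
  rewrite (_ : (fun q => _) = fun q : R * E => (y 0 l + q.1 * e 0 l)%R); last first.
    by apply/funext => q; rewrite !mxE.
  by apply: measurable_funD => //; apply: measurable_funM => //; exact: measurable_fst.
have step v : wabs w f y v <= (2 * K)%:E * \int[leb]_(s in `[0%R, 1%R]) G (y + s *: e)%R v.
  have [->|v0] := eqVneq v 0%R.
    rewrite {1}/wabs /off0 eqxx mule_ge0 //.
      by rewrite lee_fin mulr_ge0 // (le_trans _ K1).
    by apply: integral_ge0 => s _; exact: G0.
  have -> : (2 * K)%:E = (K * (1 + 1^-1) : R)%R%:E by congr EFin; rewrite invr1; ring.
  apply: (@wabs_average w f g y v (fun s => y + s *: e)%R (fun s => v)) => //.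
  - by rewrite scale0r addr0.
  - move=> s; apply: cvgD; first exact: cvg_cst.
    by apply: cvgZl; exact: cvg_id.
  - by move=> s; exact: cvg_cst.
  - move=> s.
    have da i : is_derive s 1%R (fun s => (y + s *: e)%R 0%R i) (e 0%R i).
      rewrite (_ : (fun s => _) = fun s => (y 0 i + s * e 0 i)%R); last first.
        by apply/funext => r; rewrite !mxE.
      by apply: is_derive_eq; rewrite /GRing.scale /=; ring.
    have db i : is_derive s 1%R (fun s : R => v 0%R i) (0 : R)%R by exact: is_derive_cst.
    have := phase_curve_is_derive (b := fun _ => v) Sf v0 da db.
    by rewrite [X in (_ + X)%R]big1 ?addr0 // => i _; rewrite mul0r.
  - by move=> s sd; exact: wK.
apply: le_trans (le_int3 _ step) _; first by move=> v; exact: wabs_ge0.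
have mGR' : measurable_fun [set: E * R]
    (fun q : E * R => G (y + q.2 *: e)%R (vec3 q.1)).
  exact: (measurableT_comp mGR (measurable_fun_pair measurable_snd measurable_fst)).
have K20 : (0 <= 2 * K)%R by rewrite mulr_ge0 // (le_trans _ K1).
rewrite int3Zl //; last 2 first.
- apply: (@measurable_int_itv R _ E 0%R 1%R (fun q s => G (y + s *: e)%R (vec3 q))) => //.
- by move=> v; apply: integral_ge0 => s _; exact: G0.
apply: lee_wpmul2l; first by rewrite lee_fin.
rewrite tonelli_int3_itv //.
apply: ge0_le_integral_nomeas => s sd; first by apply: int3_ge0 => v; exact: G0.
have m3 h : phase_continuous h -> measurable3 (wabs w h (y + s *: e)%R).
  move=> ch; apply: (measurable33_comp (measurable33_wabs cw ch)) => l.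
    exact: measurable_cst.
  exact: measurable_vec3.
have h0 h v : 0 <= wabs w h (y + s *: e)%R v by exact: wabs_ge0.
by rewrite [leLHS](int3D (m3 _ cf) (m3 _ cg) (h0 f) (h0 _)).
Qed.

End FlowEstimates.

(** * Sobolev inequality on spheres *)

Section Sphere.
Context {R : realType}.
Local Notation leb := (@lebesgue_measure R).
Local Notation V := 'rV[R]_3.
Implicit Types (f w : V -> V -> R) (i j l : 'I_3).

Lemma Rot_scale i j (th rho : R) (x : V) : Rot i j th (rho *: x) = rho *: Rot i j th x.
Proof.
apply/rowP => l; rewrite !mxE; case: (l == i); first by ring.
by case: (l == j); [ring|].
Qed.

Lemma planar_Rot k i : k != i -> planar k i (1 : R) (Rot k i).
Proof.
move=> ki th x; have ik : (i == k) = false by rewrite eq_sym (negbTE ki).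
split; first by rewrite mxE eqxx mul1r.
  by rewrite mxE ik eqxx mul1r addrC.
by move=> l /negbTE lk /negbTE li; rewrite mxE lk li.
Qed.

Lemma planar_Rot_sym k i : k != i -> planar k i (-1 : R) (Rot i k).
Proof.
move=> ki th x; have ik : (i == k) = false by rewrite eq_sym (negbTE ki).
split; first by rewrite mxE (negbTE ki) eqxx; ring.
  by rewrite mxE eqxx; ring.
by move=> l /negbTE lk /negbTE li; rewrite mxE lk li.
Qed.

(** Only the fields [Omega_hat a b] with [a < b] are among [rotations]; for axes in the other order
    the angle changes sign, which [e = -1] records. *)
Lemma planar_sorted k i : k != i -> exists a b : 'I_3, (a < b)%N /\
  exists e : R, e ^+ 2 = 1 /\ planar k i e (Rot a b).
Proof.
move=> ki; have : (k : nat) != i by [].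
rewrite neq_ltn => /orP[h|h].
  by exists k, i; split => //; exists 1; rewrite expr1n; split => //; exact: planar_Rot.
by exists i, k; split => //; exists (-1); rewrite sqrrN expr1n; split => //; exact: planar_Rot_sym.
Qed.

(** Selects the axis and the hemisphere in which [polar_bound] applies. *)
Lemma unit_large_coord (om0 : V) : \sum_l om0 0 l ^+ 2 = 1 ->
  exists k (sg : R), sg ^+ 2 = 1 /\ 1 / 2 <= sg * om0 0 k.
Proof.
move=> s1.
have [k hk] : exists k, 1 / 4 <= om0 0 k ^+ 2.
  apply: contrapT => /forallNP h.
  have h' k : om0 0 k ^+ 2 < 1 / 4 by rewrite ltNge; apply/negP; exact: h.
  have := s1; rewrite (sum3E 0) => s.
  have := h' 0; have := h' (lift 0 ord0); have := h' (lift 0 ord_max); lra.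
have ha : 1 / 2 <= `|om0 0 k|.
  rewrite -(@ler_pXn2r _ 2) ?nnegrE // real_normK ?num_real //.
  by apply: le_trans hk; rewrite le_eqVlt; apply/orP; left; apply/eqP; field.
have [p|n] := leP 0 (om0 0 k).
  by exists k, (1 : R); split; [rewrite expr1n|rewrite (mul1r (om0 0 k)) -(ger0_norm p)].
by exists k, (-1 : R); split; [rewrite sqrrN expr1n|rewrite mulN1r -(ltr0_norm n)].
Qed.

Local Open Scope ereal_scope.

Lemma measurable3_add (F G : V -> \bar R) : measurable3 F -> measurable3 G ->
  measurable3 (fun x => F x + G x).
Proof. exact: emeasurable_funD. Qed.

Definition Jint w f : \bar R := int3 setT (Iv w f).

Lemma Jint_ge0 w f : (forall y v, 0 <= w y v)%R -> 0 <= Jint w f.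
Proof. by move=> w0; apply: int3_ge0 => y; exact: Iv_ge0. Qed.

(** 17 for the first rotation, [34 = 17 + 17] for the second one applied to both resulting terms,
    and [64 = 16 * 4] for [polar_bound] and its four integrals. *)
Definition sphere_cst : R := (17 * 34 * 64)%R.

Lemma sphere_cst_gt0 : (0 < sphere_cst)%R.
Proof. by rewrite /sphere_cst !mulr_gt0. Qed.

(** Rotations in the planes joining axis [k] to each of the two others sweep a patch of the sphere
    around [om0]. As the left-hand side is already integrated in [rho], these two angular
    derivatives suffice to reach a volume integral. *)
Lemma sphere_sobolev w f (om0 : V) (al be : R) (M : \bar R) :
  (forall y v, 0 <= w y v)%R -> phase_continuous w -> rot_invariant w -> Sk 2 f ->
  (0 < al)%R -> (\sum_l om0 0 l ^+ 2 = 1)%R ->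
  Jint w f <= M ->
  (forall i j, (i < j)%N -> Jint w (om i j f) <= M) ->
  (forall i j i' j', (i < j)%N -> (i' < j')%N -> Jint w (om i j (om i' j' f)) <= M) ->
  \int[leb]_(rho in `[al, be]) ((rho ^+ 2)%:E * Iv w f (rho *: om0)%R) <= sphere_cst%:E * M.
Proof.
move=> w0 cw iw Sf al0 om1 M0 M1 M2.
have [k [sg [sg1 hk]]] := unit_large_coord om1.
pose i := lift k ord0; pose j := lift k ord_max.
have ki : k != i by exact: neq_lift.
have kj : k != j by exact: neq_lift.
have [a [b [ab [e1 [e11 p1]]]]] := planar_sorted ki.
have [a' [b' [ab' [e2 [e21 p2]]]]] := planar_sorted kj.
have nab : a != b by rewrite neq_ltn ab.
have nab' : a' != b' by rewrite neq_ltn ab'.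
have Sf1 := SkS Sf; have So := Sk_om a b Sf.
have cf := Sk_cont Sf; have co := Sk_cont So.
have co' := Sk_cont (Sk_om a' b' Sf); have coo := Sk_cont (Sk_om a' b' So).
pose H1 y := Iv w f y + Iv w (om a' b' f) y.
pose H2 y := Iv w (om a b f) y + Iv w (om a' b' (om a b f)) y.
pose H y := H1 y + H2 y.
have H10 y : 0 <= H1 y by apply: adde_ge0; exact: Iv_ge0.
have H20 y : 0 <= H2 y by apply: adde_ge0; exact: Iv_ge0.
have H0 y : 0 <= H y by apply: adde_ge0; [exact: H10|exact: H20].
have mH1 : measurable3 H1 by apply: measurable3_add; exact: measurable3_Iv.
have mH2 : measurable3 H2 by apply: measurable3_add; exact: measurable3_Iv.
have mH : measurable3 H by exact: (measurable3_add mH1 mH2).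
have le1 y : H1 y <= H y by exact: (leeDl (H1 y) (H20 y)).
have le2 y : H2 y <= H y by exact: (leeDr (H2 y) (H10 y)).
have bnd1 y : Iv w f y <= 17%:E * \int[leb]_(th in `[0%R, (1 / 16)%R]) H (Rot a' b' th y).
  apply: le_trans (Iv_rotation y nab' w0 cw iw Sf1) _.
  apply: lee_wpmul2l; first by rewrite lee_fin.
  apply: ge0_le_integral_nomeas => th _; first exact: H10.
  exact: le1.
have bnd2 y : Iv w (om a b f) y <= 17%:E * \int[leb]_(th in `[0%R, (1 / 16)%R]) H (Rot a' b' th y).
  apply: le_trans (Iv_rotation y nab' w0 cw iw So) _.
  apply: lee_wpmul2l; first by rewrite lee_fin.
  apply: ge0_le_integral_nomeas => th _; first exact: H20.
  exact: le2.
have I0 y : 0 <= \int[leb]_(th in `[0%R, (1 / 16)%R]) H (Rot a' b' th y).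
  by apply: integral_ge0 => th _; exact: H0.
have [c c0 cE] : exists2 c : R, (0 < c)%R & (c = 17 * 34)%R.
  by exists (17 * 34)%R => //; rewrite mulr_gt0.
have c0' : 0 <= c%:E by rewrite lee_fin ltW.
have bnd y : Iv w f y <= c%:E * \int[leb]_(th in `[0%R, (1 / 16)%R])
    \int[leb]_(th' in `[0%R, (1 / 16)%R]) H (Rot a' b' th' (Rot a b th y)).
  apply: le_trans (Iv_rotation y nab w0 cw iw Sf1) _.
  rewrite cE EFinM -muleA; apply: lee_wpmul2l; first by rewrite lee_fin.
  rewrite -ge0_integralZl_nomeas //.
  apply: ge0_le_integral_nomeas => th _; first by rewrite adde_ge0 // Iv_ge0.
  apply: (le_trans (leeD (bnd1 _) (bnd2 _))).
  rewrite -ge0_muleDl ?lee_fin // -EFinD.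
  by rewrite (_ : (17 + 17 = 34)%R) //; ring.
have := @polar_bound R k e1 e2 sg al be (Rot a b) (Rot a' b') om0 H e11 e21 sg1 al0 p1 p2 om1 hk mH H0.
move=> pb.
have II0 y : 0 <= \int[leb]_(th in `[0%R, (1 / 16)%R])
    \int[leb]_(th' in `[0%R, (1 / 16)%R]) H (Rot a' b' th' (Rot a b th y)).
  by apply: integral_ge0 => th _; exact: I0.
apply: (@le_trans _ _ (c%:E * (16%:E * int3 setT H))).
  apply: (le_trans _ (lee_wpmul2l c0' pb)).
  rewrite -ge0_integralZl_nomeas //; last first.
    move=> rho _; apply: mule_ge0; first by rewrite lee_fin sqr_ge0.
    by apply: integral_ge0 => th _; apply: integral_ge0 => th' _; exact: H0.
  apply: ge0_le_integral_nomeas => rho _.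
    by apply: mule_ge0; [rewrite lee_fin sqr_ge0|exact: Iv_ge0].
  rewrite muleCA; apply: lee_wpmul2l; first by rewrite lee_fin sqr_ge0.
  apply: le_trans (bnd _) _; apply: (lee_wpmul2l c0').
  rewrite le_eqVlt; apply/orP; left; apply/eqP.
  by apply: eq_integral => th _; apply: eq_integral => th' _; rewrite !Rot_scale.
have -> : int3 setT H = (Jint w f + Jint w (om a' b' f)) +
     (Jint w (om a b f) + Jint w (om a' b' (om a b f))).
  have mI h : phase_continuous h -> measurable3 (Iv w h) by move=> ch; exact: measurable3_Iv.
  have I0' h y : 0 <= Iv w h y by exact: Iv_ge0.
  have e1' : int3 setT H1 = Jint w f + Jint w (om a' b' f).
    exact: (int3D (mI _ cf) (mI _ co') (I0' _) (I0' _)).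
  have e2' : int3 setT H2 = Jint w (om a b f) + Jint w (om a' b' (om a b f)).
    exact: (int3D (mI _ co) (mI _ coo) (I0' _) (I0' _)).
  exact: etrans (int3D mH1 mH2 H10 H20) (f_equal2 adde e1' e2').
rewrite muleA -EFinM.
apply: (@le_trans _ _ ((c * 16)%R%:E * (M + M + (M + M)))).
  apply: lee_wpmul2l; first by rewrite lee_fin mulr_ge0 // ltW.
  exact: (leeD (leeD M0 (M1 _ _ ab')) (leeD (M1 _ _ ab) (M2 _ _ _ _ ab' ab))).
have Mge0 : 0 <= M by apply: le_trans M0; exact: Jint_ge0.
rewrite (_ : M + M + (M + M) = 4%:E * M); last first.
  rewrite (_ : 4%:E = 1 + 1 + (1 + 1)); last by rewrite -!EFinD; congr EFin; ring.
  by rewrite !ge0_muleDl ?adde_ge0 // !mul1e.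
by rewrite muleA -EFinM lee_wpmul2r // lee_fin cE /sphere_cst; lra.
Qed.

End Sphere.

(** * Radial Sobolev inequality away from the origin *)

Section WeightedSobolev.
Context {R : realType}.
Local Notation leb := (@lebesgue_measure R).
Local Notation V := 'rV[R]_3.
Implicit Types (f w : V -> V -> R) (i j l : 'I_3).
Local Open Scope ereal_scope.

Lemma Iv_sum_bound n w f (w' F : 'I_n -> V -> V -> R) y :
  (forall y v, 0 <= w y v)%R -> (forall k y v, 0 <= w' k y v)%R ->
  (forall k, phase_continuous (w' k)) -> (forall k, phase_continuous (F k)) ->
  (forall v, v != 0%R -> w y v * `|f y v| <= \sum_(k < n) w' k y v * `|F k y v|)%R ->
  Iv w f y <= \sum_(k < n) Iv (w' k) (F k) y.
Proof.
move=> w0 w'0 cw' cF h.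
have m k : measurable3 (wabs (w' k) (F k) y).
  apply: (measurable33_comp (measurable33_wabs (cw' k) (cF k))) => l.
    exact: measurable_cst.
  exact: measurable_vec3.
apply: (@le_trans _ _ (int3 setT (fun v => \sum_(i < n) wabs (w' i) (F i) y v))).
  apply: le_int3 => v; first exact: wabs_ge0.
  have [->|v0] := eqVneq v 0%R.
    by rewrite {1}/wabs /off0 eqxx; apply: sume_ge0 => i _; exact: wabs_ge0.
  rewrite (eq_bigr (fun k => (w' k y v * `|F k y v|)%:E)); last first.
    by move=> k _; rewrite /wabs /off0 (negbTE v0).
  by rewrite sumEFin /wabs /off0 (negbTE v0) lee_fin; exact: h.
rewrite /Iv /int3 preimage_setT ge0_integral_sum //.
by move=> k q _; exact: wabs_ge0.
Qed.

Lemma measurable_radial w f (om0 : V) : phase_continuous w -> phase_continuous f ->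
  (forall y v, 0 <= w y v)%R ->
  measurable_fun [set: R] (fun rho : R => (rho ^+ 2)%:E * Iv w f (rho *: om0)%R).
Proof.
move=> cw cf w0; apply: emeasurable_funM.
  by apply/measurable_EFinP; exact: (continuous_measurable_fun (@exprn_continuous R 2)).
apply: (measurable3_comp (measurable3_Iv cw cf w0)) => l.
rewrite (_ : (fun _ => _) = fun s : R => (s * om0 0 l)%R); last first.
  by apply/funext => s; rewrite mxE.
by apply: measurable_funM => //; exact: measurable_id.
Qed.

Lemma integral_shift_itv (r d : R) (H : R -> \bar R) :
  measurable_fun [set: R] H -> (forall s, 0 <= H s) ->
  \int[leb]_(s in `[0%R, d]) H (r + s)%R <= \int[leb]_(s in `[r, (r + d)%R]) H s.
Proof.
move=> mH H0.
pose H' s := if s \in `[r, (r + d)%R] then H s else 0.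
have mH' : measurable_fun [set: R] H'.
  apply: measurable_fun_ifT => //.
  rewrite (_ : (fun _ => _) = fun q : R => (r <= q) && (q <= r + d))%R; last first.
    by apply/funext => q; rewrite in_itv.
  by apply: measurable_and; apply: measurable_fun_ler.
have H'0 s : 0 <= H' s by rewrite /H'; case: ifP.
have := @integral_expanding R [set` `[0%R, d]] 1%R (fun s => r + s)%R H' (measurable_itv _) _ ltr01 _ mH' H'0.
rewrite invr1 mul1e => /(_ _ _)/le_trans h.
apply: (@le_trans _ _ (\int[leb]_(s in `[0%R, d]) H' (r + s)%R)).
  apply: ge0_le_integral_nomeas => s // sd.
  rewrite /H' ifT //; move: sd; rewrite /= !in_itv /= => /andP[a b].
  by rewrite lerDl a lerD2l.
apply: h.
- by apply: measurable_funD; [exact: measurable_cst|exact: measurable_id].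
- by move=> a b _ _; rewrite mul1r opprD addrACA subrr add0r.
- rewrite [leRHS]integral_mkcond le_eqVlt; apply/orP; left; apply/eqP.
  by apply: eq_integral => s _; rewrite /patch /H' mem_setE.
Qed.

Lemma integral_add_sum n (a b : R) (A : R -> \bar R) (B : 'I_n -> R -> \bar R) :
  measurable_fun [set: R] A -> (forall s, 0 <= A s) ->
  (forall k, measurable_fun [set: R] (B k)) -> (forall k s, 0 <= B k s) ->
  \int[leb]_(s in `[a, b]) (A s + \sum_(k < n) B k s) =
  \int[leb]_(s in `[a, b]) A s + \sum_(k < n) \int[leb]_(s in `[a, b]) B k s.
Proof.
move=> mA A0 mB B0.
have mD : measurable ([set` `[a, b]] : set R) by exact: measurable_itv.
have mB' k : measurable_fun ([set` `[a, b]] : set R) (B k) by exact: measurable_funTS.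
have eB := ge0_integral_sum leb mD mB' (fun k s _ => B0 k s) (index_enum _).
have -> : \sum_(k < n) \int[leb]_(s in `[a, b]) B k s =
    \int[leb]_(s in `[a, b]) \sum_(k < n) B k s by rewrite -eB.
apply: ge0_integralD => //.
- exact: measurable_funTS.
- by move=> s _; apply: sume_ge0.
- exact: emeasurable_sum.
Qed.

(** Only fields acting within a time slice occur, the [x]-derivatives and the rotations, so [f]
    carries no time variable. *)
Fixpoint bounded_words w (M : \bar R) k f : Prop :=
  Jint w f <= M /\
  if k is k'.+1 then
    (forall i, bounded_words w M k' (pdx i f)) /\
    (forall i j, (i < j)%N -> bounded_words w M k' (om i j f))
  else True.

Lemma bounded_words_le w M k f : bounded_words w M k f -> Jint w f <= M.
Proof. by case: k => [|k] []. Qed.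

Lemma bounded_wordsS w M k f : bounded_words w M k.+1 f -> bounded_words w M k f.
Proof.
elim: k f => [|k IH] f; first by move=> [h _]; split.
by move=> [h [h1 h2]]; split => //; split => [i|i j ij]; apply: IH; [exact: h1|exact: h2].
Qed.

Lemma sphere_sobolev_words w f (om0 : V) (al be : R) (M : \bar R) :
  (forall y v, 0 <= w y v)%R -> phase_continuous w -> rot_invariant w -> Sk 2 f ->
  (0 < al)%R -> (\sum_l om0 0 l ^+ 2 = 1)%R -> bounded_words w M 2 f ->
  \int[leb]_(rho in `[al, be]) ((rho ^+ 2)%:E * Iv w f (rho *: om0)%R) <= sphere_cst%:E * M.
Proof.
move=> w0 cw iw Sf al0 om1 [B0 [_ B]].
have B1 i j : (i < j)%N -> Jint w (om i j f) <= M by move=> ij; have [] := B i j ij.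
have B2 i j i' j' : (i < j)%N -> (i' < j')%N -> Jint w (om i j (om i' j' f)) <= M.
  by move=> ij ij'; have [_ [_ h]] := B i' j' ij'; have [] := h i j ij.
exact: (sphere_sobolev be w0 cw iw Sf al0 om1 B0 B1 B2).
Qed.

Definition slowly_varying w (K : R) := forall y e v, (enorm e <= 1)%R ->
  v != 0%R -> (w y v <= K * w (y + e)%R v)%R.

Lemma enormZ (c : R) (x : V) : (enorm (c *: x) = `|c| * enorm x)%R.
Proof.
rewrite /enorm; under eq_bigr do rewrite mxE exprMn.
by rewrite -mulr_sumr sqrtrM ?sqr_ge0 // sqrtr_sqr.
Qed.

Lemma enorm_basis i : enorm (delta_mx 0%R i : V) = 1%R.
Proof.
rewrite /enorm (bigD1 i) //= mxE !eqxx expr1n big1 ?addr0 ?sqrtr1 // => j ji.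
by rewrite mxE eqxx (negbTE ji) expr0n.
Qed.

(** A translation of length 1 along the ray supplies the integral in [rho] that [sphere_sobolev]
    asks for, and [r <= r + s] inserts the weight [rho^2]. The translation costs [2 K], and 4 counts
    [f] and its three partial derivatives. *)
Lemma radial_sobolev w f (x : V) (K : R) (M : \bar R) : (1 <= K)%R ->
  (forall y v, 0 <= w y v)%R -> phase_continuous w -> rot_invariant w ->
  slowly_varying w K -> Sk 3 f -> (1 <= enorm x)%R -> bounded_words w M 3 f ->
  (enorm x ^+ 2)%:E * Iv w f x <= (8 * K * sphere_cst)%:E * M.
Proof.
move=> K1 w0 cw iw wK Sf x1 B.
set r := enorm x; have r0 : (0 < r)%R by apply: lt_le_trans x1.
pose om0 := (r^-1 *: x)%R.
have xr : (r *: om0 = x)%R by rewrite /om0 scalerA mulfV ?gt_eqF // scale1r.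
have xE s : (x + s *: om0 = (r + s) *: om0)%R by rewrite scalerDl xr.
have no : enorm om0 = 1%R.
  by rewrite enormZ ger0_norm ?invr_ge0 ?ltW // mulVf // gt_eqF.
have om1 : (\sum_l om0 0 l ^+ 2 = 1)%R by rewrite -enorm_sqr no expr1n.
have ol i : (`|om0 0%R i| <= 1)%R.
  rewrite -(@ler_pXn2r _ 2) ?nnegrE // real_normK ?num_real // expr1n -om1 (bigD1 i) //=.
  by rewrite lerDl sumr_ge0 // => j _; exact: sqr_ge0.
pose D := (fun y v => \sum_i om0 0 i * pdx i f y v)%R.
have [cf [_ _ f3' _]] := Sf.
have f3 i : Sk 2 (pdx i f) by exact: f3'.
have cD i : phase_continuous (pdx i f) by exact: Sk_cont (f3 i).
pose G y := Iv w f y + \sum_(i < 3) Iv w (pdx i f) y.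
have DG y : Iv w f y + Iv w D y <= G y.
  apply: leeD2l; apply: (Iv_sum_bound (w' := fun=> w)) => // v v0.
  rewrite -mulr_sumr ler_wpM2l //; apply: le_trans (ler_norm_sum _ _ _) _.
  by apply: ler_sum => i _; rewrite normrM ler_piMl.
have G0 y : 0 <= G y.
  by apply: adde_ge0; [exact: Iv_ge0|apply: sume_ge0 => i _; exact: Iv_ge0].
have mf := measurable_radial om0 cw cf w0.
have md i := measurable_radial om0 cw (cD i) w0.
have K20 : (0 < 2 * K)%R by rewrite mulr_gt0 // (lt_le_trans _ K1).
have tr : Iv w f x <= (2 * K)%:E * \int[leb]_(s in `[0%R, 1%R]) G ((r + s) *: om0)%R.
  apply: le_trans (Iv_translation (y := x) (e := om0) K1 w0 cw (SkS (SkS Sf)) _) _.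
    move=> s v; rewrite in_itv /= => /andP[s0 s1] v0; apply: wK => //.
    by rewrite enormZ no mulr1 ger0_norm.
  apply: lee_wpmul2l; first by rewrite lee_fin ltW.
  apply: ge0_le_integral_nomeas => s _.
    by apply: adde_ge0; exact: Iv_ge0.
  by rewrite -xE; exact: DG.
have e1 rho : (rho ^+ 2)%:E * G (rho *: om0)%R =
    (rho ^+ 2)%:E * Iv w f (rho *: om0)%R +
    \sum_(i < 3) (rho ^+ 2)%:E * Iv w (pdx i f) (rho *: om0)%R.
  rewrite /G ge0_muleDr; last 2 first.
  - exact: Iv_ge0.
  - by apply: sume_ge0 => i _; exact: Iv_ge0.
  by rewrite ge0_sume_distrr // => i _; exact: Iv_ge0.
have p0 (rho : R) h : 0 <= (rho ^+ 2)%:E * Iv w h (rho *: om0)%R.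
  by apply: mule_ge0; [rewrite lee_fin sqr_ge0|exact: Iv_ge0].
have mG2 : measurable_fun [set: R] (fun rho : R => (rho ^+ 2)%:E * G (rho *: om0)%R).
  rewrite (funext e1); apply: emeasurable_funD => //.
  by apply: emeasurable_sum => i; exact: md.
have G20 (rho : R) : 0 <= (rho ^+ 2)%:E * G (rho *: om0)%R.
  by apply: mule_ge0; [rewrite lee_fin sqr_ge0|exact: G0].
have sph : \int[leb]_(rho in `[r, (r + 1)%R]) ((rho ^+ 2)%:E * G (rho *: om0)%R)
    <= (4 * sphere_cst)%:E * M.
  have -> : \int[leb]_(rho in `[r, (r + 1)%R]) ((rho ^+ 2)%:E * G (rho *: om0)%R) =
     \int[leb]_(rho in `[r, (r + 1)%R]) ((rho ^+ 2)%:E * Iv w f (rho *: om0)%R) +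
     \sum_(i < 3) \int[leb]_(rho in `[r, (r + 1)%R]) ((rho ^+ 2)%:E * Iv w (pdx i f) (rho *: om0)%R).
    rewrite -(integral_add_sum _ _ mf (fun s => p0 s f) md (fun i s => p0 s (pdx i f))).
    by apply: eq_integral => rho _; rewrite e1.
  have M0 : 0 <= M.
    by apply: le_trans (bounded_words_le B); exact: Jint_ge0.
  have -> : (4 * sphere_cst)%:E * M = sphere_cst%:E * M + \sum_(i < 3) sphere_cst%:E * M.
    have c0 : 0 <= sphere_cst%:E * M.
      by apply: mule_ge0 => //; rewrite lee_fin ltW // sphere_cst_gt0.
    rewrite !big_ord_recl big_ord0 adde0 EFinM -muleA.
    rewrite (_ : 4%:E = 1 + (1 + (1 + 1))); last by rewrite -!EFinD; congr EFin; ring.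
    by rewrite !ge0_muleDl ?adde_ge0 // !mul1e.
  have [_ [B' _]] := B.
  apply: leeD; last apply: lee_sum => i _.
    exact: (sphere_sobolev_words (r + 1)%R w0 cw iw (SkS Sf) r0 om1 (bounded_wordsS B)).
  exact: (sphere_sobolev_words (r + 1)%R w0 cw iw (f3 i) r0 om1 (B' i)).
apply: (@le_trans _ _ ((2 * K)%:E * ((4 * sphere_cst)%:E * M))); last first.
  by rewrite muleA -EFinM le_eqVlt; apply/orP; left; apply/eqP; congr (_%:E * _); ring.
apply: le_trans (lee_wpmul2l _ tr) _; first by rewrite lee_fin sqr_ge0.
rewrite muleCA; apply: lee_wpmul2l; first by rewrite lee_fin ltW.
apply: le_trans _ sph.
apply: le_trans _ (integral_shift_itv r 1 mG2 G20).
rewrite -ge0_integralZl_nomeas; [|by rewrite exprn_gt0|by move=> s _; exact: G0].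
apply: ge0_le_integral_nomeas => s /=; rewrite in_itv /= => /andP[s0 _].
  by apply: mule_ge0; [rewrite lee_fin sqr_ge0|exact: G0].
apply: lee_wpmul2r; first exact: G0.
by rewrite lee_fin ler_pXn2r ?nnegrE ?addr_ge0 ?lerDl // ltW.
Qed.

End WeightedSobolev.

(** * Sobolev inequality near the origin, and the global one *)

Section CubeSobolev.
Context {R : realType}.
Local Notation leb := (@lebesgue_measure R).
Local Notation V := 'rV[R]_3.
Implicit Types (f w : V -> V -> R) (i j l : 'I_3).
Local Open Scope ereal_scope.

Lemma int3D_le (F G : V -> \bar R) (a b : \bar R) : measurable3 F -> measurable3 G ->
  (forall x, 0 <= F x) -> (forall x, 0 <= G x) ->
  int3 setT F <= a -> int3 setT G <= b -> int3 setT (fun x => F x + G x) <= a + b.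
Proof. by move=> mF mG F0 G0 Fa Gb; rewrite (int3D mF mG F0 G0) leeD. Qed.

Lemma vec3_shift (y : V) (a b c : R) :
  (y + a *: delta_mx 0%R 0%R + b *: delta_mx 0%R 1%R + c *: delta_mx 0%R 2%R =
   vec3 (y 0%R 0%R + a, y 0%R 1%R + b, y 0%R 2%R + c))%R.
Proof.
apply/rowP => l; rewrite !mxE eqxx /=; have [->|->|->] := ordE3 l;
by rewrite /= ?(mulr0, mulr1, addr0).
Qed.

Lemma integral_shift_unit (r : R) (H : R -> \bar R) :
  measurable_fun [set: R] H -> (forall s, 0 <= H s) ->
  \int[leb]_(s in `[0%R, 1%R]) H (r + s)%R <= \int[leb]_s H s.
Proof.
move=> mH H0; apply: le_trans (integral_shift_itv r 1 mH H0) _.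
by rewrite integral_mkcond; apply: ge0_le_integral_nomeas => s _;
  rewrite /patch; case: ifP.
Qed.

Lemma cube_le_int3 (G : V -> \bar R) (y : V) : measurable3 G -> (forall x, 0 <= G x) ->
  \int[leb]_(a in `[0%R, 1%R]) \int[leb]_(b in `[0%R, 1%R]) \int[leb]_(c in `[0%R, 1%R])
    G (y + a *: delta_mx 0%R 0%R + b *: delta_mx 0%R 1%R + c *: delta_mx 0%R 2%R)%R
  <= int3 setT G.
Proof.
move=> mG G0.
pose p := y 0%R 0%R; pose q := y 0%R 1%R; pose s := y 0%R 2%R.
have m3 (T : measurableType _) (u v w : T -> R) : measurable_fun setT u ->
    measurable_fun setT v -> measurable_fun setT w ->
    measurable_fun [set: T] (fun z => G (vec3 (u z, v z, w z))).
  by move=> mu mv mw; apply: (measurableT_comp mG); do 2 apply: measurable_fun_pair => //.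
have I1 a b : \int[leb]_(c in `[0%R, 1%R]) G (vec3 (a, b, s + c))%R <=
    \int[leb]_c G (vec3 (a, b, c)).
  by apply: (@integral_shift_unit s (fun c => G (vec3 (a, b, c)))) => //; exact: m3.
have mI1 (T : measurableType _) (u v : T -> R) : measurable_fun setT u ->
    measurable_fun setT v ->
    measurable_fun [set: T] (fun z => \int[leb]_c G (vec3 (u z, v z, c))).
  move=> mu mv; apply: (@measurable_int_snd R _ T (fun z c => G (vec3 (u z, v z, c)))) => //.
  apply: m3; [exact: (measurableT_comp mu measurable_fst)|exact: (measurableT_comp mv measurable_fst)|].
  exact: measurable_snd.
have I10 a b : 0 <= \int[leb]_c G (vec3 (a, b, c)) by apply: integral_ge0.
have I2 a : \int[leb]_(b in `[0%R, 1%R]) \int[leb]_(c in `[0%R, 1%R]) G (vec3 (a, q + b, s + c))%R <=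
    \int[leb]_b \int[leb]_c G (vec3 (a, b, c)).
  apply: (@le_trans _ _ (\int[leb]_(b in `[0%R, 1%R]) \int[leb]_c G (vec3 (a, q + b, c))%R)).
    apply: ge0_le_integral_nomeas => b _; first exact: integral_ge0.
    exact: I1.
  apply: (@integral_shift_unit q (fun b => \int[leb]_c G (vec3 (a, b, c)))) => //.
  by apply: mI1; [exact: measurable_cst|exact: measurable_id].
rewrite (int3E mG G0).
apply: (@le_trans _ _ (\int[leb]_(a in `[0%R, 1%R]) \int[leb]_b \int[leb]_c G (vec3 (p + a, b, c))%R)).
  apply: ge0_le_integral_nomeas => a _.
    by apply: integral_ge0 => b _; exact: integral_ge0.
  apply: le_trans _ (I2 _); rewrite le_eqVlt; apply/orP; left; apply/eqP.
  by apply: eq_integral => b _; apply: eq_integral => c _; rewrite vec3_shift.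
apply: (@integral_shift_unit p (fun a => \int[leb]_b \int[leb]_c G (vec3 (a, b, c)))).
  apply: (@measurable_int_snd R _ _ (fun a b => \int[leb]_c G (vec3 (a, b, c)))) => //.
  by apply: mI1; [exact: measurable_fst|exact: measurable_snd].
by move=> a; apply: integral_ge0.
Qed.

Lemma Iv_basis_translation w f (y : V) i (K : R) : (1 <= K)%R ->
  (forall y v, 0 <= w y v)%R -> phase_continuous w -> slowly_varying w K -> Sk 1 f ->
  Iv w f y <= (2 * K)%:E * \int[leb]_(s in `[0%R, 1%R])
     (Iv w f (y + s *: delta_mx 0%R i)%R + Iv w (pdx i f) (y + s *: delta_mx 0%R i)%R).
Proof.
move=> K1 w0 cw wK Sf.
have -> : pdx i f = (fun y v => \sum_j (delta_mx 0%R i : V) 0%R j * pdx j f y v)%R.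
  apply/funext => z; apply/funext => v; rewrite (bigD1 i) //= mxE !eqxx mul1r big1 ?addr0 //.
  by move=> j ji; rewrite mxE eqxx (negbTE ji) mul0r.
apply: Iv_translation => // s v; rewrite in_itv /= => /andP[s0 s1] v0.
by apply: wK => //; rewrite enormZ enorm_basis mulr1 ger0_norm.
Qed.

(** Near the origin rotations hardly move a point, so the three derivatives are spent on
    translations along the edges of a unit cube. Each translation costs [2 K], and 8 mixed
    derivatives arise. *)
Lemma cube_sobolev w f (x : V) (K : R) (M : \bar R) : (1 <= K)%R ->
  (forall y v, 0 <= w y v)%R -> phase_continuous w -> slowly_varying w K -> Sk 3 f ->
  bounded_words w M 3 f -> Iv w f x <= ((2 * K) ^+ 3 * 8)%:E * M.
Proof.
move=> K1 w0 cw wK Sf Bw.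
have K20 : (0 < 2 * K)%R by rewrite mulr_gt0 // (lt_le_trans _ K1).
have K20' : 0 <= (2 * K)%:E by rewrite lee_fin ltW.
have cf := Sk_cont Sf.
have f3 i : Sk 2 (pdx i f) by exact: Sk_pdx.
have f2 i j : Sk 1 (pdx j (pdx i f)) by exact: Sk_pdx (f3 i).
have c1 i := Sk_cont (f3 i).
have c2 i j := Sk_cont (f2 i j).
have c3 i j l : phase_continuous (pdx l (pdx j (pdx i f))) := Sk_cont (Sk_pdx l (f2 i j)).
pose g2 h := pdx 1%R h : V -> V -> R; pose g3 h := pdx 2%R h : V -> V -> R.
pose P3 h y := Iv w h y + Iv w (g3 h) y.
pose P2 h y := P3 h y + P3 (g2 h) y.
pose P1 y := P2 f y + P2 (pdx 0%R f) y.
have P30 h y : 0 <= P3 h y by apply: adde_ge0; exact: Iv_ge0.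
have P20 h y : 0 <= P2 h y by exact: (adde_ge0 (P30 h y) (P30 _ y)).
have P10 y : 0 <= P1 y by exact: (adde_ge0 (P20 f y) (P20 _ y)).
have mI h : phase_continuous h -> measurable3 (Iv w h) by move=> ch; exact: measurable3_Iv.
have mP3 h : phase_continuous h -> phase_continuous (g3 h) -> measurable3 (P3 h).
  by move=> ch ch'; exact: (measurable3_add (mI _ ch) (mI _ ch')).
have mP2 h : phase_continuous h -> phase_continuous (g3 h) -> phase_continuous (g2 h) ->
    phase_continuous (g3 (g2 h)) -> measurable3 (P2 h).
  by move=> h1 h2 h3 h4; exact: (measurable3_add (mP3 _ h1 h2) (mP3 _ h3 h4)).
have mPf : measurable3 (P2 f) := mP2 f cf (c1 _) (c1 _) (c2 _ _).
have mPg : measurable3 (P2 (pdx 0%R f)) := mP2 _ (c1 _) (c2 _ _) (c2 _ _) (c3 _ _ _).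
have mP1 : measurable3 P1 by exact: (measurable3_add mPf mPg).
have step3 h y : Sk 1 h -> Iv w h y <= (2 * K)%:E * \int[leb]_(c in `[0%R, 1%R])
    P3 h (y + c *: delta_mx 0%R 2%R)%R.
  by move=> Sh; exact: (Iv_basis_translation y 2%R K1 w0 cw wK Sh).
have comb (A B : R -> \bar R) : (forall s, 0 <= A s) -> (forall s, 0 <= B s) ->
    (2 * K)%:E * \int[leb]_(s in `[0%R, 1%R]) A s + (2 * K)%:E * \int[leb]_(s in `[0%R, 1%R]) B s
    <= (2 * K)%:E * \int[leb]_(s in `[0%R, 1%R]) (A s + B s).
  move=> A0 B0; rewrite -ge0_muleDr; [|exact: integral_ge0|exact: integral_ge0].
  by apply: (lee_wpmul2l K20'); apply: ge0_integralD_nomeas.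
have mono2 (A B : R -> \bar R) : (forall s, 0 <= A s) -> (forall s, A s <= B s) ->
    (2 * K)%:E * \int[leb]_(s in `[0%R, 1%R]) A s <= (2 * K)%:E * \int[leb]_(s in `[0%R, 1%R]) B s.
  by move=> A0 AB; apply: (lee_wpmul2l K20'); apply: ge0_le_integral_nomeas.
have I0 (A : R -> \bar R) : (forall s, 0 <= A s) ->
    0 <= (2 * K)%:E * \int[leb]_(s in `[0%R, 1%R]) A s.
  by move=> A0; apply: mule_ge0 => //; apply: integral_ge0.
have step2 h y : Sk 2 h -> Iv w h y <= (2 * K)%:E * \int[leb]_(b in `[0%R, 1%R])
    ((2 * K)%:E * \int[leb]_(c in `[0%R, 1%R])
    P2 h (y + b *: delta_mx 0%R 1%R + c *: delta_mx 0%R 2%R)%R).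
  move=> Sh; apply: le_trans (Iv_basis_translation y 1%R K1 w0 cw wK (SkS Sh)) _.
  apply: (mono2) => b; first by apply: adde_ge0; exact: Iv_ge0.
  apply: le_trans (leeD (step3 h _ (SkS Sh)) (step3 (pdx 1%R h) _ (Sk_pdx 1%R Sh))) _.
  by apply: (comb) => c; exact: P30.
have step1 : Iv w f x <= (2 * K)%:E * \int[leb]_(a in `[0%R, 1%R])
    ((2 * K)%:E * \int[leb]_(b in `[0%R, 1%R])
    ((2 * K)%:E * \int[leb]_(c in `[0%R, 1%R])
    P1 (x + a *: delta_mx 0%R 0%R + b *: delta_mx 0%R 1%R + c *: delta_mx 0%R 2%R)%R)).
  apply: le_trans (Iv_basis_translation x 0%R K1 w0 cw wK (SkS (SkS Sf))) _.
  apply: (mono2) => a; first by apply: adde_ge0; exact: Iv_ge0.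
  apply: le_trans (leeD (step2 f _ (SkS Sf)) (step2 _ _ (f3 0%R))) _.
  pose U h (b : R) := (2 * K)%:E * \int[leb]_(c in `[0%R, 1%R])
    P2 h (x + a *: delta_mx 0%R 0%R + b *: delta_mx 0%R 1%R + c *: delta_mx 0%R 2%R)%R.
  have U0 h b : 0 <= U h b by apply: (I0) => c; exact: P20.
  apply: (le_trans (comb (U f) (U (pdx 0%R f)) (U0 _) (U0 _))).
  apply: (mono2) => b; first by apply: adde_ge0; exact: U0.
  by apply: (comb) => c; exact: P20.
apply: (le_trans step1).
have z1 (A : R -> \bar R) : (forall s, 0 <= A s) ->
    \int[leb]_(s in `[0%R, 1%R]) ((2 * K)%:E * A s) = (2 * K)%:E * \int[leb]_(s in `[0%R, 1%R]) A s.
  by move=> A0; apply: ge0_integralZl_nomeas.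
have J0 (A : R -> \bar R) : (forall s, 0 <= A s) -> 0 <= \int[leb]_(s in `[0%R, 1%R]) A s.
  by move=> A0; apply: integral_ge0.
rewrite z1; last first.
  by move=> a; apply: (J0) => b; apply: (I0) => c; exact: P10.
have -> : \int[leb]_(a in `[0%R, 1%R]) \int[leb]_(b in `[0%R, 1%R])
    ((2 * K)%:E * \int[leb]_(c in `[0%R, 1%R])
    P1 (x + a *: delta_mx 0%R 0%R + b *: delta_mx 0%R 1%R + c *: delta_mx 0%R 2%R)%R) =
   (2 * K)%:E * \int[leb]_(a in `[0%R, 1%R]) \int[leb]_(b in `[0%R, 1%R]) \int[leb]_(c in `[0%R, 1%R])
    P1 (x + a *: delta_mx 0%R 0%R + b *: delta_mx 0%R 1%R + c *: delta_mx 0%R 2%R)%R.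
  rewrite -z1; last by move=> a; apply: (J0) => b; apply: (J0) => c; exact: P10.
  apply: eq_integral => a _; rewrite z1 //.
  by move=> b; apply: (J0) => c; exact: P10.
rewrite !muleA -!EFinM.
apply: le_trans (lee_wpmul2l _ (cube_le_int3 x mP1 P10)) _.
  by rewrite lee_fin; apply: mulr_ge0; [apply: mulr_ge0|]; exact: ltW.
have JM h : Jint w h <= M -> phase_continuous h -> Jint w (g3 h) <= M ->
    phase_continuous (g3 h) -> int3 setT (P3 h) <= M + M.
  move=> h1 h2 h3 h4; have h0 k y : 0 <= Iv w k y by exact: Iv_ge0.
  exact: (int3D_le (mI _ h2) (mI _ h4) (h0 _) (h0 _) h1 h3).
have [B0 [B1 _]] := Bw.
have b1 i : Jint w (pdx i f) <= M by have [] := B1 i.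
have b2 i j : bounded_words w M 1 (pdx j (pdx i f)) by have [_ [h _]] := B1 i; exact: h.
have b2' i j : Jint w (pdx j (pdx i f)) <= M by have [] := b2 i j.
have b3 i j l : Jint w (pdx l (pdx j (pdx i f))) <= M.
  by have [_ [h _]] := b2 i j; by have [] := h l.
have JP2f : int3 setT (P2 f) <= M + M + (M + M).
  exact: (int3D_le (mP3 f cf (c1 _)) (mP3 _ (c1 _) (c2 _ _)) (P30 _) (P30 _) (JM f B0 cf (b1 _) (c1 _)) (JM _ (b1 _) (c1 _) (b2' _ _) (c2 _ _))).
have JP2g : int3 setT (P2 (pdx 0%R f)) <= M + M + (M + M).
  exact: (int3D_le (mP3 _ (c1 _) (c2 _ _)) (mP3 _ (c2 _ _) (c3 _ _ _)) (P30 _) (P30 _) (JM _ (b1 _) (c1 _) (b2' _ _) (c2 _ _)) (JM _ (b2' _ _) (c2 _ _) (b3 _ _ _) (c3 _ _ _))).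
have JP1 : int3 setT P1 <= 8%:E * M.
  apply: (le_trans (int3D_le mPf mPg (P20 _) (P20 _) JP2f JP2g)).
  have M0 : 0 <= M by apply: le_trans B0; exact: Jint_ge0.
  have e2 (c : R) : (0 <= c)%R -> c%:E * M + c%:E * M = (c + c)%:E * M.
    by move=> c0; rewrite EFinD ge0_muleDl.
  have -> : M + M = (1 + 1)%R%:E * M by rewrite -(e2 1%R ler01) mul1e.
  have p2 : (0 <= 1 + 1 :> R)%R by [].
  have p4 : (0 <= 1 + 1 + (1 + 1) :> R)%R by [].
  rewrite (e2 _ p2) (e2 _ p4) le_eqVlt; apply/orP; left; apply/eqP; congr (_%:E * _); ring.
apply: le_trans (lee_wpmul2l _ JP1) _; first by rewrite lee_fin; apply: mulr_ge0; [apply: mulr_ge0|]; exact: ltW.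
by rewrite muleA -EFinM le_eqVlt; apply/orP; left; apply/eqP; congr (_%:E * _); ring.
Qed.

(** [(1 + r)^2] is at most [4 r^2] when [r >= 1] and at most 4 otherwise; hence [32 = 4 * 8] and
    [256 = 4 * 2^3 * 8], added to cover both cases. *)
Lemma weighted_sobolev w f (x : V) (K : R) (M : \bar R) : (1 <= K)%R ->
  (forall y v, 0 <= w y v)%R -> phase_continuous w -> rot_invariant w ->
  slowly_varying w K -> Sk 3 f -> bounded_words w M 3 f ->
  ((1 + enorm x) ^+ 2)%:E * Iv w f x <= (32 * K * sphere_cst + 256 * K ^+ 3)%:E * M.
Proof.
move=> K1 w0 cw iw wK Sf B.
have M0 : 0 <= M by apply: le_trans (bounded_words_le B); exact: Jint_ge0.
have K0 : (0 <= K)%R by apply: le_trans K1.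
have s0 : (0 <= sphere_cst :> R)%R by rewrite ltW // sphere_cst_gt0.
have x0 : (0 <= enorm x)%R by rewrite /enorm sqrtr_ge0.
have I0 := Iv_ge0 f x w0.
have [x1|x1] := leP 1%R (enorm x).
  apply: (@le_trans _ _ (4%:E * ((enorm x ^+ 2)%:E * Iv w f x))).
    rewrite muleA -EFinM; apply: (lee_wpmul2r I0); rewrite lee_fin; nra.
  apply: le_trans (lee_wpmul2l _ (radial_sobolev K1 w0 cw iw wK Sf x1 B)) _.
    by rewrite lee_fin.
  rewrite muleA -EFinM; apply: (lee_wpmul2r M0); rewrite lee_fin.
  rewrite (_ : (4 * (8 * K * sphere_cst) = 32 * K * sphere_cst)%R); last by ring.
  by rewrite lerDl; apply: mulr_ge0; [exact: ler0n|exact: exprn_ge0].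
apply: (@le_trans _ _ (4%:E * Iv w f x)).
  by apply: (lee_wpmul2r I0); rewrite lee_fin; nra.
apply: le_trans (lee_wpmul2l _ (cube_sobolev x K1 w0 cw wK Sf B)) _; first by rewrite lee_fin.
rewrite muleA -EFinM; apply: (lee_wpmul2r M0); rewrite lee_fin.
have : (0 <= 32 * K * sphere_cst)%R by rewrite !mulr_ge0.
by move: (32 * _ * _)%R => z z0; lra.
Qed.
End CubeSobolev.

(** * The weights s and z *)

Section Weights.
Context {R : realType}.
Local Notation V := 'rV[R]_3.
Implicit Types (f w : V -> V -> R) (i j l : 'I_3) (t q : R) (x y v e : V).

Lemma enorm_ge0 x : 0 <= enorm x.
Proof. exact: sqrtr_ge0. Qed.

Lemma dot_sqr_le x y : (\sum_i x 0 i * y 0 i) ^+ 2 <= enorm x ^+ 2 * enorm y ^+ 2.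
Proof.
rewrite !enorm_sqr !(sum3E 0).
set a0 := x 0 _; set a1 := x 0 _; set a2 := x 0 _.
set b0 := y 0 _; set b1 := y 0 _; set b2 := y 0 _.
(* Lagrange's identity. *)
rewrite -subr_ge0 (_ : _ - _ = (a0 * b1 - a1 * b0) ^+ 2 + (a0 * b2 - a2 * b0) ^+ 2 +
  (a1 * b2 - a2 * b1) ^+ 2); last by ring.
by rewrite !addr_ge0 ?sqr_ge0.
Qed.

Lemma dot_le x y : `|\sum_i x 0 i * y 0 i| <= enorm x * enorm y.
Proof.
rewrite -(@ler_pXn2r _ 2) ?nnegrE ?mulr_ge0 ?enorm_ge0 //.
by rewrite real_normK ?num_real // exprMn dot_sqr_le.
Qed.

Lemma enormD x y : enorm (x + y) <= enorm x + enorm y.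
Proof.
rewrite -(@ler_pXn2r _ 2) ?nnegrE ?addr_ge0 ?enorm_ge0 //.
have -> : enorm (x + y) ^+ 2 = enorm x ^+ 2 + 2 * (\sum_i x 0 i * y 0 i) + enorm y ^+ 2.
  by rewrite !enorm_sqr mulr_sumr -!big_split /=; apply: eq_bigr => i _; rewrite mxE; ring.
have := dot_le x y; have := ler_norm (\sum_i x 0 i * y 0 i); nra.
Qed.

Lemma enormN x : enorm (- x) = enorm x.
Proof. by rewrite -scaleN1r enormZ normrN1 mul1r. Qed.

Lemma enorm_le_shift x e : enorm x <= enorm (x + e) + enorm e.
Proof. by rewrite -(enormN e) -[X in enorm X <= _](addrK e) enormD. Qed.

Definition along y v : R := \sum_i y 0 i * (v 0 i / enorm v).

Lemma alongE y v : along y v = (\sum_i y 0 i * v 0 i) / enorm v.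
Proof. by rewrite /along mulr_suml; apply: eq_bigr => i _; rewrite mulrA. Qed.

Lemma along_le y v : `|along y v| <= enorm y.
Proof.
have [->|v0] := eqVneq v 0.
  by rewrite /along big1 ?normr0 ?enorm_ge0 // => i _; rewrite mxE mul0r mulr0.
have n0 := enorm_gt0 v0.
rewrite alongE normrM normfV (ger0_norm (ltW n0)) ler_pdivrMr //; exact: dot_le.
Qed.

Lemma alongD x y v : along (x + y) v = along x v + along y v.
Proof. by rewrite /along -big_split; apply: eq_bigr => i _; rewrite mxE mulrDl. Qed.

Lemma along_rot i j (c s : R) y v : i != j -> c ^+ 2 + s ^+ 2 = 1 ->
  along (prot i j c s y) (prot i j c s v) = along y v.
Proof. by move=> ij cs; rewrite !alongE rot_dot // enorm_rot. Qed.

Lemma Sk_along k : Sk k along.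
Proof.
by apply: Sk_sum => i; apply: Sk_mul; [exact: Sk_x|apply: Sk_mul; [exact: Sk_v|exact: Sk_inorm]].
Qed.

Lemma phase_continuous_enorm : phase_continuous (fun y v => enorm y).
Proof.
move=> y v _; apply: (@continuous_comp _ _ _ fst (@enorm R)); first exact: cvg_fst.
exact: enorm_continuous.
Qed.

Definition s_abs t y v : R := 1 + `|s_weight t y v|.

Lemma s_weightE t y v : s_weight t y v = t - along y v. Proof. by []. Qed.

Lemma s_abs_ge0 t y v : 0 <= s_abs t y v. Proof. by rewrite /s_abs addr_ge0. Qed.

Lemma phase_continuous_s_abs t : phase_continuous (s_abs t).
Proof.
move=> y v v0; apply: cvgD; first exact: cvg_cst.
have := Sk_cont (Sk_sub (Sk_cst 0 t) (Sk_along 0)) v0 (y := y).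
exact: cvg_norm.
Qed.

Lemma rot_invariant_s_abs t : rot_invariant (s_abs t).
Proof. by move=> i j c s y v ij cs v0; rewrite /s_abs !s_weightE along_rot. Qed.

Lemma slowly_varying_s_abs t : slowly_varying (s_abs t) 2.
Proof.
move=> y e v e1 v0; rewrite /s_abs !s_weightE alongD opprD addrA.
have := le_trans (along_le e v) e1; set a := along e v; set b := t - _ => ha.
have : `|b| <= `|b - a| + `|a| by rewrite -[X in `|X| <= _](subrK a); exact: ler_normD.
have := normr_ge0 (b - a); lra.
Qed.

(** The four ratios [v^mu / v^0] contribute 2. Both [s^2] plus the squares of the [z_ij], and the
    sum of the squares of the [z_0k], equal the squared distance from [y] to [t v / |v|]. The bounds
    on [z] are read off from this distance. *)
Lemma z_weight_sqr t y v : v != 0 ->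
  z_weight t y v ^+ 2 = 2 + 2 * (enorm y ^+ 2 - 2 * t * along y v + t ^+ 2).
Proof.
move=> v0; have n0 := enorm_gt0 v0; have n1 : enorm v != 0 by rewrite gt_eqF.
rewrite /z_weight sqr_sqrtr; last by apply: sumr_ge0 => w _; exact: sqr_ge0.
rewrite /k0 !big_cons big_nil divff // s_weightE /z_rot /z_boost enorm_sqr alongE !(sum3E 0).
have e1 : lift 0 ord0 = 1 :> 'I_3 by exact/val_inj.
have e2 : lift 0 ord_max = 2%R :> 'I_3 by exact/val_inj.
rewrite e1 e2.
have : enorm v ^+ 2 = v 0 0 ^+ 2 + v 0 1 ^+ 2 + v 0 2%R ^+ 2.
  by rewrite enorm_sqr (sum3E 0) e1 e2.
move: (enorm v) n0 n1 (v 0 0) (v 0 1) (v 0 2%R) (y 0 0) (y 0 1) (y 0 2%R) => n n0 n1 a b c x0 x1 x2 hn.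
set A := a / n; set B := b / n; set C := c / n.
have hA : A ^+ 2 + B ^+ 2 + C ^+ 2 = 1.
  by rewrite /A /B /C !exprMn -!mulrDl -hn exprVn divff // expf_neq0.
rewrite (_ : (x0 * a + x1 * b + x2 * c) / n = x0 * A + x1 * B + x2 * C); last first.
  by rewrite /A /B /C; field.
move: A B C hA => A B C hA; apply: subr0_eq.
transitivity ((1 + (x0 ^+ 2 + x1 ^+ 2 + x2 ^+ 2) + t ^+ 2) * (A ^+ 2 + B ^+ 2 + C ^+ 2 - 1)).
  by ring.
by rewrite hA subrr mulr0.
Qed.

Lemma z_weight_ge0 t y v : 0 <= z_weight t y v. Proof. exact: sqrtr_ge0. Qed.

Lemma sqr_le_of_sqr (a b : R) : 0 <= b -> a ^+ 2 <= b ^+ 2 -> a <= b.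
Proof.
move=> b0 h; have [a0|/ltW a0] := leP 0 a; last exact: le_trans a0 b0.
by rewrite -(@ler_pXn2r _ 2) ?nnegrE.
Qed.

Lemma z_weight_boost t y v : v != 0 ->
  z_weight t y v ^+ 2 = 2 + 2 * enorm (y - (t / enorm v) *: v) ^+ 2.
Proof.
move=> v0; rewrite z_weight_sqr //; congr (_ + _ * _).
have n0 : enorm v != 0 by rewrite gt_eqF // enorm_gt0.
rewrite alongE !enorm_sqr.
have -> : \sum_i (y - (t / enorm v) *: v) 0 i ^+ 2 =
    \sum_i y 0 i ^+ 2 - 2 * (t / enorm v) * (\sum_i y 0 i * v 0 i) + (t / enorm v) ^+ 2 * enorm v ^+ 2.
  rewrite enorm_sqr !mulr_sumr -sumrN -!big_split /=.
  by apply: eq_bigr => i _; rewrite !mxE; ring.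
by field.
Qed.

Lemma boost_norm t v : v != 0 -> 0 <= t -> enorm ((t / enorm v) *: v) = t.
Proof.
move=> v0 t0; have n0 := enorm_gt0 v0.
have h : 0 <= t / enorm v by rewrite divr_ge0 // ltW.
by rewrite enormZ (ger0_norm h) divfK // gt_eqF.
Qed.

(** The difference between [|y|] and [t] is at most the distance from [y] to [t v / |v|], a point of
    the sphere of radius [t]. *)
Lemma tau_minus_le_z t y v : 0 <= t -> v != 0 -> tau_minus t y <= z_weight t y v.
Proof.
move=> t0 v0; apply: sqr_le_of_sqr; first exact: z_weight_ge0.
rewrite z_weight_boost // sqr_sqrtr ?addr_ge0 ?sqr_ge0 //.
have h1 := boost_norm v0 t0; set b := _ *: v in h1 *.
have h2 : enorm y <= enorm (y - b) + t by rewrite -[X in enorm X <= _](subrK b) -h1 enormD.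
have h3 : t <= enorm (y - b) + enorm y.
  by have := enorm_le_shift (- b) y; rewrite enormN h1 (addrC (- b)).
have := enorm_ge0 (y - b); nra.
Qed.

Lemma z_weight_ge1 t y v : v != 0 -> 1 <= z_weight t y v.
Proof.
move=> v0; apply: sqr_le_of_sqr; first exact: z_weight_ge0.
rewrite z_weight_boost // expr1n; have := sqr_ge0 (enorm (y - (t / enorm v) *: v)); lra.
Qed.

Lemma z_weight_slow t y e v : enorm e <= 1 -> v != 0 ->
  z_weight t y v <= 2 * z_weight t (y + e) v.
Proof.
move=> e1 v0; apply: sqr_le_of_sqr; first by rewrite mulr_ge0 ?z_weight_ge0.
rewrite exprMn !z_weight_boost // (addrAC y e); set b := _ - _ *: v.
have h : enorm b <= enorm (b + e) + 1.
  by apply: le_trans (enorm_le_shift b e) _; rewrite lerD2l.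
have := enorm_ge0 b; have := enorm_ge0 (b + e).
move: (enorm b) (enorm (b + e)) h => c d h d0 c0.
have : c ^+ 2 <= (d + 1) ^+ 2 by rewrite ler_pXn2r ?nnegrE ?addr_ge0.
have := sqr_ge0 (d - 1); nra.
Qed.

Definition z_power t q y v : R := z_weight t y v `^ q.

Lemma z_power_ge0 t q y v : 0 <= z_power t q y v.
Proof. exact: powR_ge0. Qed.

Lemma phase_continuous_z_weight t : phase_continuous (z_weight t).
Proof.
apply: (@phase_continuous_ext R (fun y v => Num.sqrt (2 + 2 * (enorm y ^+ 2 - 2 * t * along y v + t ^+ 2)))).
  by move=> y v v0; rewrite -z_weight_sqr // sqrtr_sqr ger0_norm // z_weight_ge0.
have h : Sk 0 (fun y v => 2 + 2 * (enorm y ^+ 2 - 2 * t * along y v + t ^+ 2)).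
  have e2 : Sk 0 (fun y v => enorm y ^+ 2).
    have Se : Sk 0 (fun y v => enorm y) by split => //; exact: phase_continuous_enorm.
    exact: (Sk_mul Se Se).
  apply: Sk_add (Sk_cst _ _) _; apply: Sk_mul (Sk_cst _ _) _.
  exact: Sk_add (Sk_sub e2 (Sk_mul (Sk_cst _ (2 * t)) (Sk_along 0))) (Sk_cst _ (t ^+ 2)).
move=> y v v0.
apply: (@continuous_comp _ _ _ (fun p : V * V => 2 + 2 * (enorm p.1 ^+ 2 - 2 * t * along p.1 p.2 + t ^+ 2)) Num.sqrt).
  exact: (Sk_cont h).
exact: sqrt_continuous.
Qed.

Lemma phase_continuous_z_power t q : phase_continuous (z_power t q).
Proof.
move=> y v v0.
apply: (@continuous_comp _ _ _ (fun p : V * V => z_weight t p.1 p.2) (fun a => a `^ q)).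
  exact: phase_continuous_z_weight.
apply/differentiable_continuous/derivable1_diffP; apply: derivable_powR.
by rewrite in_itv /= andbT (lt_le_trans ltr01) // z_weight_ge1.
Qed.

Lemma rot_invariant_z_power t q : rot_invariant (z_power t q).
Proof.
move=> i j c s y v ij cs v0; rewrite /z_power; congr powR.
have v0' : prot i j c s v != 0.
  apply/eqP => h; have := enorm_gt0 v0; rewrite -(enorm_rot v ij cs) h /enorm big1 ?sqrtr0 ?ltxx //.
  by move=> l _; rewrite mxE expr0n.
apply/eqP; rewrite -(@eqrXn2 _ 2) ?z_weight_ge0 //.
by rewrite !z_weight_sqr // along_rot // enorm_rot.
Qed.

Lemma slowly_varying_z_power t q : 0 <= q -> slowly_varying (z_power t q) (2 `^ q).
Proof.
move=> q0 y e v e1 v0; rewrite /z_power -powRM ?z_weight_ge0 //.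
by apply: ge0_ler_powR; rewrite ?nnegrE ?mulr_ge0 ?z_weight_ge0 ?z_weight_slow.
Qed.

(** The weight [r / v^0] carried by [T_phi(g)] in the first estimate. *)
Definition speed_ratio y v : R := enorm y / enorm v.

Lemma speed_ratio_ge0 y v : 0 <= speed_ratio y v.
Proof. by rewrite divr_ge0 ?enorm_ge0. Qed.

Lemma phase_continuous_speed_ratio : phase_continuous speed_ratio.
Proof.
move=> y v v0; apply: cvgM; first exact: phase_continuous_enorm.
exact: (Sk_cont (Sk_inorm 0)).
Qed.

Lemma rot_invariant_speed_ratio : rot_invariant speed_ratio.
Proof. by move=> i j c s y v ij cs v0; rewrite /speed_ratio !enorm_rot. Qed.

(** [s >= t - r] gives the bound for [r <= t], and [tau_-] is bounded for [t < r <= t + 1]. Further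
    out [s] vanishes for some directions of [v] while [tau_-] grows, which forces a separate
    argument there. *)
Lemma tau_minus_le_s t y v : 0 <= t -> enorm y <= t + 1 -> tau_minus t y <= 2 * s_abs t y v.
Proof.
move=> t0 yt; apply: sqr_le_of_sqr; first by rewrite mulr_ge0 // s_abs_ge0.
rewrite sqr_sqrtr ?addr_ge0 ?sqr_ge0 // /s_abs s_weightE.
have := along_le y v; rewrite ler_norml => /andP[_ h].
have := ler_norm (t - along y v); have := normr_ge0 (t - along y v).
have := enorm_ge0 y.
set n := `|_|; have [ty|ty] := leP (enorm y) t; nra.
Qed.

End Weights.

(** * From space-time regularity to a time slice; sums over words *)

Section Slices.
Context {R : realType}.
Local Notation V := 'rV[R]_3.
Implicit Types (i j l : 'I_3) (t q sigma : R) (T : \bar R).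
Implicit Types (g : R -> V -> V -> R) (phi : R -> V -> R).

Lemma slice_continuous T g t : 0 <= t -> (t%:E < T)%E ->
  {within phase_domain T, continuous (fun y => g y.1.1 y.1.2 y.2)} ->
  phase_continuous (g t).
Proof.
move=> t0 tT /subspace_continuousP cg y v v0.
have Dp : phase_domain T (t, y, v) by split.
have h := cg _ Dp => U gU; have {}h := h U gU.
change (nbhs (y, v) [set p : V * V | U (g t p.1 p.2)]).
have ct : ((t, p.1, p.2) : R * V * V) @[p --> (y, v)] --> ((t, y, v) : R * V * V).
  apply: pair_cvg; last exact: cvg_snd.
  by apply: pair_cvg; [exact: cvg_cst|exact: cvg_fst].
have := ct _ h; apply: filterS2 (near_nonzero2 y v0) => p p0 /=; apply.
by split.
Qed.

Lemma Ck_slice T k g t : 0 <= t -> (t%:E < T)%E -> Ck T k g -> Sk k (g t).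
Proof.
move=> t0 tT; elim: k g => [|k IH] g [cg hg].
  by split => //; exact: slice_continuous cg.
split; first exact: slice_continuous cg.
case: hg => hp _ hx hv; split.
- by move=> y v i v0; have [_ h _] := hp t y v (And3 t0 tT v0); exact: h.
- by move=> y v i v0; have [_ _ h] := hp t y v (And3 t0 tT v0); exact: h.
- by move=> i; exact: IH (hx i).
- by move=> i; exact: IH (hv i).
Qed.

Lemma Ck_dt T k g : Ck T k.+1 g -> Ck T k (dt g). Proof. by case=> _ []. Qed.

Lemma Sk_S_field T k g t : 0 <= t -> (t%:E < T)%E -> Ck T k.+1 g -> Sk k (S_field g t).
Proof.
move=> t0 tT Cg; have Sd := Ck_slice t0 tT (Ck_dt Cg); have Sg := Ck_slice t0 tT Cg.
apply: (Sk_add (Sk_mul (Sk_cst k t) Sd)); apply: Sk_sum => i.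
exact: (Sk_mul (Sk_x k i) (Sk_pdx i Sg)).
Qed.

Lemma Sk_Tphi T k g phi sigma t : 0 <= t -> (t%:E < T)%E -> Ck T k.+1 g ->
  Ck T k.+1 (fun t x _ => phi t x) -> Sk k (Tphi sigma phi g t).
Proof.
move=> t0 tT Cg Cp; have Sd := Ck_slice t0 tT (Ck_dt Cg); have Sg := Ck_slice t0 tT Cg.
have Sp := Ck_slice t0 tT Cp.
apply: (Sk_add (Sk_add (Sk_mul (Sk_norm k) Sd) _)).
  by apply: Sk_sum => i; exact: (Sk_mul (Sk_v k i) (Sk_pdx i Sg)).
apply: (Sk_mul (Sk_mul (Sk_cst k sigma) (Sk_norm k))); apply: Sk_sum => i.
exact: (Sk_mul (Sk_pdx i Sp) (Sk_pdv i Sg)).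
Qed.

Local Open Scope ereal_scope.

Lemma Jint_int_x (w f : V -> V -> R) (F : V -> V -> \bar R) :
  (forall y v, v != 0%R -> F y v = (w y v * `|f y v|)%:E) ->
  int_x (fun y => int_v (F y)) = Jint w f.
Proof.
move=> FE; rewrite /int_x /Jint; congr int3; apply/funext => y.
rewrite int_v_off0 /Iv; congr int3; apply/funext => v.
by rewrite /wabs /off0; case: eqVneq => // v0; rewrite FE.
Qed.

Lemma Iv_lower_bound (w f : V -> V -> R) (c : R) (y : V) : (0 < c)%R ->
  (forall v, v != 0%R -> c <= w y v)%R ->
  c%:E * int_v (fun v => `|f y v|%:E) <= Iv w f y.
Proof.
move=> c0 cw; rewrite int_v_off0 /Iv /int3 preimage_setT.
rewrite -ge0_integralZl_nomeas //; last first.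
  by move=> q _; rewrite /off0; case: ifP.
apply: ge0_le_integral_nomeas => q _; rewrite /wabs /off0; case: eqVneq => v0.
- by rewrite mule0.
- by rewrite -EFinM lee_fin mulr_ge0 // ltW.
- by rewrite mule0.
- by rewrite -EFinM lee_fin ler_wpM2r // cw.
Qed.

Lemma lee_sum_In (I : Type) (s : seq I) (F : I -> \bar R) (a : I) :
  (forall a, 0 <= F a) -> List.In a s -> F a <= \sum_(z <- s) F z.
Proof.
move=> F0; elim: s => //= b s IH [->|h]; rewrite big_cons.
  by rewrite leeDl // sume_ge0.
by apply: le_trans (IH h) _; rewrite leeDr.
Qed.

Lemma In_cat (A : Type) (s r : seq A) a : List.In a s \/ List.In a r -> List.In a (s ++ r).
Proof. by elim: s => [[]|b s IH /= [[->|h]|h]] //=; [left|right; apply: IH; left|right; apply: IH; right]. Qed.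

Lemma In_allpairs (A B C : Type) (f : A -> B -> C) (s : seq A) (r : seq B) a b :
  List.In a s -> List.In b r -> List.In (f a b) [seq f x y | x <- s, y <- r].
Proof.
move=> sa tb; elim: s sa => //= c s IH [->|sa].
  by apply: In_cat; left; exact: List.in_map.
by apply: In_cat; right; exact: IH.
Qed.

Lemma In_compositions (F : seq ((R -> V -> V -> R) -> (R -> V -> V -> R))) k A W :
  List.In A F -> List.In W (compositions F k) -> List.In (A \o W) (compositions F k.+1).
Proof. exact: In_allpairs. Qed.

(** Lengths are strictly below [n]: 3 for the words of length at most 2, 4 for those of length at
    most 3. *)
Definition word_sum n (F : seq ((R -> V -> V -> R) -> (R -> V -> V -> R)))
    (w : V -> V -> R) g t : \bar R :=
  \sum_(k < n) \sum_(W <- compositions F k) Jint w (W g t).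

Lemma word_sum_ge n F w g t k W : (forall y v, 0 <= w y v)%R -> (k < n)%N ->
  List.In W (compositions F k) -> Jint w (W g t) <= word_sum n F w g t.
Proof.
move=> w0 kn kW; pose k' := Ordinal kn.
have J0 W' : 0 <= Jint w (W' g t) by exact: Jint_ge0.
apply: le_trans (lee_sum_In J0 kW) _.
rewrite /word_sum (bigD1 k') //= leeDl //.
by apply: sume_ge0 => l _; apply: sume_ge0.
Qed.

Lemma In_dx i : List.In (@dx R i) V_hat.
Proof. have [->|->|->] := ordE3 i; [right; left|do 2 right; left|do 3 right; left]; exact: erefl. Qed.

Lemma In_Omega i j : (i < j)%N -> List.In (@Omega_hat R i j) rotations.
Proof.
have [->|->|->] := ordE3 i; have [->|->|->] := ordE3 j => // _;
  [left|right; left|do 2 right; left]; exact: erefl.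
Qed.

Lemma In_rotations Z : List.In Z rotations -> List.In Z (@V_hat R).
Proof. by move=> h; apply: In_cat; right. Qed.

Lemma words1 F w g t A : (forall y v, 0 <= w y v)%R ->
  List.In A F -> Jint w (A g t) <= word_sum 4 F w g t.
Proof.
move=> w0 FA; apply: (@word_sum_ge 4 F w g t 1 (A \o id)) => //.
by apply: In_compositions => //; left.
Qed.
End Slices.

(** * The z-weighted estimate, and the interior region of the first one *)

Section WeightedDecay.
Context {R : realType}.
Local Notation V := 'rV[R]_3.
Implicit Types (i j l : 'I_3) (t q sigma : R) (T : \bar R).
Implicit Types (g : R -> V -> V -> R) (phi : R -> V -> R) (w : V -> V -> R).
Local Open Scope ereal_scope.

Lemma words2 w g t A B : (forall y v, 0 <= w y v)%R -> List.In A V_hat -> List.In B V_hat ->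
  Jint w (B (A g) t) <= word_sum 4 V_hat w g t.
Proof.
move=> w0 VA VB; apply: (@word_sum_ge R 4 V_hat w g t 2 (B \o (A \o id))) => //.
by apply: In_compositions => //; apply: In_compositions => //; left.
Qed.

Lemma words3 w g t A B C : (forall y v, 0 <= w y v)%R -> List.In A V_hat -> List.In B V_hat ->
  List.In C V_hat -> Jint w (C (B (A g)) t) <= word_sum 4 V_hat w g t.
Proof.
move=> w0 VA VB VC; apply: (@word_sum_ge R 4 V_hat w g t 3 (C \o (B \o (A \o id)))) => //.
by apply: In_compositions => //; apply: In_compositions => //; apply: In_compositions => //; left.
Qed.

Lemma words0 n F w g t : (forall y v, 0 <= w y v)%R -> (0 < n)%N ->
  Jint w (g t) <= word_sum n F w g t.
Proof. by move=> w0 n0; apply: (@word_sum_ge R n F w g t 0 id) => //; left. Qed.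

Lemma Omega_slice i j g t : Omega_hat i j g t = om i j (g t). Proof. by []. Qed.

Lemma dx_slice i g t : dx i g t = pdx i (g t). Proof. by []. Qed.

Let sliceE := (Omega_slice, dx_slice).

Lemma word_sum_bounded_words w g t : (forall y v, 0 <= w y v)%R ->
  bounded_words w (word_sum 4 V_hat w g t) 3 (g t).
Proof.
move=> w0; have dV := @In_dx R; have rV i j (ij : (i < j)%N) := In_rotations (@In_Omega R i j ij).
have M1 A := @words1 R V_hat w g t A w0.
have M2 A B := @words2 w g t A B w0.
have M3 A B C := @words3 w g t A B C w0.
split; first exact: words0.
split => [i|i j ij].
- split; first exact: (M1 _ (dV i)).
  split => [i'|i' j' ij'].
  + split; first by have := M2 _ _ (dV i) (dV i'); rewrite !sliceE.
    split => [k|k l kl]; split; rewrite //.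
      by have := M3 _ _ _ (dV i) (dV i') (dV k); rewrite !sliceE.
    by have := M3 _ _ _ (dV i) (dV i') (rV k l kl); rewrite !sliceE.
  + split; first by have := M2 _ _ (dV i) (rV i' j' ij'); rewrite !sliceE.
    split => [k|k l kl]; split; rewrite //.
      by have := M3 _ _ _ (dV i) (rV i' j' ij') (dV k); rewrite !sliceE.
    by have := M3 _ _ _ (dV i) (rV i' j' ij') (rV k l kl); rewrite !sliceE.
- split; first exact: (M1 _ (rV i j ij)).
  split => [i'|i' j' ij'].
  + split; first by have := M2 _ _ (rV i j ij) (dV i'); rewrite !sliceE.
    split => [k|k l kl]; split; rewrite //.
      by have := M3 _ _ _ (rV i j ij) (dV i') (dV k); rewrite !sliceE.
    by have := M3 _ _ _ (rV i j ij) (dV i') (rV k l kl); rewrite !sliceE.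
  + split; first by have := M2 _ _ (rV i j ij) (rV i' j' ij'); rewrite !sliceE.
    split => [k|k l kl]; split; rewrite //.
      by have := M3 _ _ _ (rV i j ij) (rV i' j' ij') (dV k); rewrite !sliceE.
    by have := M3 _ _ _ (rV i j ij) (rV i' j' ij') (rV k l kl); rewrite !sliceE.
Qed.

Definition sobolev_cst (K : R) : R := (32 * K * sphere_cst + 256 * K ^+ 3)%R.

Lemma sobolev_cst_gt0 (K : R) : (1 <= K)%R -> (0 < sobolev_cst K)%R.
Proof.
move=> K1; have K0 : (0 < K)%R by apply: lt_le_trans K1.
rewrite /sobolev_cst; apply: ltr_pwDl.
  by apply: mulr_gt0; [apply: mulr_gt0; [exact: ltr0n|]|exact: sphere_cst_gt0].
by apply: mulr_ge0; [exact: ler0n|exact: (exprn_ge0 _ (ltW K0))].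
Qed.

(** The weight acts twice: at [x] its lower bound [c] is divided out, while on the right it stays
    inside the integrals. *)
Lemma weighted_decay w g t (x : V) (K c : R) : (1 <= K)%R -> (0 < c)%R ->
  (forall y v, 0 <= w y v)%R -> phase_continuous w -> rot_invariant w ->
  slowly_varying w K -> Sk 3 (g t) -> (forall v, v != 0%R -> c <= w x v)%R ->
  int_v (fun v => `|g t x v|%:E) <=
    (sobolev_cst K / ((1 + enorm x) ^+ 2 * c))%:E * word_sum 4 V_hat w g t.
Proof.
move=> K1 c0 w0 cw iw wK Sg wc.
have r0 : (0 < (1 + enorm x) ^+ 2)%R by rewrite exprn_gt0 // ltr_wpDr ?enorm_ge0.
have h1 := @Iv_lower_bound R w (g t) c x c0 wc.
have h2 := weighted_sobolev x K1 w0 cw iw wK Sg (word_sum_bounded_words g t w0).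
have ac0 : (0 < (1 + enorm x) ^+ 2 * c)%R by exact: mulr_gt0.
rewrite [X in X%:E]mulrC EFinM -muleA lee_pdivlMl // EFinM -muleA.
apply: le_trans h2; apply: lee_wpmul2l h1; by rewrite lee_fin ltW.
Qed.

Lemma z_decay q g t (x : V) : (0 <= t)%R -> (0 <= q)%R -> Sk 3 (g t) ->
  int_v (fun v => `|g t x v|%:E) <=
    (sobolev_cst (2 `^ q) / ((1 + enorm x) ^+ 2 * tau_minus t x `^ q))%:E *
    word_sum 4 V_hat (z_power t q) g t.
Proof.
move=> t0 q0 Sg; have tau1 : (0 < tau_minus t x)%R.
  by rewrite /tau_minus sqrtr_gt0 ltr_pwDl // sqr_ge0.
have K1 : (1 <= 2 `^ q :> R)%R by rewrite -[leLHS](powRr0 2) ler_powR // ler1n.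
have wz v : v != 0%R -> (tau_minus t x `^ q <= z_power t q x v)%R.
  move=> v0; apply: ge0_ler_powR; rewrite ?nnegrE ?z_weight_ge0 ?(ltW tau1) //.
  exact: tau_minus_le_z.
exact: (weighted_decay K1 (powR_gt0 q tau1) (@z_power_ge0 R t q) (@phase_continuous_z_power R t q)
  (@rot_invariant_z_power R t q) (slowly_varying_z_power t q0) Sg wz).
Qed.

Lemma interior_decay g t (x : V) : (0 <= t)%R -> Sk 3 (g t) -> (enorm x <= t + 1)%R ->
  int_v (fun v => `|g t x v|%:E) <=
    (2 * sobolev_cst 2 / ((1 + enorm x) ^+ 2 * tau_minus t x))%:E *
    word_sum 4 V_hat (s_abs t) g t.
Proof.
move=> t0 Sg xt; have tau1 : (0 < tau_minus t x)%R.
  by rewrite /tau_minus sqrtr_gt0 ltr_pwDl // sqr_ge0.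
have -> : (2 * sobolev_cst 2 / ((1 + enorm x) ^+ 2 * tau_minus t x) =
    sobolev_cst 2 / ((1 + enorm x) ^+ 2 * (tau_minus t x / 2)))%R.
  by rewrite !invfM invrK; ring.
have K1 : (1 <= 2 :> R)%R by rewrite ler1n.
have c0 : (0 < tau_minus t x / 2)%R by rewrite divr_gt0.
have ws v : v != 0%R -> (tau_minus t x / 2 <= s_abs t x v)%R.
  by move=> v0; rewrite ler_pdivrMr // mulrC; exact: tau_minus_le_s.
exact: (weighted_decay K1 c0 (@s_abs_ge0 R t) (@phase_continuous_s_abs R t)
  (@rot_invariant_s_abs R t) (slowly_varying_s_abs t) Sg ws).
Qed.

End WeightedDecay.

(** * Integration by parts in v *)

Section BalancedDerivative.
Context {R : realType}.
Local Notation leb := (@lebesgue_measure R).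
Local Open Scope ereal_scope.

Lemma fatou_bound d (T : measurableType d) (mu : {measure set T -> \bar R})
    (u : nat -> T -> \bar R) (f : T -> \bar R) (B : \bar R) :
  (forall n, measurable_fun [set: T] (u n)) -> (forall n x, 0 <= u n x) ->
  (forall x, u n x @[n --> \oo] --> f x) -> (forall n, \int[mu]_x u n x <= B) ->
  \int[mu]_x f x <= B.
Proof.
move=> mu' u0 uf uB.
have -> : \int[mu]_x f x = \int[mu]_x limn_einf (u^~ x).
  by apply: eq_integral => x _; have [-> _] := cvg_limn_einf_sup (uf x).
apply: le_trans (fatou mu measurableT mu' (fun n x _ => u0 n x)) _.
rewrite limn_einf_lim; apply: lime_le; first exact: is_cvg_einfs.
apply: nearW => n; apply: le_trans (uB n); apply: ereal_inf_lbound.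
by exists n => /=.
Qed.

Definition posR (a : R) : R := ((`|a| + a) / 2)%R.
Definition negR (a : R) : R := ((`|a| - a) / 2)%R.

Lemma posR_ge0 a : (0 <= posR a)%R.
Proof. by rewrite /posR; have := ler_norm (- a); rewrite normrN; lra. Qed.

Lemma posR_sub_negR a : (posR a - negR a = a)%R.
Proof. by rewrite /posR /negR; field. Qed.

Lemma posR_le a : (posR a <= `|a|)%R.
Proof. by rewrite /posR; have := ler_norm a; lra. Qed.

Lemma posRN a : posR (- a) = negR a. Proof. by rewrite /posR normrN. Qed.

Lemma negR_ge0 a : (0 <= negR a)%R.
Proof. by rewrite -posRN posR_ge0. Qed.

Lemma negR_le a : (negR a <= `|a|)%R.
Proof. by rewrite -posRN -normrN posR_le. Qed.

Lemma continuous_posR : continuous posR.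
Proof.
move=> a; apply: cvgM; last exact: cvg_cst.
by apply: cvgD; [apply: cvg_norm; exact: cvg_id|exact: cvg_id].
Qed.

Lemma continuous_negR : continuous negR.
Proof.
move=> a; apply: cvgM; last exact: cvg_cst.
by apply: cvgB; [apply: cvg_norm; exact: cvg_id|exact: cvg_id].
Qed.

Lemma log_integral (n Y : R) : (0 <= n)%R -> (n < Y)%R ->
  \int[leb]_(x in `[n, Y]) ((1 + x)^-1)%:E = (ln (1 + Y) - ln (1 + n))%:E.
Proof.
move=> n0 nY.
have pos x : (n <= x)%R -> (0 < 1 + x)%R by move=> nx; rewrite ltr_pwDl // (le_trans n0).
have d x : (n <= x)%R -> is_derive x (1 : R)%R (fun x => ln (1 + x)%R) ((1 + x)^-1)%R.
  move=> nx; have h := is_derive1_ln (pos _ nx).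
  have h' : is_derive x (1 : R)%R (fun x => 1 + x)%R (1 : R)%R.
    have := is_deriveD (is_derive_cst (1 : R)%R x (1 : R)%R) (is_derive_id x (1 : R)%R).
    by rewrite add0r.
  have := @is_derive1_comp R (@ln R) (fun x => 1 + x)%R x _ _ h h'.
  by rewrite mulr1.
have c (x : R) : (n <= x)%R -> {for x, continuous (fun x : R => ln (1 + x) : R)%R}.
  by move=> nx; apply/differentiable_continuous/derivable1_diffP; have [] := d x nx.
rewrite EFinB; apply: (@continuous_FTC2 R (fun x => (1 + x)^-1)%R (fun x => ln (1 + x))%R) => //.
- apply: continuous_in_subspaceT => x; rewrite inE /= in_itv /= => /andP[nx _].
  apply: (cvgV (f := fun x => 1 + x)%R); first by rewrite gt_eqF // pos.
  by apply: cvgD; [exact: cvg_cst|exact: cvg_id].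
- split.
  + by move=> x; rewrite in_itv /= => /andP[/ltW nx _]; have [] := d x nx.
  + exact: (cvg_at_right_filter (c n (lexx n))).
  + exact: (cvg_at_left_filter (c Y (ltW nY))).
- by move=> x; rewrite in_itv /= => /andP[/ltW nx _]; rewrite derive1E; have [_ ->] := d x nx.
Qed.

(** Otherwise [H] would dominate [c / (1 + x)] on a half line, where the integral of the latter
    diverges. *)
Lemma log_divergence (H : R -> \bar R) (c : R) (n : R) : (0 < c)%R -> (0 <= n)%R ->
  measurable_fun [set: R] H -> (forall x, 0 <= H x) -> \int[leb]_x H x < +oo ->
  exists2 X : R, (n <= X)%R & H X < (c / (1 + X))%:E.
Proof.
move=> c0 n0 mH H0 fH; apply: contrapT => h.
have hX X : (n <= X)%R -> (c * (1 + X)^-1)%:E <= H X.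
  by move=> nX; rewrite leNgt; apply/negP => hX; apply: h; exists X.
have I0 : 0 <= \int[leb]_x H x by apply: integral_ge0.
have fI : \int[leb]_x H x \is a fin_num by rewrite ge0_fin_numE.
pose A := fine (\int[leb]_x H x).
have A0 : (0 <= A)%R by exact: fine_ge0.
(* Chosen so that [c * (ln (1 + Y) - ln (1 + n)) = A + 1], which exceeds the integral [A] of [H]. *)
pose Y := ((1 + n) * expR ((A + 1) / c) - 1)%R.
have n1 : (0 < 1 + n)%R by rewrite ltr_pwDl.
have YE : (1 + Y = (1 + n) * expR ((A + 1) / c))%R by rewrite /Y addrC subrK.
have q0 : (0 < (A + 1) / c)%R by rewrite divr_gt0 // ltr_wpDl.
have nY : (n < Y)%R.
  by rewrite -(ltrD2l 1) YE ltr_pMr // expR_gt1.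
have key : (c * (ln (1 + Y) - ln (1 + n)))%:E <= \int[leb]_x H x.
  rewrite EFinM -log_integral // -ge0_integralZl_nomeas //; last first.
    by move=> x /=; rewrite in_itv /= => /andP[nx _]; rewrite lee_fin invr_ge0 addr_ge0 // (le_trans n0).
  apply: (@le_trans _ _ (\int[leb]_(x in `[n, Y]) H x)).
    apply: ge0_le_integral_nomeas => x /=; rewrite in_itv /= => /andP[nx _].
      by rewrite -EFinM lee_fin mulr_ge0 ?(ltW c0) // invr_ge0 addr_ge0 // (le_trans n0).
    by rewrite -EFinM; exact: hX.
  rewrite integral_mkcond; apply: ge0_le_integral_nomeas => x _; rewrite /patch; case: ifP => //.
move: key; rewrite YE lnM ?posrE ?expR_gt0 // expRK addrAC subrr add0r.
rewrite mulrC divfK ?gt_eqF // -(fineK fI) -/A lee_fin; lra.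
Qed.

Lemma integral_posR_negR (f f' : R -> R) (a b : R) : (a < b)%R ->
  (forall x : R, is_derive x (1 : R)%R f (f' x)) -> continuous f' ->
  \int[leb]_(x in `[a, b]) (posR (f' x))%:E =
  \int[leb]_(x in `[a, b]) (negR (f' x))%:E + (f b - f a)%:E.
Proof.
move=> ab df cf.
have ftc : \int[leb]_(x in `[a, b]) (f' x)%:E = (f b)%:E - (f a)%:E.
  have cff : continuous f.
    by move=> x; apply/differentiable_continuous/derivable1_diffP; have [] := df x.
  apply: continuous_FTC2 => //.
  - exact: continuous_subspaceT.
  - split; first by move=> x _; have [] := df x.
    + exact: (cvg_at_right_filter (cff _)).
    + exact: (cvg_at_left_filter (cff _)).
  - by move=> x _; rewrite derive1E; have [_ ->] := df x.
have ip : leb.-integrable [set` `[a, b]] (EFin \o (fun x => posR (f' x))).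
  apply: continuous_compact_integrable; first exact: segment_compact.
  apply: continuous_subspaceT => x.
  by apply: continuous_comp; [exact: cf|exact: continuous_posR].
have im : leb.-integrable [set` `[a, b]] (EFin \o (fun x => negR (f' x))).
  apply: continuous_compact_integrable; first exact: segment_compact.
  apply: continuous_subspaceT => x.
  by apply: continuous_comp; [exact: cf|exact: continuous_negR].
have := @integralB_EFin _ (measurableTypeR R) R leb _ _ _ (measurable_itv _) ip im.
have -> : \int[leb]_(x in `[a, b]) ((posR (f' x))%:E - (negR (f' x))%:E) =
    \int[leb]_(x in `[a, b]) (f' x)%:E.
  by apply: eq_integral => x _; rewrite -EFinB posR_sub_negR.
rewrite ftc -EFinB => ->.
by rewrite addeCA subee ?adde0 //; exact: integrable_fin_num im.
Qed.

Lemma integral_symm_le (H : R -> \bar R) : measurable_fun [set: R] H -> (forall x, 0 <= H x) ->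
  \int[leb]_x H (- x)%R <= \int[leb]_x H x.
Proof.
move=> mH H0; have := @integral_expanding R setT 1%R (fun s => - s)%R H measurableT _ ltr01 _ mH H0.
rewrite invr1 mul1e; apply.
- by apply: continuous_measurable_fun => x; apply: cvgN; exact: cvg_id.
- by move=> x y _ _; rewrite mul1r -opprD normrN.
Qed.

(* A derivative has vanishing integral over the line when it is integrable and its
   primitive is [o(|x|)] in the weak sense that [f / (1 + |x|)] is integrable: otherwise
   [|f x| + |f (- x)|] is bounded below for large [x], and [\int dx / (1 + x)] diverges. *)
Lemma balanced_derivative (f f' : R -> R) (H : R -> \bar R) (c : R) : (0 < c)%R ->
  (forall x : R, is_derive x (1 : R)%R f (f' x)) -> continuous f' ->
  measurable_fun [set: R] H -> (forall x, 0 <= H x) -> \int[leb]_x H x < +oo ->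
  (forall x, `|f' x|%:E <= c%:E * H x) ->
  (forall x, `|f x|%:E <= (c * (1 + `|x|))%:E * H x) ->
  \int[leb]_x (posR (f' x))%:E <= \int[leb]_x (negR (f' x))%:E.
Proof.
move=> c0 df cf mH H0 fH bf' bf.
set B := \int[leb]_x (negR (f' x))%:E.
have mp (D : set R) : measurable_fun D (fun x => (posR (f' x))%:E).
  apply/measurable_EFinP; apply: measurable_funTS; apply: continuous_measurable_fun => x.
  by apply: continuous_comp; [exact: cf|exact: continuous_posR].
have mn (D : set R) : measurable_fun D (fun x => (negR (f' x))%:E).
  apply/measurable_EFinP; apply: measurable_funTS; apply: continuous_measurable_fun => x.
  by apply: continuous_comp; [exact: cf|exact: continuous_negR].
have B0 : 0 <= B by apply: integral_ge0 => x _; rewrite lee_fin negR_ge0.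
have BH : B < +oo.
  apply: (@le_lt_trans _ _ (c%:E * \int[leb]_x H x)).
    rewrite -ge0_integralZl_nomeas //.
    apply: ge0_le_integral_nomeas => x _; first by rewrite lee_fin negR_ge0.
    by apply: le_trans (bf' x); rewrite lee_fin negR_le.
  by rewrite lte_mul_pinfty ?lee_fin ?(ltW c0).
apply/lee_addgt0Pr => eps e0.
pose u (n : nat) x := if x \in `[(- n%:R)%R, n%:R%R] then (posR (f' x))%:E else 0.
apply: (@fatou_bound _ _ leb u).
- move=> n; apply: measurable_fun_ifT; [|exact: (mp setT)|exact: measurable_cst].
  rewrite (_ : (fun _ => _) = fun q : R => (- n%:R <= q) && (q <= n%:R))%R; last first.
    by apply/funext => q; rewrite in_itv.
  by apply: measurable_and; apply: measurable_fun_ler.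
- by move=> n x; rewrite /u; case: ifP => // _; rewrite lee_fin posR_ge0.
- move=> x; apply: cvg_near_cst; near=> n.
  rewrite /u ifT // in_itv /= -ler_norml.
  by near: n; exact: nbhs_infty_ger.
move=> n.
have mH2 : measurable_fun [set: R] (fun x => H x + H (- x)%R).
  apply: emeasurable_funD => //; apply: (measurableT_comp mH).
  by apply: continuous_measurable_fun => x; apply: cvgN; exact: cvg_id.
have H20 x : 0 <= H x + H (- x)%R by rewrite adde_ge0.
have fH2 : \int[leb]_x (H x + H (- x)%R) < +oo.
  rewrite ge0_integralD //; last first.
    apply: (measurableT_comp mH).
    by apply: continuous_measurable_fun => x; apply: cvgN; exact: cvg_id.
  rewrite lte_add_pinfty //; exact: le_lt_trans (integral_symm_le mH H0) fH.
(* The symmetric sum [H x + H (- x)] yields a single [X] good for both ends of the interval, and the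
   constant [eps / c] makes the boundary term at most [eps]. Asking for [n.+1] forces [X > 0]. *)
have [X nX hX] := log_divergence (divr_gt0 e0 c0) (ler0n R n.+1) mH2 H20 fH2.
have X0 : (0 < X)%R by apply: lt_le_trans nX; rewrite ltr0n.
have small : (f X - f (- X) <= eps)%R.
  have hf : `|f X|%:E + `|f (- X)|%R%:E <= (c * (1 + X))%:E * (H X + H (- X)%R).
    rewrite ge0_muleDr //; have h1 := bf X; have h2 := bf (- X)%R.
    by move: h1 h2; rewrite normrN (ger0_norm (ltW X0)); exact: leeD.
  have : (`|f X| + `|f (- X)|)%:E <= eps%:E.
    rewrite EFinD; apply: le_trans hf _.
    have c1 : (0 < c * (1 + X))%R by rewrite mulr_gt0 // addr_gt0.
    apply: le_trans (lee_wpmul2l _ (ltW hX)) _; first by rewrite lee_fin ltW.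
    rewrite -EFinM lee_fin le_eqVlt; apply/orP; left; apply/eqP; field.
    by rewrite !gt_eqF // addr_gt0.
  by rewrite lee_fin; have := ler_norm (f X); have := ler_norm (- f (- X))%R; rewrite normrN; lra.
have NX : (- X < X)%R by rewrite gtrN.
have pn := integral_posR_negR NX df cf.
apply: (@le_trans _ _ (\int[leb]_(x in `[(- X)%R, X]) (posR (f' x))%:E)).
  rewrite [leRHS]integral_mkcond; apply: ge0_le_integral_nomeas => x _.
    by rewrite /u; case: ifP => // _; rewrite lee_fin posR_ge0.
  rewrite /u /patch mem_setE; case: ifP => [|_]; last by case: ifP => // _; rewrite lee_fin posR_ge0.
  rewrite !in_itv /= => /andP[x1 x2]; rewrite ifT //.
  have nX' : (n%:R <= X)%R by apply: le_trans nX; rewrite ler_nat.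
  by rewrite (le_trans x2 nX') andbT; apply: le_trans x1; rewrite lerN2.
rewrite pn; apply: leeD; last by rewrite lee_fin.
rewrite integral_mkcond; apply: ge0_le_integral_nomeas => x _; rewrite /patch.
  by case: ifP => // _; rewrite lee_fin negR_ge0.
by case: ifP => // _; rewrite lee_fin negR_ge0.
Unshelve. all: by end_near. Qed.

End BalancedDerivative.

(** * From lines to the whole velocity space *)

Section IntegrationByParts.
Context {R : realType}.
Local Notation leb := (@lebesgue_measure R).
Local Notation V := 'rV[R]_3.
Local Notation E := (R * R * R)%type.
Implicit Types (i j k l : 'I_3).
Local Open Scope ereal_scope.

Lemma integral_off_zero (G : R -> \bar R) : measurable_fun [set: R] G -> (forall a, 0 <= G a) ->
  \int[leb]_a G a = \int[leb]_a (if a == 0%R then 0 else G a).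
Proof.
move=> mG G0.
have m1 : measurable ([set 0%R] : set (measurableTypeR R)) by exact: measurable_set1.
have -> : \int[leb]_a G a = \int[leb]_(a in [set: R] `\` [set 0%R]) G a.
  apply: (@ge0_negligible_integral _ (measurableTypeR R)) => //.
  exact: lebesgue_measure_set1.
rewrite integral_mkcond; apply: eq_integral => a _; rewrite /patch.
case: eqVneq => [->|a0]; first by rewrite memNset //= => -[_ /(_ erefl)].
by rewrite mem_set //=; split=> // e; rewrite e eqxx in a0.
Qed.

Lemma measurable3_slice (h : V -> V -> R) (y : V) : phase_continuous h ->
  measurable3 (off0 (fun v => (h y v)%:E)).
Proof.
move=> ch; apply: (measurable33_comp (measurable33_cont ch)) => l.
  exact: measurable_cst.
exact: measurable_vec3.
Qed.

Lemma enorm_insert3 k (a b s : R) : (enorm (insert3 k a b s) <= `|a| + `|b| + `|s|)%R.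
Proof.
apply: sqr_le_of_sqr; first by rewrite !addr_ge0.
rewrite enorm_sqr (sum3E k) insert3_k insert3_i insert3_j.
rewrite -[(a ^+ 2)%R]real_normK ?num_real // -[(b ^+ 2)%R]real_normK ?num_real //.
rewrite -[(s ^+ 2)%R]real_normK ?num_real //.
have := normr_ge0 a; have := normr_ge0 b; have := normr_ge0 s.
move: `|a|%R `|b|%R `|s|%R => p q r *; nra.
Qed.

Lemma insert3_neq0 k (a b s : R) : a != 0%R -> insert3 k a b s != 0%R.
Proof.
apply: contraNneq => e; have := insert3_i k a b s; rewrite e mxE => <-; exact: eqxx.
Qed.

Lemma insert3_is_derive (F : V -> V -> R) y k (a b s : R) : Sk 1 F -> a != 0%R ->
  is_derive s (1 : R)%R (fun s => F y (insert3 k a b s)) (pdv k F y (insert3 k a b s)).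
Proof.
move=> SF a0.
have dy l : is_derive s (1 : R)%R (fun s : R => y 0%R l) (0 : R)%R by exact: is_derive_cst.
have dv' l : is_derive s (1 : R)%R (fun s => insert3 k a b s 0%R l) ((l == k)%:R : R)%R.
  have [->|lk] := eqVneq l k.
    rewrite (_ : (fun _ => _) = id); first exact: is_derive_id.
    by apply/funext => r; rewrite insert3_k.
  rewrite (_ : (fun _ => _) = cst (if l == lift k ord0 then a else b)).
    exact: is_derive_cst.
  by apply/funext => r; rewrite mxE (negbTE lk).
have := phase_curve_is_derive (a := fun _ => y) SF (insert3_neq0 k b s a0) dy dv'.
rewrite big1; last by move=> l _; rewrite mul0r.
rewrite add0r (bigD1 k) //= eqxx mul1r big1 ?addr0 //.
by move=> l /negbTE ->; rewrite mul0r.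
Qed.

Lemma insert3_continuous k (a b : R) : continuous (fun s => insert3 k a b s).
Proof.
move=> s; apply: mx_cvg_coord => l.
have [->|lk] := eqVneq l k.
  rewrite insert3_k (_ : (fun _ => _) = id); first exact: cvg_id.
  by apply/funext => r; rewrite insert3_k.
rewrite mxE (negbTE lk) (_ : (fun _ => _) = cst (if l == lift k ord0 then a else b)).
  exact: cvg_cst.
by apply/funext => r; rewrite mxE (negbTE lk).
Qed.

(** [a != 0] keeps the line away from [v = 0], where nothing is known about the regularity of
    [F]. *)
Lemma line_balanced (F : V -> V -> R) (y : V) k (H : V -> R) (c a b : R) :
  (0 < c)%R -> Sk 1 F -> measurable3 (fun v => (H v)%:E) -> (forall v, 0 <= H v)%R ->
  (forall v, v != 0 -> `|pdv k F y v| <= c * H v)%R ->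
  (forall v, v != 0 -> `|F y v| <= c * (1 + enorm v) * H v)%R -> a != 0%R ->
  \int[leb]_s (H (insert3 k a b s))%:E < +oo ->
  \int[leb]_s (posR (pdv k F y (insert3 k a b s)))%:E <=
  \int[leb]_s (negR (pdv k F y (insert3 k a b s)))%:E.
Proof.
move=> c0 SF mH H0 bd bf a0 fH.
(* On this line [1 + |v| <= (1 + |a| + |b|) (1 + |s|)], which converts growth in [|v|] into the
   growth allowed by [balanced_derivative]. *)
pose c' := (c * (1 + `|a| + `|b|))%R.
have c'0 : (0 < c')%R by rewrite mulr_gt0 // -addrA ltr_pwDl // addr_ge0.
have n0 s := insert3_neq0 k b s a0.
have cp : continuous (fun s => pdv k F y (insert3 k a b s)).
  move=> s; have cD := Sk_cont (Sk_pdv k SF).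
  have cy : (fun _ : R => y) r @[r --> s] --> y by exact: cvg_cst.
  exact: (cvg_comp _ _ (pair_cvg cy (@insert3_continuous k a b s)) (cD _ _ (n0 s))).
apply: (@balanced_derivative R (fun s => F y (insert3 k a b s)) _
    (fun s => (H (insert3 k a b s))%:E) c') => //.
- by move=> s; exact: insert3_is_derive.
- by apply: (measurable_insert3 k mH); [exact: measurable_cst|exact: measurable_cst|exact: measurable_id].
- by move=> s; rewrite lee_fin.
- move=> s; rewrite -EFinM lee_fin; apply: le_trans (bd _ (n0 s)) _.
  apply: ler_wpM2r => //; rewrite /c' ler_peMr ?(ltW c0) // -addrA lerDl addr_ge0 //.
- move=> s; rewrite -EFinM lee_fin; apply: le_trans (bf _ (n0 s)) _.
  apply: ler_wpM2r => //; rewrite /c' -mulrA; apply: ler_wpM2l; first exact: ltW.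
  have := enorm_insert3 k a b s; have := normr_ge0 a; have := normr_ge0 b; have := normr_ge0 s.
  move: `|a|%R `|b|%R `|s|%R => p q r *; nra.
Qed.

(** Integration by parts with no boundary term, as a comparison of positive and negative parts.
    [line_balanced] applies on the lines where [H] is integrable; adding [eps * H] on the right
    makes the comparison trivial on the other lines and costs at most [delta] in total. *)
Lemma int3_balanced (F : V -> V -> R) (y : V) k (H : V -> R) (c : R) :
  (0 < c)%R -> Sk 1 F -> measurable3 (fun v => (H v)%:E) -> (forall v, 0 <= H v)%R ->
  int3 setT (fun v => (H v)%:E) < +oo ->
  (forall v, v != 0 -> `|pdv k F y v| <= c * H v)%R ->
  (forall v, v != 0 -> `|F y v| <= c * (1 + enorm v) * H v)%R ->
  int3 setT (off0 (fun v => (posR (pdv k F y v))%:E)) <=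
  int3 setT (off0 (fun v => (negR (pdv k F y v))%:E)).
Proof.
move=> c0 SF mH H0 fH bd bf.
have cD := Sk_cont (Sk_pdv k SF).
have cpos : phase_continuous (fun y v => posR (pdv k F y v)).
  move=> z v v0; exact: (cvg_comp _ _ (cD z v v0) (@continuous_posR R _)).
have cneg : phase_continuous (fun y v => negR (pdv k F y v)).
  move=> z v v0; exact: (cvg_comp _ _ (cD z v v0) (@continuous_negR R _)).
pose P := off0 (fun v => (posR (pdv k F y v))%:E).
pose N := off0 (fun v => (negR (pdv k F y v))%:E).
have mP : measurable3 P := measurable3_slice y cpos.
have mN : measurable3 N := measurable3_slice y cneg.
have P0 v : 0 <= P v by rewrite /P /off0; case: ifP => // _; rewrite lee_fin posR_ge0.
have N0 v : 0 <= N v by rewrite /N /off0; case: ifP => // _; rewrite lee_fin negR_ge0.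
have H0' v : 0 <= (H v)%:E by rewrite lee_fin.
have I0 : 0 <= int3 setT (fun v => (H v)%:E) by exact: int3_ge0.
have fI : int3 setT (fun v => (H v)%:E) \is a fin_num by rewrite ge0_fin_numE.
apply/lee_addgt0Pr => delta d0.
(* The 1 makes [A] positive, and [eps = delta / A] then gives [eps * int H <= delta]. *)
pose A := (fine (int3 setT (fun v => (H v)%:E)) + 1)%R.
have A0 : (0 < A)%R by rewrite ltr_wpDl // fine_ge0.
pose eps := (delta / A)%R; have e0 : (0 < eps)%R by rewrite divr_gt0.
have mG : measurable3 (fun v => eps%:E * (H v)%:E).
  by apply: emeasurable_funM => //; exact: measurable_cst.
have G0 v : 0 <= eps%:E * (H v)%:E by rewrite mule_ge0 // lee_fin ltW.
apply: (@le_trans _ _ (int3 setT (fun v => N v + eps%:E * (H v)%:E))); last first.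
  rewrite (int3D mN mG N0 G0) (int3Zl mH H0' (ltW e0)); apply: leeD2l.
  rewrite -(fineK fI) -EFinM lee_fin /eps mulrAC ler_pdivrMr // ler_wpM2l ?(ltW d0) //.
  by rewrite lerDl.
have mQ : measurable3 (fun v => N v + eps%:E * (H v)%:E) by exact: measurable3_add.
have Q0 v : 0 <= N v + eps%:E * (H v)%:E by exact: adde_ge0.
rewrite (int3_insert k mP P0) (int3_insert k mQ Q0).
have mline F' (a b : R) : measurable3 F' -> measurable_fun [set: R] (fun s => F' (insert3 k a b s)).
  by move=> mF'; apply: (measurable_insert3 k mF'); [exact: measurable_cst|exact: measurable_cst|exact: measurable_id].
have line (a b : R) : a != 0%R -> \int[leb]_s P (insert3 k a b s) <=
    \int[leb]_s (N (insert3 k a b s) + eps%:E * (H (insert3 k a b s))%:E).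
  move=> a0; rewrite ge0_integralD //; [|exact: mline|exact: (mline _ _ _ mG)].
  rewrite ge0_integralZl_nomeas //.
  have [fL|nL] := ltP (\int[leb]_s (H (insert3 k a b s))%:E) +oo; last first.
    move: nL; rewrite leye_eq => /eqP ->; rewrite gt0_muley ?lte_fin // addey ?leey //.
    by rewrite -ltNye (lt_le_trans _ (integral_ge0 _ _)) // => s _; exact: N0.
  have off (F' : V -> \bar R) s : off0 F' (insert3 k a b s) = F' (insert3 k a b s).
    by rewrite /off0 (negbTE (insert3_neq0 k b s a0)).
  apply: (@le_trans _ _ (\int[leb]_s N (insert3 k a b s))); last first.
    by rewrite leeDl // mule_ge0 ?lee_fin ?(ltW e0) // integral_ge0.
  have -> : \int[leb]_s P (insert3 k a b s) = \int[leb]_s (posR (pdv k F y (insert3 k a b s)))%:E.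
    by apply: eq_integral => s _; rewrite /P off.
  have -> : \int[leb]_s N (insert3 k a b s) = \int[leb]_s (negR (pdv k F y (insert3 k a b s)))%:E.
    by apply: eq_integral => s _; rewrite /N off.
  exact: (line_balanced c0 SF mH H0 bd bf a0 fL).
have PI0 a : 0 <= \int[leb]_b \int[leb]_s P (insert3 k a b s).
  by apply: integral_ge0 => b _; apply: integral_ge0.
have QI0 a : 0 <= \int[leb]_b \int[leb]_s (N (insert3 k a b s) + eps%:E * (H (insert3 k a b s))%:E).
  by apply: integral_ge0 => b _; apply: integral_ge0.
(* The lines that may meet [v = 0] lie over [a = 0], a null set. *)
rewrite (integral_off_zero _ PI0); last first.
  apply: (@measurable_int_snd R _ _ (fun a b => \int[leb]_s P (insert3 k a b s))); last first.
    by move=> a b; apply: integral_ge0.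
  apply: (@measurable_int_snd R _ _ (fun (q : R * R) s => P (insert3 k q.1 q.2 s))) => //.
  apply: (measurable_insert3 k mP); last exact: measurable_snd.
    exact: (measurableT_comp measurable_fst measurable_fst).
  exact: (measurableT_comp measurable_snd measurable_fst).
apply: ge0_le_integral_nomeas => a _; first by case: ifP.
case: eqVneq => [_|a0]; first exact: QI0.
apply: ge0_le_integral_nomeas => b _; first by apply: integral_ge0.
exact: line.
Qed.

End IntegrationByParts.

(** * Smoothed absolute value, and the drift in v *)

Section Regularisation.
Context {R : realType}.
Local Notation V := 'rV[R]_3.
Implicit Types (i j k l : 'I_3) (eps a : R) (f : V -> V -> R).

(* a smooth approximation of the absolute value from below *)
Definition reg eps a : R := Num.sqrt (a ^+ 2 + eps ^+ 2) - eps.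
Definition dreg eps a : R := a / Num.sqrt (a ^+ 2 + eps ^+ 2).

Lemma reg_sqrt_gt0 eps a : 0 < eps -> 0 < Num.sqrt (a ^+ 2 + eps ^+ 2).
Proof. by move=> e0; rewrite sqrtr_gt0 ltr_wpDl ?sqr_ge0 // exprn_gt0. Qed.

Lemma reg_sqrt_sqr eps a : 0 < eps -> Num.sqrt (a ^+ 2 + eps ^+ 2) ^+ 2 = a ^+ 2 + eps ^+ 2.
Proof. by move=> e0; rewrite sqr_sqrtr // addr_ge0 ?sqr_ge0. Qed.

Lemma reg_ge0 eps a : 0 < eps -> 0 <= reg eps a.
Proof.
move=> e0; rewrite /reg subr_ge0; apply: sqr_le_of_sqr; first exact/ltW/reg_sqrt_gt0.
by rewrite reg_sqrt_sqr // lerDr sqr_ge0.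
Qed.

Lemma reg_le eps a : 0 < eps -> reg eps a <= `|a|.
Proof.
move=> e0; rewrite /reg lerBlDr; apply: sqr_le_of_sqr; first by rewrite addr_ge0 // ltW.
rewrite reg_sqrt_sqr // sqrrD real_normK ?num_real // lerD2r lerDl.
by rewrite mulrn_wge0 // mulr_ge0 // ltW.
Qed.

Lemma reg_ge eps a : 0 < eps -> `|a| - eps <= reg eps a.
Proof.
move=> e0; rewrite /reg lerD2r; apply: sqr_le_of_sqr; first exact/ltW/reg_sqrt_gt0.
by rewrite reg_sqrt_sqr // real_normK ?num_real // lerDl sqr_ge0.
Qed.

Lemma dreg_le1 eps a : 0 < eps -> `|dreg eps a| <= 1.
Proof.
move=> e0; have s0 := reg_sqrt_gt0 a e0.
rewrite /dreg normrM normfV (gtr0_norm s0) ler_pdivrMr // mul1r.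
apply: sqr_le_of_sqr; first exact: ltW.
by rewrite reg_sqrt_sqr // real_normK ?num_real // lerDl sqr_ge0.
Qed.

Lemma reg_is_derive eps a : 0 < eps -> is_derive a (1 : R) (reg eps) (dreg eps a).
Proof.
move=> e0; have s0 : 0 < a ^+ 2 + eps ^+ 2 by rewrite ltr_wpDl ?sqr_ge0 // exprn_gt0.
have h : is_derive a (1 : R) (fun b : R => b ^+ 2 + eps ^+ 2) (2 * a).
  by apply: is_derive_eq; rewrite /GRing.scale /=; ring.
have := @is_derive1_comp R Num.sqrt (fun b : R => b ^+ 2 + eps ^+ 2) a _ _ (is_derive1_sqrt s0) h.
move=> h1; have := is_deriveB h1 (is_derive_cst eps a (1 : R)).
rewrite subr0 (_ : _ * _ = dreg eps a) //.
by rewrite /dreg; field; rewrite gt_eqF // reg_sqrt_gt0.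
Qed.

Lemma continuous_dreg eps : 0 < eps -> continuous (dreg eps).
Proof.
move=> e0 a; apply: cvgM; first exact: cvg_id.
apply: (cvgV (f := fun b : R => Num.sqrt (b ^+ 2 + eps ^+ 2))).
  by rewrite gt_eqF // reg_sqrt_gt0.
apply: (@continuous_comp _ _ _ (fun b : R => b ^+ 2 + eps ^+ 2) Num.sqrt).
  by apply: cvgD; [exact: exprn_continuous|exact: cvg_cst].
exact: sqrt_continuous.
Qed.

Lemma reg_partials eps f i y v : 0 < eps -> Sk 1 f -> v != 0 ->
  pdx i (fun y v => reg eps (f y v)) y v = dreg eps (f y v) * pdx i f y v /\
  pdv i (fun y v => reg eps (f y v)) y v = dreg eps (f y v) * pdv i f y v.
Proof.
move=> e0 [_ [f1 f2 _ _]] v0.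
have h1 : is_derive y (delta_mx 0 i : V) (fun z => f z v) (pdx i f y v) by split => //; exact: f1.
have h2 : is_derive v (delta_mx 0 i : V) (f y) (pdv i f y v) by split => //; exact: f2.
have [_ e1] := comp_is_derive h1 (reg_is_derive (f y v) e0).
by have [_ e2] := comp_is_derive h2 (reg_is_derive (f y v) e0); split.
Qed.

Lemma phase_continuous_comp (phi : R -> R) f : continuous phi -> phase_continuous f ->
  phase_continuous (fun y v => phi (f y v)).
Proof. by move=> cp cf y v v0; exact: (cvg_comp _ _ (cf y v v0) (cp _)). Qed.

Lemma Sk_reg eps f : 0 < eps -> Sk 1 f -> Sk 1 (fun y v => reg eps (f y v)).
Proof.
move=> e0 Sf; have cf := Sk_cont Sf; have [_ [f1 f2 f3 f4]] := Sf.
have cr : continuous (reg eps).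
  by move=> a; apply/differentiable_continuous/derivable1_diffP; have [] := reg_is_derive a e0.
have cq : Sk 0 (fun y v => dreg eps (f y v)).
  by split => //; apply: phase_continuous_comp => //; exact: continuous_dreg.
split; first exact: phase_continuous_comp.
split.
- move=> y v i v0.
  have h1 : is_derive y (delta_mx 0 i : V) (fun z => f z v) (pdx i f y v) by split => //; exact: f1.
  by have [] := comp_is_derive h1 (reg_is_derive (f y v) e0).
- move=> y v i v0.
  have h2 : is_derive v (delta_mx 0 i : V) (f y) (pdv i f y v) by split => //; exact: f2.
  by have [] := comp_is_derive h2 (reg_is_derive (f y v) e0).
- move=> i; apply: Sk_ext (Sk_mul cq (f3 i)) => y v v0.
  by have [-> _] := reg_partials i y e0 Sf v0.
- move=> i; apply: Sk_ext (Sk_mul cq (f4 i)) => y v v0.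
  by have [_ ->] := reg_partials i y e0 Sf v0.
Qed.

(* The [v]-rotations in the identity below act as [sum_i m_i d/dv_i], and [m] is almost
   divergence free. *)
Definition drift (om : V) i (v : V) : R :=
  (\sum_l v 0 l * om 0 l) * (v 0 i / enorm v) - enorm v * om 0 i.

Lemma Sk_drift k om i : Sk k (fun _ v => drift om i v).
Proof.
apply: Sk_sub; last exact: Sk_mul (Sk_norm k) (Sk_cst k _).
apply: Sk_mul; last exact: Sk_mul (Sk_v k i) (Sk_inorm k).
by apply: Sk_sum => l; exact: Sk_mul (Sk_v k l) (Sk_cst k _).
Qed.

(** The two terms in [om_i v_i / |v|] cancel. What is left is homogeneous of degree 0 in [v], hence
    bounded, so integrating by parts loses no weight in [v]. *)
Lemma drift_is_derive om i v : v != 0 ->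
  is_derive v (delta_mx 0 i : V) (drift om i)
    ((\sum_l v 0 l * om 0 l) / enorm v * (1 - (v 0 i / enorm v) ^+ 2)).
Proof.
move=> v0; have n0 : enorm v != 0 by rewrite gt_eqF // enorm_gt0.
pose e : V := delta_mx 0 i.
have dn : is_derive v e (@enorm R) (v 0 i / enorm v) by exact: enorm_is_derive.
have dl : is_derive v e (fun w : V => \sum_l w 0 l * om 0 l) (om 0 i).
  have dj j : is_derive v e (fun w : V => w 0 j * om 0 j) ((i == j)%:R * om 0 j).
    apply: (is_derive_eq (is_deriveM (coord_is_derive v i j) (is_derive_cst (om 0 j) v e))).
    by rewrite scaler0 add0r; exact: mulrC.
  have -> : (fun w : V => \sum_l w 0 l * om 0 l) = \sum_(l < 3) (fun w : V => w 0 l * om 0 l).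
    by apply/funext => w; rewrite fct_sumE.
  apply: (is_derive_eq (is_derive_sum dj)).
  rewrite (bigD1 i) //= eqxx mul1r big1 ?addr0 // => j ji.
  by rewrite eq_sym (negbTE ji) mul0r.
have iv : is_derive v e (fun w => (enorm w)^-1) (- (v 0 i / enorm v) / enorm v ^+ 2).
  have [d1 d2] := dn; split; first exact: derivableV.
  by rewrite (@deriveV _ _ (@enorm R) v) // d2 /GRing.scale /=; field.
have dq := is_deriveM (coord_is_derive v i i) iv.
have dB := is_deriveB (is_deriveM dl dq) (is_deriveM dn (is_derive_cst (om 0 i) v e)).
apply: (is_derive_eq dB); rewrite eqxx scaler0 /GRing.scale /=.
rewrite (_ : ((fun z : V => z 0 i) * (fun w : V => (enorm w)^-1)) v = v 0 i / enorm v) //.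
by set s := \sum_l _; field.
Qed.

Lemma coord_le (x : V) i : `|x 0 i| <= enorm x.
Proof.
apply: sqr_le_of_sqr; first exact: enorm_ge0.
rewrite real_normK ?num_real // enorm_sqr (bigD1 i) //= lerDl.
by apply: sumr_ge0 => j _; exact: sqr_ge0.
Qed.

End Regularisation.

(** * The exterior region *)

Section RadialIdentity.
Context {R : realType}.
Local Notation V := 'rV[R]_3.
Implicit Types (i j k l : 'I_3).

(* With [tau], [X], [W] standing for the derivatives of [g] in [t], [x], [v], [p] for the
   gradient of [phi] and [h] for [v / |v|]: [(rho^2 - t^2) d_rho] in terms of [S], [T_phi],
   [s d_rho], the rotations, and [v]-derivatives. *)
Lemma radial_identity (t rho n sigma tau : R) (om h X W p : 'I_3 -> R) :
  \sum_i om i ^+ 2 = 1 -> \sum_i h i ^+ 2 = 1 ->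
  let D := \sum_i om i * X i in
  let Om i j := rho * om i * X j - rho * om j * X i + n * h i * W j - n * h j * W i in
  let a i j := h j * om i - h i * om j in
  (rho ^+ 2 - t ^+ 2) * D =
  rho * (t * tau + \sum_i rho * om i * X i)
  - t * rho * (tau + \sum_i h i * X i + sigma * \sum_i p i * W i)
  - t * (t - rho * \sum_i om i * h i) * D
  + t * (a 0 1 * Om 0 1 + a 0 2%R * Om 0 2%R + a 1 2%R * Om 1 2%R)
  + \sum_i (t * rho * sigma * p i - t * ((\sum_l n * h l * om l) * h i - n * om i)) * W i.
Proof.
have e1 : lift 0 ord0 = 1 :> 'I_3 by exact/val_inj.
have e2 : lift 0 ord_max = 2%R :> 'I_3 by exact/val_inj.
move=> ho hh D Om a; rewrite /D /Om /a {D Om a}; move: ho hh; rewrite !(sum3E 0) e1 e2.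
move: (om 0) (om 1) (om 2%R) (h 0) (h 1) (h 2%R) (X 0) (X 1) (X 2%R) (W 0) (W 1) (W 2%R) (p 0) (p 1) (p 2%R).
move=> o0 o1 o2 h0 h1 h2 x0 x1 x2 w0 w1 w2 p0 p1 p2 ho hh /=.
apply/eqP; rewrite -subr_eq0; apply/eqP.
(* The two sides differ by multiples of [|h|^2 - 1] and [|om|^2 - 1] only. *)
transitivity (t * n * (o0 * w0 + o1 * w1 + o2 * w2) * (h0 ^+ 2 + h1 ^+ 2 + h2 ^+ 2 - 1)
  - t * rho * (h0 * x0 + h1 * x1 + h2 * x2) * (o0 ^+ 2 + o1 ^+ 2 + o2 ^+ 2 - 1)).
  by ring.
by rewrite ho hh; ring.
Qed.

End RadialIdentity.

(** * Integrals in v of nonnegative functions *)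

Section VelocityIntegrals.
Context {R : realType}.
Local Notation V := 'rV[R]_3.
Implicit Types (f h w : V -> V -> R) (y v : V).
Local Open Scope ereal_scope.

Definition vint h y : \bar R := int3 setT (off0 (fun v => (h y v)%:E)).

Lemma off0_ge0 h y v : (forall v, v != 0 -> 0 <= h y v)%R -> 0 <= off0 (fun v => (h y v)%:E) v.
Proof. by move=> h0; rewrite /off0; case: ifPn => // v0; rewrite lee_fin h0. Qed.

Lemma vint_ge0 h y : (forall v, v != 0 -> 0 <= h y v)%R -> 0 <= vint h y.
Proof. by move=> h0; apply: int3_ge0 => v; exact: off0_ge0. Qed.

Lemma le_vint h1 h2 y : (forall v, v != 0 -> 0 <= h1 y v)%R ->
  (forall v, v != 0 -> h1 y v <= h2 y v)%R -> vint h1 y <= vint h2 y.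
Proof.
move=> h0 h12; apply: le_int3 => v; first exact: off0_ge0.
by rewrite /off0; case: ifPn => // v0; rewrite lee_fin h12.
Qed.

Lemma eq_vint h1 h2 y : (forall v, v != 0 -> h1 y v = h2 y v)%R -> vint h1 y = vint h2 y.
Proof.
move=> h12; rewrite /vint; congr int3; apply/funext => v.
by rewrite /off0; case: ifPn => // v0; rewrite h12.
Qed.

Lemma vintD h1 h2 y : phase_continuous h1 -> phase_continuous h2 ->
  (forall v, v != 0 -> 0 <= h1 y v)%R -> (forall v, v != 0 -> 0 <= h2 y v)%R ->
  vint (fun y v => h1 y v + h2 y v)%R y = vint h1 y + vint h2 y.
Proof.
move=> c1 c2 p1 p2; rewrite /vint.
rewrite -(int3D (measurable3_slice y c1) (measurable3_slice y c2)) //.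
- by congr int3; apply/funext => v; rewrite /off0; case: ifP => // _; rewrite adde0.
- by move=> v; exact: off0_ge0.
- by move=> v; exact: off0_ge0.
Qed.

Lemma vintZ h (c : R) y : (0 < c)%R -> (forall v, v != 0 -> 0 <= h y v)%R ->
  vint (fun y v => c * h y v)%R y = c%:E * vint h y.
Proof.
move=> c0 h0; rewrite /vint /int3 preimage_setT -ge0_integralZl_nomeas //; last first.
  by move=> q _; exact: off0_ge0.
by apply: eq_integral => q _; rewrite /off0; case: ifP => // _; rewrite mule0.
Qed.

Lemma vint_lty h y (H : V -> R) (c : R) : (0 < c)%R ->
  (forall v, 0 <= H v)%R ->
  int3 setT (fun v => (H v)%:E) < +oo ->
  (forall v, v != 0 -> 0 <= h y v <= c * H v)%R -> vint h y < +oo.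
Proof.
move=> c0 H0 fH hH.
apply: (@le_lt_trans _ _ (c%:E * int3 setT (fun v => (H v)%:E))); last first.
  by rewrite lte_mul_pinfty ?lee_fin ?(ltW c0).
rewrite /vint /int3 preimage_setT -ge0_integralZl_nomeas //; last first.
  by move=> q _; rewrite lee_fin.
apply: ge0_le_integral_nomeas => q _.
  by apply: off0_ge0 => v v0; have /andP[] := hH v v0.
rewrite /off0; case: ifPn => v0; first by rewrite -EFinM lee_fin mulr_ge0 // ltW.
by rewrite -EFinM lee_fin; have /andP[] := hH _ v0.
Qed.

Lemma Iv_vint w f y : Iv w f y = vint (fun y v => w y v * `|f y v|)%R y.
Proof. by []. Qed.

Lemma phase_continuousD f h : phase_continuous f -> phase_continuous h ->
  phase_continuous (fun y v => f y v + h y v)%R.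
Proof. by move=> cf ch y v v0; apply: cvgD; [exact: cf|exact: ch]. Qed.

Lemma phase_continuousZ f (c : R) : phase_continuous f ->
  phase_continuous (fun y v => c * f y v)%R.
Proof. by move=> cf y v v0; apply: cvgM; [exact: cvg_cst|exact: cf]. Qed.

Lemma phase_continuous_norm f : phase_continuous f ->
  phase_continuous (fun y v => `|f y v|)%R.
Proof. by move=> cf y v v0; apply: cvg_norm; exact: cf. Qed.

(** Each [t] is bounded by [rho], terms without [s] are weakened by [1 <= 1 + |s|], and the overall
    2 absorbs the bounds on [a1], [a2], [a3] and on the divergence [2 * hw]. *)
Lemma flux_term_bound (q t rho n s D S' T' a1 a2 a3 hw u G X0 X1 X2 O1 O2 O3 : R) :
  (`|q| <= 1 -> 0 <= t -> t <= rho -> 0 < n -> `|D| <= `|X0| + `|X1| + `|X2| ->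
  `|a1| <= 2 -> `|a2| <= 2 -> `|a3| <= 2 -> `|hw| <= 1 -> 0 <= u -> u <= G ->
  `|q * (rho * S' - t * rho * (T' / n) - t * s * D + t * (a1 * O1 + a2 * O2 + a3 * O3))
    + t * u * (2 * hw)| <=
  2 * rho * (rho / n * `|T'| + (1 + `|s|) * `|S'| + (1 + `|s|) * `|X0| + (1 + `|s|) * `|X1| +
    (1 + `|s|) * `|X2| + (1 + `|s|) * `|O1| + (1 + `|s|) * `|O2| + (1 + `|s|) * `|O3| +
    (1 + `|s|) * G))%R.
Proof.
move=> q1 t0 tr n0 HD A1 A2 A3 hw1 u0 uG.
have r0 : (0 <= rho)%R by apply: le_trans tr.
have B1 : (`|rho * S'| = rho * `|S'|)%R by rewrite normrM ger0_norm.
have B2 : (`|t * rho * (T' / n)| <= rho * (rho / n * `|T'|))%R.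
  rewrite !normrM normfV (ger0_norm t0) (ger0_norm r0) (gtr0_norm n0).
  rewrite (_ : rho * (rho / n * _) = rho * rho * (`|T'| / n))%R; last by ring.
  by rewrite ler_wpM2r ?divr_ge0 ?(ltW n0) // ler_wpM2r.
have B3 : (`|t * s * D| <= rho * (`|s| * (`|X0| + `|X1| + `|X2|)))%R.
  rewrite -mulrA normrM (ger0_norm t0) normrM; apply: ler_pM => //.
  by rewrite ler_wpM2l.
have B4 : (`|t * (a1 * O1 + a2 * O2 + a3 * O3)| <= rho * (2 * (`|O1| + `|O2| + `|O3|)))%R.
  rewrite normrM (ger0_norm t0); apply: ler_pM => //.
  apply: le_trans (ler_normD _ _) _; rewrite mulrDr; apply: lerD.
    apply: le_trans (ler_normD _ _) _; rewrite mulrDr.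
    by apply: lerD; rewrite normrM ler_wpM2r.
  by rewrite normrM ler_wpM2r.
have B5 : (`|t * u * (2 * hw)| <= rho * (2 * G))%R.
  rewrite -mulrA normrM (ger0_norm t0) normrM (ger0_norm u0).
  apply: ler_pM => //; first by rewrite mulr_ge0.
  rewrite mulrC; apply: ler_pM => //.
  by rewrite normrM (ger0_norm (ler0n R 2)) -[leRHS]mulr1 ler_wpM2l.
apply: le_trans (ler_normD _ _) _.
have Bq z : (`|q * z| <= `|z|)%R by rewrite normrM ler_piMl.
have Btri : (`|rho * S' - t * rho * (T' / n) - t * s * D + t * (a1 * O1 + a2 * O2 + a3 * O3)| <=
   `|rho * S'| + `|t * rho * (T' / n)| + `|t * s * D| + `|t * (a1 * O1 + a2 * O2 + a3 * O3)|)%R.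
  apply: le_trans (ler_normD _ _) _; rewrite lerD2r.
  apply: le_trans (ler_normB _ _) _; rewrite lerD2r.
  exact: ler_normB.
apply: le_trans (lerD (le_trans (Bq _) Btri) B5) _.
rewrite B1 in Btri *; apply: le_trans (lerD (lerD (lerD (lerD (lexx _) B2) B3) B4) (lexx _)) _.
have G0 : (0 <= G)%R by apply: le_trans uG.
have sa (z : R) : (`|z| <= (1 + `|s|) * `|z|)%R by rewrite mulrDl mul1r lerDl mulr_ge0.
have sb (z : R) : (`|s| * `|z| <= (1 + `|s|) * `|z|)%R by rewrite mulrDl mul1r lerDr.
have sG : (G <= (1 + `|s|) * G)%R by rewrite mulrDl mul1r lerDl mulr_ge0.
apply: (@le_trans _ _ (rho * (`|S'| + rho / n * `|T'| + `|s| * (`|X0| + `|X1| + `|X2|) +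
    2 * (`|O1| + `|O2| + `|O3|) + 2 * G))%R).
  by rewrite le_eqVlt; apply/orP; left; apply/eqP; ring.
rewrite -[leRHS]mulrA [leRHS]mulrCA; apply: ler_wpM2l => //.
have Tn : (0 <= rho / n * `|T'|)%R by rewrite mulr_ge0 // divr_ge0 // ltW.
have := sa S'; have := sa O1; have := sa O2; have := sa O3.
have := sb X0; have := sb X1; have := sb X2.
have p0 (z : R) : (0 <= (1 + `|s|) * `|z|)%R by rewrite mulr_ge0 // addr_ge0.
have := p0 X0; have := p0 X1; have := p0 X2; have := p0 S'.
move: sG Tn; lra.
Qed.

End VelocityIntegrals.

(** * The radial derivative and the fields to be integrated by parts *)

Section RadialFlux.
Context {R : realType}.
Local Notation V := 'rV[R]_3.
Implicit Types (t sigma rho eps : R) (g : R -> V -> V -> R) (phi : R -> V -> R).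
Implicit Types (f : V -> V -> R) (om y v : V).

(** The derivative of [reg eps f] in the direction [om], for nonzero [v]. *)
Definition flux eps om f y v : R := dreg eps (f y v) * \sum_i om 0 i * pdx i f y v.

Lemma phase_continuous_flux eps om f : 0 < eps -> Sk 1 f -> phase_continuous (flux eps om f).
Proof.
move=> e0 Sf y v v0; apply: cvgM.
  exact: (phase_continuous_comp (continuous_dreg e0) (Sk_cont Sf) (y := y) v0).
have h : Sk 0 (fun y v => \sum_i om 0 i * pdx i f y v).
  by apply: Sk_sum => i; apply: Sk_mul; [exact: Sk_cst|exact: Sk_pdx].
exact: (Sk_cont h (y := y) v0).
Qed.

Definition ray_weight t (k : 'I_9) : V -> V -> R :=
  if k == ord0 then @speed_ratio R else s_abs t.

(** Eight entries for nine indices: index 8 falls on the default value [g t]. Index 0, the transport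
    term, is the one weighted by [r / v^0]. *)
Definition ray_term sigma phi g t (k : 'I_9) : V -> V -> R :=
  nth (g t) [:: Tphi sigma phi g t; S_field g t; pdx 0 (g t); pdx 1 (g t); pdx 2%R (g t);
    om 0 1 (g t); om 0 2%R (g t); om 1 2%R (g t)] k.

Lemma ray_weight_ge0 t k y v : 0 <= ray_weight t k y v.
Proof. by rewrite /ray_weight; case: ifP => _; [exact: speed_ratio_ge0|exact: s_abs_ge0]. Qed.

Lemma phase_continuous_ray_weight t k : phase_continuous (ray_weight t k).
Proof.
rewrite /ray_weight; case: ifP => _; first exact: phase_continuous_speed_ratio.
exact: phase_continuous_s_abs.
Qed.

Lemma rot_invariant_ray_weight t k : rot_invariant (ray_weight t k).
Proof.
rewrite /ray_weight; case: ifP => _; first exact: rot_invariant_speed_ratio.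
exact: rot_invariant_s_abs.
Qed.

(* the vector field [-F_i d/dv_i] collects the [v]-derivatives of the radial identity *)
Definition flux_field (al : R) t eps om i f y v : R :=
  (t * drift om i v - al) * reg eps (f y v).

Lemma Sk_flux_field al t eps om i f : 0 < eps -> Sk 1 f -> Sk 1 (flux_field al t eps om i f).
Proof.
move=> e0 Sf; apply: (Sk_mul _ (Sk_reg e0 Sf)).
exact: (Sk_sub (Sk_mul (Sk_cst 1 t) (Sk_drift 1 om i)) (Sk_cst 1 al)).
Qed.

Definition drift_div om i v : R :=
  (\sum_l v 0 l * om 0 l) / enorm v * (1 - (v 0 i / enorm v) ^+ 2).

Lemma flux_field_derive al t eps om i f y v : 0 < eps -> Sk 1 f -> v != 0 ->
  pdv i (flux_field al t eps om i f) y v =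
  t * drift_div om i v * reg eps (f y v) +
  (t * drift om i v - al) * (dreg eps (f y v) * pdv i f y v).
Proof.
move=> e0 Sf v0; pose e : V := delta_mx 0 i.
have [_ [_ r2 _ _]] := Sk_reg e0 Sf.
have D2 : is_derive v e (fun w => reg eps (f y w)) (dreg eps (f y v) * pdv i f y v).
  split; first exact: r2.
  by have [_ <-] := reg_partials i y e0 Sf v0.
have D1 := is_deriveB (is_deriveM (is_derive_cst t v e) (drift_is_derive om i v0)) (is_derive_cst al v e).
have [_ h] := is_deriveM D1 D2.
rewrite /pdv; have -> : flux_field al t eps om i f y =
  (cst t * drift om i - cst al) * (fun w : V => reg eps (f y w)) by [].
rewrite h scaler0 addr0 subr0 /GRing.scale /= -/(drift_div om i v).
rewrite (_ : (cst t * drift om i - cst al) v = t * drift om i v - al) //.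
by rewrite addrC; congr (_ + _); exact: mulrC.
Qed.

Lemma unit_enorm om : \sum_l om 0 l ^+ 2 = 1 -> enorm om = 1.
Proof. by move=> h; rewrite /enorm h sqrtr1. Qed.

Lemma dot_ratio_le om v : \sum_l om 0 l ^+ 2 = 1 -> v != 0 ->
  `|(\sum_l v 0 l * om 0 l) / enorm v| <= 1.
Proof.
move=> om1 v0; have n0 := enorm_gt0 v0.
rewrite normrM normfV (gtr0_norm n0) ler_pdivrMr // mul1r.
by have := dot_le v om; rewrite (unit_enorm om1) mulr1.
Qed.

Lemma ratio_le v i : v != 0 -> `|v 0 i / enorm v| <= 1.
Proof.
move=> v0; have n0 := enorm_gt0 v0.
by rewrite normrM normfV (gtr0_norm n0) ler_pdivrMr // mul1r coord_le.
Qed.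

Lemma drift_div_le om i v : \sum_l om 0 l ^+ 2 = 1 -> v != 0 -> `|drift_div om i v| <= 1.
Proof.
move=> om1 v0; rewrite /drift_div normrM.
have h1 := dot_ratio_le om1 v0; have := ratio_le i v0.
set h := v 0 i / _ => hh.
have h2 : 0 <= h ^+ 2 <= 1 by rewrite sqr_ge0 /= -(@real_normK _ h) ?num_real // exprn_ile1.
have : `|1 - h ^+ 2| <= 1 by rewrite ger0_norm; move: h2 => /andP[]; lra.
by move=> h3; rewrite -[leRHS]mulr1; apply: ler_pM.
Qed.

Lemma drift_le om i v : \sum_l om 0 l ^+ 2 = 1 -> v != 0 -> `|drift om i v| <= 2 * enorm v.
Proof.
move=> om1 v0; have n0 := enorm_gt0 v0; rewrite /drift.
apply: le_trans (ler_normB _ _) _; rewrite mulr2n mulrDl mul1r; apply: lerD.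
  rewrite normrM -[leRHS]mulr1; apply: ler_pM => //; last exact: ratio_le.
  by have := dot_le v om; rewrite (unit_enorm om1) mulr1.
rewrite normrM (gtr0_norm n0) -[leRHS]mulr1; apply: ler_pM => //; first exact: ltW.
by apply: le_trans (coord_le om i) _; rewrite (unit_enorm om1).
Qed.

(** The divergence of the drift, which integration by parts leaves in front of [reg eps g]. *)
Lemma sum_drift_div om v : v != 0 ->
  \sum_i drift_div om i v = 2 * ((\sum_l v 0 l * om 0 l) / enorm v).
Proof.
move=> v0; rewrite /drift_div -mulr_sumr sumrB.
have -> : \sum_i (v 0 i / enorm v) ^+ 2 = 1.
  under eq_bigr do rewrite exprMn.
  by rewrite -mulr_suml -enorm_sqr -exprMn divff ?expr1n // gt_eqF // enorm_gt0.
by rewrite sumr_const card_ord mulrC; congr (_ * _); ring.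
Qed.

(** These are the two domination hypotheses of [int3_balanced]. The drift grows like [|v|]; the
    factor [1 + |v|] in front of the gradient in [v_dominated] is there to match it. *)
Lemma flux_field_bounds al c t eps om i f y v (H : R) : 0 <= t -> 0 < eps -> Sk 1 f -> v != 0 ->
  \sum_l om 0 l ^+ 2 = 1 -> `|al| + 2 * t <= c ->
  `|f y v| + (1 + enorm v) * (\sum_l `|pdv l f y v|) <= H ->
  `|pdv i (flux_field al t eps om i f) y v| <= c * H /\
  `|flux_field al t eps om i f y v| <= c * (1 + enorm v) * H.
Proof.
move=> t0 e0 Sf v0 om1 alc fH; have n0 := enorm_gt0 v0.
have c0 : 0 <= c by apply: le_trans alc; rewrite addr_ge0 // mulr_ge0.
have u1 : `|reg eps (f y v)| <= `|f y v| by rewrite ger0_norm ?reg_ge0 // reg_le.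
have a1 : `|t * drift om i v - al| <= c * (1 + enorm v).
  apply: le_trans (ler_normB _ _) _; rewrite normrM (ger0_norm t0).
  have := drift_le i om1 v0; have := normr_ge0 al.
  move: `|drift _ _ _| `|al| (enorm v) n0 alc => p q n n0 *; nra.
have g1 : `|pdv i f y v| <= \sum_l `|pdv l f y v|.
  by rewrite (bigD1 i) //= lerDl sumr_ge0.
have s0 : 0 <= \sum_l `|pdv l f y v| by apply: sumr_ge0.
split.
  rewrite flux_field_derive //; apply: le_trans (ler_normD _ _) _.
  apply: (le_trans _ (ler_wpM2l c0 fH)); rewrite [leRHS]mulrDr; apply: lerD.
    rewrite -mulrA normrM (ger0_norm t0); apply: ler_pM => //.
      by have := normr_ge0 al; lra.
    rewrite normrM -[leRHS]mul1r; apply: ler_pM => //; exact: drift_div_le.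
  rewrite normrM mulrA; apply: ler_pM => //.
  rewrite normrM -[leRHS]mul1r; apply: ler_pM => //; exact: dreg_le1.
rewrite normrM; apply: ler_pM => //; apply: le_trans u1 (le_trans _ fH).
by rewrite lerDl mulr_ge0 // addr_ge0 // ltW.
Qed.

End RadialFlux.

(** * Balance of the positive and negative radial flux *)

Section FluxBalance.
Context {R : realType}.
Local Notation V := 'rV[R]_3.
Implicit Types (t sigma rho eps : R) (g : R -> V -> V -> R) (phi : R -> V -> R).
Implicit Types (f w : V -> V -> R) (dir y v : V).

(* what remains of the radial derivative once the [v]-derivatives are integrated by parts *)
Definition remainder sigma phi g t rho eps dir y v : R :=
  (rho ^+ 2 - t ^+ 2) * flux eps dir (g t) y v +
  \sum_i pdv i (flux_field (t * rho * sigma * pdx i (fun x _ => phi t x) y 0) t eps dir i (g t)) y v.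

(** Multiplied by [dreg], the [v]-derivatives of the radial identity become those of [reg eps g] and
    cancel against the same terms in the derivatives of the flux fields. Only the divergence of the
    drift times [reg eps g] is left; outside [T_phi(g)] the gradient of [phi] is gone. *)
Lemma remainder_bound sigma phi g t rho eps dir v : 0 <= t -> t <= rho -> 0 < eps ->
  \sum_l dir 0 l ^+ 2 = 1 -> Sk 1 (g t) -> v != 0 ->
  `|remainder sigma phi g t rho eps dir (rho *: dir) v| <=
  \sum_(k < 9) 2 * rho * ray_weight t k (rho *: dir) v * `|ray_term sigma phi g t k (rho *: dir) v|.
Proof.
move=> t0 tr e0 dir1 Sg v0; set y := rho *: dir.
have r0 : 0 <= rho by apply: le_trans tr.
have n0 := enorm_gt0 v0; have n1 : enorm v != 0 by rewrite gt_eqF.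
pose X i := pdx i (g t) y v; pose W i := pdv i (g t) y v; pose p i := pdx i (fun x _ => phi t x) y 0.
pose h i := v 0 i / enorm v; pose q := dreg eps (g t y v); pose u := reg eps (g t y v).
pose tau := dt g t y v.
have hh : \sum_i h i ^+ 2 = 1.
  rewrite /h; under eq_bigr do rewrite exprMn.
  by rewrite -mulr_suml -enorm_sqr -exprMn divff ?expr1n.
have vh i : v 0 i = enorm v * h i by rewrite /h mulrC divfK.
have yE i : y 0 i = rho * dir 0 i by rewrite mxE.
have ny : enorm y = rho by rewrite enormZ (unit_enorm dir1) mulr1 ger0_norm.
have hw : (\sum_l v 0 l * dir 0 l) / enorm v = \sum_l dir 0 l * h l.
  by rewrite mulr_suml; apply: eq_bigr => l _; rewrite /h; ring.
pose a i j := h j * dir 0 i - h i * dir 0 j.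
have SE : S_field g t y v = t * tau + \sum_i rho * dir 0 i * X i.
  by rewrite /S_field; congr (_ + _); apply: eq_bigr => i _; rewrite yE.
have TE : Tphi sigma phi g t y v / enorm v = tau + \sum_i h i * X i + sigma * \sum_i p i * W i.
  rewrite /Tphi -/tau; apply: (canLR (mulfK n1)).
  rewrite !mulrDl mulr_suml; congr (_ + _ + _); first exact: mulrC.
    by apply: eq_bigr => i _; rewrite vh (_ : dx i g t y v = X i) //; ring.
  by rewrite -mulrA (mulrC (enorm v)) mulrA.
have sE : s_weight t y v = t - rho * \sum_i dir 0 i * h i.
  by rewrite /s_weight mulr_sumr; congr (_ - _); apply: eq_bigr => i _; rewrite yE -mulrA.
have OE i j : om i j (g t) y v = rho * dir 0 i * X j - rho * dir 0 j * X i +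
    enorm v * h i * W j - enorm v * h j * W i.
  by rewrite /om !yE (vh i) (vh j).
have mE i : drift dir i v = (\sum_l enorm v * h l * dir 0 l) * h i - enorm v * dir 0 i.
  by rewrite /drift; congr (_ * _ - _); apply: eq_bigr => l _; rewrite -vh.
pose D := \sum_i dir 0 i * X i.
pose al i := t * rho * sigma * p i.
have RI := @radial_identity R t rho (enorm v) sigma tau (dir 0) h X W p dir1 hh.
rewrite /= -SE -TE -sE -!OE -/D in RI.
have E : remainder sigma phi g t rho eps dir y v =
   q * (rho * S_field g t y v - t * rho * (Tphi sigma phi g t y v / enorm v) - t * s_weight t y v * D
     + t * (a 0 1 * om 0 1 (g t) y v + a 0 2%R * om 0 2%R (g t) y v + a 1 2%R * om 1 2%R (g t) y v))
   + t * u * (2 * \sum_l dir 0 l * h l).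
  have -> : \sum_l dir 0 l * h l = (\sum_l v 0 l * dir 0 l) / enorm v by [].
  rewrite -sum_drift_div // /remainder.
  have -> : \sum_i pdv i (flux_field (t * rho * sigma * pdx i (fun x _ => phi t x) y 0) t eps dir i (g t)) y v
     = t * u * (\sum_i drift_div dir i v) - q * \sum_i (al i - t * drift dir i v) * W i.
    rewrite mulr_sumr mulr_sumr -sumrB; apply: eq_bigr => i _.
    by rewrite flux_field_derive // -/q -/u -/(W i) -/(p i) -/(al i); ring.
  rewrite /flux -/q -/D [in LHS]mulrCA RI.
  rewrite (eq_bigr (fun i => (al i - t * drift dir i v) * W i)); last first.
    by move=> i _; rewrite mE.
  rewrite -/(a 0 1) -/(a 0 2%R) -/(a 1 2%R) -/al.
  move: (\sum_i (al i - _) * W i) (\sum_i drift_div dir i v) (D) (q) (u) (a 0 1) (a 0 2%R) (a 1 2%R).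
  move: (om 0 1 (g t) y v) (om 0 2%R (g t) y v) (om 1 2%R (g t) y v) (S_field g t y v).
  by move: (Tphi sigma phi g t y v / enorm v) (s_weight t y v) => *; ring.
rewrite E.
have a2 i j : `|a i j| <= 2.
  have b1 k : `|h k| <= 1 by exact: ratio_le.
  have b2 k : `|dir 0 k| <= 1 by rewrite -(unit_enorm dir1) coord_le.
  have b3 (x z : R) : `|x| <= 1 -> `|z| <= 1 -> `|x * z| <= 1 by move=> *; rewrite normrM mulr_ile1.
  exact: le_trans (ler_normB _ _) (lerD (b3 _ _ (b1 j) (b2 i)) (b3 _ _ (b1 i) (b2 j))).
have DX : `|D| <= `|X 0| + `|X 1| + `|X 2%R|.
  have e1 : lift 0 ord0 = 1 :> 'I_3 by exact/val_inj.
  have e2 : lift 0 ord_max = 2%R :> 'I_3 by exact/val_inj.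
  rewrite /D (sum3E 0) e1 e2.
  have b2 k z : `|dir 0 k * z| <= `|z|.
    by rewrite normrM ler_piMl // -(unit_enorm dir1) coord_le.
  apply: le_trans (ler_normD _ _) _; apply: lerD => //.
  by apply: le_trans (ler_normD _ _) _; apply: lerD.
have hw1 : `|\sum_l dir 0 l * h l| <= 1 by rewrite -hw; exact: dot_ratio_le.
have uG : u <= `|g t y v| by exact: reg_le.
have u0 : 0 <= u by exact: reg_ge0.
apply: le_trans (@flux_term_bound R q t rho (enorm v) (s_weight t y v) D _ _ _ _ _ _ u _
  _ _ _ _ _ _ (dreg_le1 _ e0) t0 tr n0 DX (a2 _ _) (a2 _ _) (a2 _ _) hw1 u0 uG) _.
rewrite !big_ord_recl big_ord0 /ray_weight /ray_term /=.
rewrite /speed_ratio ny -/(X 0) -/(X 1) -/(X 2%R) /s_abs.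
have idt (c r s T' S' x0 x1 x2 o1 o2 o3 G : R) :
    c * (r * T' + s * S' + s * x0 + s * x1 + s * x2 + s * o1 + s * o2 + s * o3 + s * G) =
    c * r * T' + (c * s * S' + (c * s * x0 + (c * s * x1 + (c * s * x2 + (c * s * o1 +
      (c * s * o2 + (c * s * o3 + (c * s * G + 0)))))))) by ring.
by rewrite idt.
Qed.

Local Open Scope ereal_scope.

Lemma vint_sum3 (h : 'I_3 -> V -> V -> R) y : (forall i, phase_continuous (h i)) ->
  (forall i v, v != 0 -> 0 <= h i y v)%R ->
  vint (fun y v => \sum_i h i y v)%R y = \sum_i vint (h i) y.
Proof.
move=> ch h0.
have e1 : lift ord0 ord0 = 1%R :> 'I_3 by exact/val_inj.
have e2 : lift ord0 (lift ord0 ord0) = 2%R :> 'I_3 by exact/val_inj.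
rewrite !big_ord_recl big_ord0 adde0 e1 e2.
rewrite -(vintD (ch 1%R) (ch 2%R) (h0 1%R) (h0 2%R)).
rewrite -(vintD (ch ord0) (phase_continuousD (ch 1%R) (ch 2%R)) (h0 ord0)); last first.
  by move=> v v0; rewrite addr_ge0 // h0.
by apply: eq_vint => v v0; rewrite !big_ord_recl big_ord0 addr0 e1 e2.
Qed.

(** Pointwise, [(rho^2 - t^2) * flux] is the remainder minus the derivatives of the fields [F_i].
    The integrals of these derivatives satisfy [int posR <= int negR], and those of the negative
    parts, being finite, are subtracted from both sides. *)
Lemma flux_balance sigma phi g t rho eps dir (H : V -> R) :
  (0 <= t)%R -> (t < rho)%R -> (0 < eps)%R -> (\sum_l dir 0 l ^+ 2 = 1)%R ->
  Sk 1 (g t) -> (forall k, phase_continuous (ray_term sigma phi g t k)) ->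
  measurable3 (fun v => (H v)%:E) -> (forall v, 0 <= H v)%R ->
  int3 setT (fun v => (H v)%:E) < +oo ->
  (forall v, v != 0 -> `|g t (rho *: dir) v| +
    (1 + enorm v) * (\sum_l `|pdv l (g t) (rho *: dir) v|) <= H v)%R ->
  (rho ^+ 2 - t ^+ 2)%:E * vint (fun y v => negR (flux eps dir (g t) y v)) (rho *: dir)%R <=
  (rho ^+ 2 - t ^+ 2)%:E * vint (fun y v => posR (flux eps dir (g t) y v)) (rho *: dir)%R +
  (2 * rho)%:E * \sum_(k < 9) Iv (ray_weight t k) (ray_term sigma phi g t k) (rho *: dir)%R.
Proof.
move=> t0 tr e0 dir1 Sg cT mH H0 fH gH; set y := (rho *: dir)%R.
have r0 : (0 < rho)%R by apply: le_lt_trans tr.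
set K := (rho ^+ 2 - t ^+ 2)%R.
have K0 : (0 < K)%R by rewrite subr_gt0 ltr_pXn2r // nnegrE ltW.
pose al i := (t * rho * sigma * pdx i (fun x _ => phi t x) y 0)%R.
pose F i := flux_field (al i) t eps dir i (g t).
have SF i : Sk 1 (F i) by exact: Sk_flux_field.
(* One constant for the three fields. It depends on the gradient of [phi] but only serves the
   finiteness and the integration by parts, and is absent from the conclusion. *)
pose c := (1 + \sum_i `|al i| + 2 * t)%R.
have sal i : (`|al i| + 2 * t <= c)%R.
  by rewrite /c lerD2r (bigD1 i) //= addrCA lerDl addr_ge0 // sumr_ge0.
have c0 : (0 < c)%R by rewrite /c -addrA ltr_pwDl // addr_ge0 ?sumr_ge0 // mulr_ge0.
pose P i y v := posR (pdv i (F i) y v); pose N i y v := negR (pdv i (F i) y v).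
have cD i := Sk_cont (Sk_pdv i (SF i)).
have cP i : phase_continuous (P i) := phase_continuous_comp (@continuous_posR R) (cD i).
have cN i : phase_continuous (N i) := phase_continuous_comp (@continuous_negR R) (cD i).
have P0 i v : v != 0%R -> (0 <= P i y v)%R by move=> _; exact: posR_ge0.
have N0 i v : v != 0%R -> (0 <= N i y v)%R by move=> _; exact: negR_ge0.
have bd i v : v != 0%R -> (`|pdv i (F i) y v| <= c * H v)%R.
  by move=> v0; have [] := flux_field_bounds i t0 e0 Sg v0 dir1 (sal i) (gH v v0).
have bf i v : v != 0%R -> (`|F i y v| <= c * (1 + enorm v) * H v)%R.
  by move=> v0; have [] := flux_field_bounds i t0 e0 Sg v0 dir1 (sal i) (gH v v0).
have PN i : vint (P i) y <= vint (N i) y := int3_balanced c0 (SF i) mH H0 fH (bd i) (bf i).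
have Nfin i : vint (N i) y < +oo.
  apply: (vint_lty c0 H0 fH) => v v0; rewrite N0 //=.
  by apply: le_trans (bd i v v0); exact: negR_le.
pose A y v := (K * flux eps dir (g t) y v + \sum_i pdv i (F i) y v)%R.
have cf : phase_continuous (flux eps dir (g t)) by exact: phase_continuous_flux.
have cA : phase_continuous A.
  apply: phase_continuousD; first exact: phase_continuousZ.
  have h : Sk 0 (fun y v => \sum_i pdv i (F i) y v)%R by apply: Sk_sum => i; exact: Sk_pdv.
  exact: Sk_cont h.
have cpos := phase_continuous_comp (@continuous_posR R) cf.
have cneg := phase_continuous_comp (@continuous_negR R) cf.
have pos0 v : v != 0%R -> (0 <= posR (flux eps dir (g t) y v))%R by move=> _; exact: posR_ge0.
have neg0 v : v != 0%R -> (0 <= negR (flux eps dir (g t) y v))%R by move=> _; exact: negR_ge0.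
have sN0 v : v != 0%R -> (0 <= \sum_i N i y v)%R by move=> v0; apply: sumr_ge0 => i _; exact: N0.
have sP0 v : v != 0%R -> (0 <= \sum_i P i y v)%R by move=> v0; apply: sumr_ge0 => i _; exact: P0.
have csum (h : 'I_3 -> V -> V -> R) : (forall i, phase_continuous (h i)) ->
    phase_continuous (fun y v => \sum_i h i y v)%R.
  by move=> ch; apply: (@Sk_cont R 0); apply: Sk_sum => i; split => //; exact: ch.
have K0' : 0 <= K%:E by rewrite lee_fin ltW.
(* Domination by [H] makes this sum finite, which permits its cancellation in [main2]. *)
have fS : \sum_i vint (N i) y \is a fin_num.
  rewrite ge0_fin_numE; last by apply: sume_ge0 => i _; apply: vint_ge0 => v v0; exact: N0.
  by rewrite lte_sum_pinfty // => i _; exact: Nfin.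
have main : vint (fun y v => K * negR (flux eps dir (g t) y v) + \sum_i N i y v)%R y <=
   vint (fun y v => (K * posR (flux eps dir (g t) y v) + `|A y v|) + \sum_i P i y v)%R y.
  apply: le_vint => v v0.
    by rewrite addr_ge0 ?sN0 // mulr_ge0 ?(ltW K0) // neg0.
  have hA : (A y v = K * flux eps dir (g t) y v + (\sum_i P i y v - \sum_i N i y v))%R.
    rewrite /A -sumrB; congr (_ + _)%R; apply: eq_bigr => i _.
    by rewrite /P /N posR_sub_negR.
  have := ler_norm (- A y v)%R; rewrite normrN {1}hA.
  rewrite -{1}(posR_sub_negR (flux eps dir (g t) y v)).
  by rewrite mulrBr; lra.
have cKn : phase_continuous (fun y v => K * negR (flux eps dir (g t) y v))%R.
  exact: phase_continuousZ cneg.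
have cKp : phase_continuous (fun y v => K * posR (flux eps dir (g t) y v))%R.
  exact: phase_continuousZ cpos.
have cNA := phase_continuous_norm cA.
have Kn0 v : v != 0%R -> (0 <= K * negR (flux eps dir (g t) y v))%R.
  by move=> v0; rewrite mulr_ge0 ?(ltW K0) // neg0.
have Kp0 v : v != 0%R -> (0 <= K * posR (flux eps dir (g t) y v))%R.
  by move=> v0; rewrite mulr_ge0 ?(ltW K0) // pos0.
have A0 v : v != 0%R -> (0 <= `|A y v|)%R by [].
rewrite (vintD cKn (csum _ cN) Kn0 sN0) in main.
rewrite (vintD (phase_continuousD cKp cNA) (csum _ cP) _ sP0) in main; last first.
  by move=> v v0; rewrite addr_ge0 // Kp0.
rewrite (vintD cKp cNA Kp0 A0) (vintZ K0 neg0) (vintZ K0 pos0) in main.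
rewrite (vint_sum3 cN N0) (vint_sum3 cP P0) in main.
have main2 : K%:E * vint (fun y v => negR (flux eps dir (g t) y v)) y <=
    K%:E * vint (fun y v => posR (flux eps dir (g t) y v)) y + vint (fun y v => `|A y v|)%R y.
  rewrite -(leeD2rE _ _ fS); apply: (le_trans main); apply: leeD2l.
  by apply: lee_sum => i _; exact: PN.
apply: (le_trans main2); apply: leeD2l.
have -> : vint (fun y v => `|A y v|)%R y = Iv (fun _ _ => 1%R) A y.
  by rewrite Iv_vint; apply: eq_vint => v v0; rewrite mul1r.
have r20 : (0 < 2 * rho)%R by rewrite mulr_gt0.
apply: (@le_trans _ _ (\sum_(k < 9) Iv (fun y v => 2 * rho * ray_weight t k y v)%R (ray_term sigma phi g t k) y)).
  apply: (Iv_sum_bound (w' := fun k y v => (2 * rho * ray_weight t k y v)%R)).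
  - by move=> *; exact: ler01.
  - by move=> k y' v'; rewrite mulr_ge0 ?(ltW r20) // ray_weight_ge0.
  - by move=> k; apply: phase_continuousZ; exact: phase_continuous_ray_weight.
  - exact: cT.
  - move=> v v0; rewrite mul1r.
    exact: (@remainder_bound sigma phi g t rho eps dir v t0 (ltW tr) e0 dir1 Sg v0).
rewrite ge0_sume_distrr; last first.
  by move=> k _; apply: Iv_ge0 => y' v'; exact: ray_weight_ge0.
apply: lee_sum => k _; rewrite le_eqVlt; apply/orP; left; apply/eqP.
have h0 v : v != 0%R -> (0 <= ray_weight t k y v * `|ray_term sigma phi g t k y v|)%R.
  by move=> v0; rewrite mulr_ge0 // ray_weight_ge0.
by rewrite !Iv_vint -(vintZ r20 h0); apply: eq_vint => v v0; rewrite mulrA.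
Qed.

End FluxBalance.

(** * Comparison of radii along a ray *)

Section ExteriorRegion.
Context {R : realType}.
Local Notation leb := (@lebesgue_measure R).
Local Notation V := 'rV[R]_3.
Local Notation E := (R * R * R)%type.
Implicit Types (t sigma rho eps : R) (g : R -> V -> V -> R) (phi : R -> V -> R).
Implicit Types (f w : V -> V -> R) (dir y v : V).
Local Open Scope ereal_scope.

Lemma measurable_ray (h : V -> V -> R) dir : phase_continuous h ->
  measurable_fun [set: R * E]
    (fun q : R * E => off0 (fun v => (h (q.1 *: dir)%R v)%:E) (vec3 q.2)).
Proof.
move=> ch; apply: (measurable33_comp (measurable33_cont ch)) => l; last first.
  exact: (measurableT_comp (@measurable_vec3 R l) measurable_snd).
rewrite (_ : (fun q => _) = fun q : R * E => (q.1 * dir 0 l)%R); last first.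
  by apply/funext => q; rewrite mxE.
by apply: measurable_funM => //; exact: measurable_fst.
Qed.

Lemma measurable_vint_ray (h : V -> V -> R) dir : phase_continuous h ->
  (forall y v, v != 0 -> 0 <= h y v)%R ->
  measurable_fun [set: R] (fun s : R => vint h (s *: dir)%R).
Proof.
move=> ch h0; apply: (@measurable_int3 R _ _ (fun (s : R) => off0 (fun v => (h (s *: dir)%R v)%:E))).
  exact: measurable_ray.
by move=> s v; apply: off0_ge0; exact: h0.
Qed.

Lemma integralD_itv (a b : R) (A B : R -> \bar R) :
  measurable_fun [set: R] A -> measurable_fun [set: R] B ->
  (forall s, 0 <= A s) -> (forall s, 0 <= B s) ->
  \int[leb]_(s in `[a, b]) (A s + B s) =
  \int[leb]_(s in `[a, b]) A s + \int[leb]_(s in `[a, b]) B s.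
Proof.
move=> mA mB A0 B0; have mD : measurable ([set` `[a, b]] : set R) by exact: measurable_itv.
by apply: ge0_integralD => //; exact: measurable_funTS.
Qed.

(** The fundamental theorem of calculus along the ray for each [v], then Tonelli. Any of the four
    integrals may be infinite, hence an additive form without subtraction. *)
Lemma ray_ftc f dir eps (a b : R) : (a < b)%R -> (0 < eps)%R -> Sk 1 f ->
  vint (fun y v => reg eps (f y v)) (a *: dir)%R +
    \int[leb]_(s in `[a, b]) vint (fun y v => posR (flux eps dir f y v)) (s *: dir)%R =
  vint (fun y v => reg eps (f y v)) (b *: dir)%R +
    \int[leb]_(s in `[a, b]) vint (fun y v => negR (flux eps dir f y v)) (s *: dir)%R.
Proof.
move=> ab e0 Sf.
have Su := Sk_reg e0 Sf; have cu := Sk_cont Su.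
have cf : phase_continuous (flux eps dir f) by exact: phase_continuous_flux.
have cpos := phase_continuous_comp (@continuous_posR R) cf.
have cneg := phase_continuous_comp (@continuous_negR R) cf.
have mp := measurable_ray dir cpos; have mn := measurable_ray dir cneg.
have p0 (s : R) v : 0 <= off0 (fun v => (posR (flux eps dir f (s *: dir)%R v))%:E) v.
  by rewrite /off0; case: ifP => // _; rewrite lee_fin posR_ge0.
have n0 (s : R) v : 0 <= off0 (fun v => (negR (flux eps dir f (s *: dir)%R v))%:E) v.
  by rewrite /off0; case: ifP => // _; rewrite lee_fin negR_ge0.
have u0 y v : 0 <= off0 (fun v => (reg eps (f y v))%:E) v.
  by rewrite /off0; case: ifP => // _; rewrite lee_fin reg_ge0.
have mI (G : R -> V -> \bar R) : measurable_fun [set: R * E] (fun q : R * E => G q.1 (vec3 q.2)) ->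
    (forall s v, 0 <= G s v) -> measurable3 (fun v => \int[leb]_(s in `[a, b]) G s v).
  move=> mG G0; apply: (@measurable_int_itv R _ E a b (fun q s => G s (vec3 q))) => //.
  exact: (measurableT_comp mG (measurable_fun_pair measurable_snd measurable_fst)).
have ip0 v : 0 <= \int[leb]_(s in `[a, b]) off0 (fun v => (posR (flux eps dir f (s *: dir)%R v))%:E) v.
  by apply: integral_ge0 => s _; exact: p0.
have in0 v : 0 <= \int[leb]_(s in `[a, b]) off0 (fun v => (negR (flux eps dir f (s *: dir)%R v))%:E) v.
  by apply: integral_ge0 => s _; exact: n0.
have tp := @tonelli_int3_itv R a b (fun s => off0 (fun v => (posR (flux eps dir f (s *: dir)%R v))%:E)) mp p0.
have tn := @tonelli_int3_itv R a b (fun s => off0 (fun v => (negR (flux eps dir f (s *: dir)%R v))%:E)) mn n0.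
rewrite /vint -tp -tn.
rewrite -(int3D (measurable3_slice _ cu) (mI _ mp p0) (u0 _) ip0).
rewrite -(int3D (measurable3_slice _ cu) (mI _ mn n0) (u0 _) in0).
congr int3; apply/funext => v; rewrite /off0; case: eqVneq => v0.
  by rewrite !integral0.
have du (s : R) : is_derive s (1 : R)%R (fun s : R => reg eps (f (s *: dir)%R v)) (flux eps dir f (s *: dir)%R v).
  have dy l : is_derive s (1 : R)%R (fun s : R => (s *: dir)%R 0%R l) (dir 0%R l).
    rewrite (_ : (fun s => _) = fun s : R => (s * dir 0 l)%R); last first.
      by apply/funext => q; rewrite mxE.
    by apply: is_derive_eq; rewrite /GRing.scale /=; ring.
  have dv' l : is_derive s (1 : R)%R (fun s : R => v 0%R l) (0 : R)%R by exact: is_derive_cst.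
  have := phase_curve_is_derive (b := fun _ => v) Su v0 dy dv'.
  rewrite [X in (_ + X)%R]big1 ?addr0; last by move=> l _; rewrite mul0r.
  move=> h; apply: (is_derive_eq h); rewrite /flux mulr_sumr; apply: eq_bigr => l _.
  by have [-> _] := reg_partials l (s *: dir)%R e0 Sf v0; ring.
have cfl : continuous (fun s : R => flux eps dir f (s *: dir)%R v).
  move=> s; have cd : (fun s : R => (s *: dir)%R) r @[r --> s] --> (s *: dir)%R.
    by apply: cvgZl; exact: cvg_id.
  have cv : (fun _ : R => v) r @[r --> s] --> v by exact: cvg_cst.
  exact: (cvg_comp _ _ (pair_cvg cd cv) (cf _ _ v0)).
rewrite (integral_posR_negR ab du cfl) addeCA -EFinD subrKC addeC //.
Qed.

Definition ray_density sigma phi g t y : \bar R :=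
  \sum_(k < 9) Iv (ray_weight t k) (ray_term sigma phi g t k) y.

Lemma ray_density_ge0 sigma phi g t y : 0 <= ray_density sigma phi g t y.
Proof. by apply: sume_ge0 => k _; apply: Iv_ge0; exact: ray_weight_ge0. Qed.

Lemma measurable_ray_density sigma phi g t dir :
  (forall k, phase_continuous (ray_term sigma phi g t k)) ->
  measurable_fun [set: R] (fun s : R => ray_density sigma phi g t (s *: dir)%R).
Proof.
move=> cT; apply: emeasurable_sum => k.
apply: (measurable3_comp (measurable3_Iv (@phase_continuous_ray_weight R t k) (cT k) (@ray_weight_ge0 R t k))) => l.
rewrite (_ : (fun _ => _) = fun s : R => (s * dir 0 l)%R); last first.
  by apply/funext => s; rewrite mxE.
by apply: measurable_funM => //; exact: measurable_id.
Qed.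

(** The terms of index 2, 3, 4 and 8 are the [x]-derivatives of [g] and [g] itself, with the weight
    [1 + |s| >= 1]. *)
Lemma ray_density_bound sigma phi g t y (h : V -> V -> R) :
  (forall k, phase_continuous (ray_term sigma phi g t k)) ->
  (forall v, v != 0 -> 0 <= h y v)%R ->
  (forall v, v != 0 -> h y v <= `|g t y v| + (`|pdx 0 (g t) y v| + `|pdx 1 (g t) y v| +
     `|pdx 2%R (g t) y v|))%R ->
  vint h y <= ray_density sigma phi g t y.
Proof.
move=> cT h0 hb.
have -> : vint h y = Iv (fun _ _ => 1%R) h y.
  by rewrite Iv_vint; apply: eq_vint => v v0; rewrite mul1r ger0_norm // h0.
apply: Iv_sum_bound.
- by move=> *; exact: ler01.
- by move=> k y' v'; exact: ray_weight_ge0.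
- by move=> k; exact: phase_continuous_ray_weight.
- exact: cT.
move=> v v0; rewrite mul1r ger0_norm ?h0 //; apply: (le_trans (hb v v0)).
rewrite !big_ord_recl big_ord0 /ray_weight /ray_term /=.
have aux (c G x0 x1 x2 T' S' o1 o2 o3 : R) : (1 <= c -> 0 <= G -> 0 <= x0 -> 0 <= x1 -> 0 <= x2 ->
    0 <= T' -> 0 <= S' -> 0 <= o1 -> 0 <= o2 -> 0 <= o3 ->
    G + (x0 + x1 + x2) <= T' + (c * S' + (c * x0 + (c * x1 + (c * x2 + (c * o1 +
      (c * o2 + (c * o3 + (c * G + 0))))))))) %R.
  move=> c1 G0 x00 x10 x20 T0 S0 o10 o20 o30.
  have cz z : (0 <= z -> z <= c * z)%R by move=> z0; rewrite ler_peMl.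
  have := cz _ G0; have := cz _ x00; have := cz _ x10; have := cz _ x20.
  by have := cz _ S0; have := cz _ o10; have := cz _ o20; have := cz _ o30; lra.
apply: aux; rewrite ?normr_ge0 //; first by rewrite /s_abs lerDl.
by rewrite mulr_ge0 // speed_ratio_ge0.
Qed.

Lemma flux_le eps f dir y v : (0 < eps)%R -> (\sum_l dir 0 l ^+ 2 = 1)%R ->
  (`|flux eps dir f y v| <= `|pdx 0 f y v| + `|pdx 1 f y v| + `|pdx 2%R f y v|)%R.
Proof.
move=> e0 dir1; rewrite /flux normrM.
apply: le_trans (ler_piMl (normr_ge0 _) (dreg_le1 _ e0)) _.
have e1 : lift 0%R ord0 = 1%R :> 'I_3 by exact/val_inj.
have e2 : lift 0%R ord_max = 2%R :> 'I_3 by exact/val_inj.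
rewrite (sum3E 0%R) e1 e2.
have b2 k (z : R) : (`|dir 0 k * z| <= `|z|)%R.
  by rewrite normrM ler_piMl // -(unit_enorm dir1) coord_le.
apply: le_trans (ler_normD _ _) _; apply: lerD => //.
by apply: le_trans (ler_normD _ _) _; apply: lerD.
Qed.

(* Comparison of the velocity average at radius [r] with the one at radius [a], from the
   flux balance on the segment between them. *)
Lemma ray_step sigma phi g t eps dir (r a d : R) (H : V -> R) :
  (0 <= t)%R -> (0 < d)%R -> (r = t + d)%R -> (r < a)%R -> (a <= r + d)%R -> (0 < eps)%R ->
  (\sum_l dir 0 l ^+ 2 = 1)%R -> Sk 1 (g t) ->
  (forall k, phase_continuous (ray_term sigma phi g t k)) ->
  measurable3 (fun v => (H v)%:E) -> (forall v, 0 <= H v)%R ->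
  int3 setT (fun v => (H v)%:E) < +oo ->
  (forall s v, s \in `[r, (r + d)%R] -> v != 0 -> `|g t (s *: dir) v| +
    (1 + enorm v) * (\sum_l `|pdv l (g t) (s *: dir) v|) <= H v)%R ->
  \int[leb]_(s in `[r, (r + d)%R]) ray_density sigma phi g t (s *: dir)%R < +oo ->
  vint (fun y v => reg eps (g t y v)) (r *: dir)%R <=
  vint (fun y v => reg eps (g t y v)) (a *: dir)%R +
  (2 / d)%:E * \int[leb]_(s in `[r, (r + d)%R]) ray_density sigma phi g t (s *: dir)%R.
Proof.
move=> t0 d0 rE ra ad e0 dir1 Sg cT mH H0 fH gH fB.
set B := fun s : R => ray_density sigma phi g t (s *: dir)%R in fB *.
have B0 s : 0 <= B s by exact: ray_density_ge0.
have cf : phase_continuous (flux eps dir (g t)) by exact: phase_continuous_flux.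
have cpos := phase_continuous_comp (@continuous_posR R) cf.
pose P s := vint (fun y v => posR (flux eps dir (g t) y v)) (s *: dir)%R.
pose N s := vint (fun y v => negR (flux eps dir (g t) y v)) (s *: dir)%R.
have P0 s : 0 <= P s by apply: vint_ge0 => v _; exact: posR_ge0.
have N0 s : 0 <= N s by apply: vint_ge0 => v _; exact: negR_ge0.
have mP : measurable_fun [set: R] P.
  by apply: (measurable_vint_ray dir cpos) => y v _; exact: posR_ge0.
have mB : measurable_fun [set: R] B by exact: measurable_ray_density.
have d2 : (0 <= 2 / d)%R by rewrite divr_ge0 // ltW.
have NP s : s \in `[r, a] -> N s <= P s + (2 / d)%:E * B s.
  rewrite in_itv /= => /andP[rs sa].
  have sI : s \in `[r, (r + d)%R] by rewrite in_itv /= rs (le_trans sa).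
  have ts : (t < s)%R by apply: lt_le_trans rs; rewrite rE ltrDl.
  have s0 : (0 < s)%R by apply: le_lt_trans ts.
  have fb := flux_balance t0 ts e0 dir1 Sg cT mH H0 fH (fun v => gH s v sI).
  have K0 : (0 < s ^+ 2 - t ^+ 2)%R by rewrite subr_gt0 ltr_pXn2r // nnegrE ltW.
  (* [s - t >= d] and [s + t >= s], so dividing the flux balance by [s^2 - t^2] leaves at most
     [2 s / (d s) = 2 / d]. *)
  have ds : (d * s <= s ^+ 2 - t ^+ 2)%R.
    rewrite subr_sqr; apply: ler_pM => //; [exact: ltW|exact: ltW| |by rewrite lerDl].
    by rewrite lerBrDr addrC -rE.
  rewrite -(@lee_pmul2l _ (s ^+ 2 - t ^+ 2)%:E) ?lte_fin //.
  have q0 : 0 <= (2 / d)%:E * B s by rewrite mule_ge0 // lee_fin.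
  apply: (le_trans fb); rewrite (ge0_muleDr _ (P0 s) q0).
  apply: leeD2l; rewrite muleA -EFinM; apply: lee_wpmul2r; first exact: B0.
  by rewrite lee_fin mulrA ler_pdivlMr //; move: ds; lra.
have ra' : `[r, a]%classic `<=` `[r, (r + d)%R]%classic.
  by apply: subset_itvl; rewrite bnd_simp.
have sub (G : R -> \bar R) : (forall s, 0 <= G s) -> \int[leb]_(s in `[r, a]) G s <= \int[leb]_(s in `[r, (r + d)%R]) G s.
  move=> G0; rewrite integral_mkcond [leRHS]integral_mkcond.
  apply: ge0_le_integral_nomeas => s _; rewrite /patch; first by case: ifP.
  case: ifPn => [/set_mem/ra' h|_]; first by rewrite mem_set.
  by case: ifP.
have PB s : P s <= B s.
  apply: ray_density_bound => // v v0; first exact: posR_ge0.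
  apply: le_trans (posR_le _) _; apply: le_trans (flux_le _ _ _ e0 dir1) _.
  by rewrite lerDr.
have IP0 : 0 <= \int[leb]_(s in `[r, a]) P s by apply: integral_ge0 => s _; exact: P0.
(* The positive flux is dominated by the density, hence finite: it is added to both sides and
   cancelled. *)
have fP : \int[leb]_(s in `[r, a]) P s \is a fin_num.
  rewrite ge0_fin_numE //; apply: le_lt_trans fB; apply: le_trans (sub _ B0).
  by apply: ge0_le_integral_nomeas => s _; [exact: P0|exact: PB].
have E1 : vint (fun y v => reg eps (g t y v)) (r *: dir)%R + \int[leb]_(s in `[r, a]) P s =
    vint (fun y v => reg eps (g t y v)) (a *: dir)%R + \int[leb]_(s in `[r, a]) N s.
  exact: ray_ftc.
rewrite -(leeD2rE _ _ fP) E1.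
move: (vint _ (a *: dir)%R) => ua; rewrite -(addeA ua); apply: leeD2l.
apply: (@le_trans _ _ (\int[leb]_(s in `[r, a]) (P s + (2 / d)%:E * B s))).
  by apply: ge0_le_integral_nomeas => s /= sI; [exact: N0|exact: NP].
rewrite addeC.
have q0 s : 0 <= (2 / d)%:E * B s by rewrite mule_ge0 // lee_fin.
have mqB : measurable_fun [set: R] (fun s => (2 / d)%:E * B s).
  by apply: emeasurable_funM => //; exact: measurable_cst.
have -> : \int[leb]_(s in `[r, a]) (P s + (2 / d)%:E * B s) =
    \int[leb]_(s in `[r, a]) P s + \int[leb]_(s in `[r, a]) ((2 / d)%:E * B s).
  exact: (integralD_itv r a mP mqB P0 q0).
have d2' : (0 < 2 / d)%R by rewrite divr_gt0.
have -> : \int[leb]_(s in `[r, a]) ((2 / d)%:E * B s) = (2 / d)%:E * \int[leb]_(s in `[r, a]) B s.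
  by apply: ge0_integralZl_nomeas; [exact: d2'|move=> s _; exact: B0].
apply: leeD2l.
by apply: lee_wpmul2l; [rewrite lee_fin|exact: sub].
Qed.

(** [ray_step] is averaged over [a] in an interval of length [d]: the values at [a] contribute one
    integral of the density, and [d * (2 / d)] two more. *)
Lemma ray_average sigma phi g t eps dir (r d : R) (H : V -> R) :
  (0 <= t)%R -> (0 < d)%R -> (r = t + d)%R -> (0 < eps)%R ->
  (\sum_l dir 0 l ^+ 2 = 1)%R -> Sk 1 (g t) ->
  (forall k, phase_continuous (ray_term sigma phi g t k)) ->
  measurable3 (fun v => (H v)%:E) -> (forall v, 0 <= H v)%R ->
  int3 setT (fun v => (H v)%:E) < +oo ->
  (forall s v, s \in `[r, (r + d)%R] -> v != 0 -> `|g t (s *: dir) v| +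
    (1 + enorm v) * (\sum_l `|pdv l (g t) (s *: dir) v|) <= H v)%R ->
  d%:E * vint (fun y v => reg eps (g t y v)) (r *: dir)%R <=
  3%:E * \int[leb]_(s in `[r, (r + d)%R]) ray_density sigma phi g t (s *: dir)%R.
Proof.
move=> t0 d0 rE e0 dir1 Sg cT mH H0 fH gH.
set B := fun s : R => ray_density sigma phi g t (s *: dir)%R.
have B0 s : 0 <= B s by exact: ray_density_ge0.
have J0 : 0 <= \int[leb]_(s in `[r, (r + d)%R]) B s by apply: integral_ge0 => s _; exact: B0.
(* With an infinite integral of the density the bound is trivial; the cancellation in [ray_step]
   requires the finite case. *)
have [fB|nB] := ltP (\int[leb]_(s in `[r, (r + d)%R]) B s) +oo; last first.
  by move: nB; rewrite leye_eq => /eqP ->; rewrite gt0_muley ?lte_fin // leey.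
set J := \int[leb]_(s in _) _ in fB J0 *.
have mB : measurable_fun [set: R] B by exact: measurable_ray_density.
set U := vint _ _.
have step a : a \in `[r, (r + d)%R] -> U <= B a + (2 / d)%:E * J.
  rewrite in_itv /= => /andP[ra ad].
  have q0 : 0 <= (2 / d)%:E * J by rewrite mule_ge0 // lee_fin divr_ge0 // ltW.
  have UB : vint (fun y v => reg eps (g t y v)) (a *: dir)%R <= B a.
    apply: ray_density_bound => // v v0; first exact: reg_ge0.
    by apply: le_trans (reg_le _ e0) _; rewrite lerDl !addr_ge0.
  (* [ray_step] compares distinct radii; at [a = r] the density at [r] itself bounds the average. *)
  move: ra; rewrite le_eqVlt => /orP[/eqP e|ra]; last first.
    apply: le_trans (ray_step t0 d0 rE ra ad e0 dir1 Sg cT mH H0 fH gH fB) _.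
    exact: leeD2r.
  by move: UB; rewrite -e => UB; apply: (le_trans UB); rewrite leeDl.
have rd : (r < r + d)%R by rewrite ltrDl.
have -> : d%:E * U = \int[leb]_(s in `[r, (r + d)%R]) U.
  by rewrite integral_cst_itv // addrAC subrr add0r.
have q0 (s : R) : 0 <= (fun _ : R => (2 / d)%:E * J) s by rewrite mule_ge0 // lee_fin divr_ge0 // ltW.
apply: (@le_trans _ _ (\int[leb]_(s in `[r, (r + d)%R]) (B s + (2 / d)%:E * J))).
  apply: ge0_le_integral_nomeas => s /=; last exact: step.
  by move=> _; apply: vint_ge0 => v _; exact: reg_ge0.
have -> : \int[leb]_(s in `[r, (r + d)%R]) (B s + (2 / d)%:E * J) = J + \int[leb]_(s in `[r, (r + d)%R]) ((2 / d)%:E * J).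
  exact: (integralD_itv r (r + d) mB (measurable_cst ((2 / d)%:E * J)) B0 q0).
rewrite integral_cst_itv // (_ : (r + d - r = d)%R); last by ring.
rewrite muleA -EFinM mulrCA divff ?gt_eqF // mulr1.
rewrite le_eqVlt; apply/orP; left; apply/eqP.
have -> : (3%:E : \bar R) = 1 + 2%:E by rewrite -EFinD; congr EFin; ring.
by rewrite ge0_muleDl // mul1e.
Qed.

(** The bound of [ray_average] does not depend on [eps], so it passes to the limit by Fatou's lemma
    along [eps = 1 / (n + 1)]. *)
Lemma velocity_average_bound sigma phi g t dir (r d : R) (H : V -> R) :
  (0 <= t)%R -> (0 < d)%R -> (r = t + d)%R ->
  (\sum_l dir 0 l ^+ 2 = 1)%R -> Sk 1 (g t) ->
  (forall k, phase_continuous (ray_term sigma phi g t k)) ->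
  measurable3 (fun v => (H v)%:E) -> (forall v, 0 <= H v)%R ->
  int3 setT (fun v => (H v)%:E) < +oo ->
  (forall s v, s \in `[r, (r + d)%R] -> v != 0 -> `|g t (s *: dir) v| +
    (1 + enorm v) * (\sum_l `|pdv l (g t) (s *: dir) v|) <= H v)%R ->
  d%:E * int_v (fun v => `|g t (r *: dir)%R v|%:E) <=
  3%:E * \int[leb]_(s in `[r, (r + d)%R]) ray_density sigma phi g t (s *: dir)%R.
Proof.
move=> t0 d0 rE dir1 Sg cT mH H0 fH gH.
set B := _ * \int[leb]_(s in _) _.
pose eps n : R := (n.+1%:R^-1)%R; have e0 n : (0 < eps n)%R by rewrite invr_gt0 ltr0n.
rewrite -lee_pdivlMl // int_v_off0 /int3 preimage_setT.
pose u n (q : E) := off0 (fun v => (reg (eps n) (g t (r *: dir)%R v))%:E) (vec3 q).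
apply: (@fatou_bound _ _ _ (@lebesgue3 R) u).
- by move=> n; exact: (measurable3_slice (r *: dir)%R (Sk_cont (Sk_reg (e0 n) Sg))).
- by move=> n q; rewrite /u /off0; case: ifP => // _; rewrite lee_fin reg_ge0.
- move=> q; rewrite /u /off0; case: ifP => _; first exact: cvg_cst.
  apply: cvg_EFin; first by apply: nearW.
  set a := g t _ _.
  apply: (@squeeze_cvgr _ _ _ _ (fun n => `|a| - eps n)%R (fun _ => `|a|%R)).
  + by apply: nearW => n /=; rewrite reg_ge //= reg_le.
  + rewrite -[X in _ --> X]subr0; apply: cvgB; first exact: cvg_cst.
    exact: cvg_harmonic.
  + exact: cvg_cst.
- move=> n; rewrite lee_pdivlMl //.
  have := ray_average t0 d0 rE (e0 n) dir1 Sg cT mH H0 fH gH.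
  by rewrite {1}/vint /int3 preimage_setT.
Qed.

End ExteriorRegion.

(** * Spherical bounds for the terms of the ray density *)

Section ExteriorDecay.
Context {R : realType}.
Local Notation leb := (@lebesgue_measure R).
Local Notation V := 'rV[R]_3.
Implicit Types (i j : 'I_3) (w : V -> V -> R) (f : R -> V -> V -> R) (T : \bar R) (t sigma : R) (g : R -> V -> V -> R) (phi : R -> V -> R) (dir : V).
Local Open Scope ereal_scope.

Definition energy sigma phi g t : \bar R :=
  word_sum 3 rotations (@speed_ratio R) (Tphi sigma phi g) t + word_sum 4 V_hat (s_abs t) g t.

Lemma word_sum_ge0 n F (w : V -> V -> R) g t : (forall y v, 0 <= w y v)%R ->
  0 <= word_sum n F w g t.
Proof. by move=> w0; apply: sume_ge0 => k _; apply: sume_ge0 => W _; exact: Jint_ge0. Qed.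

Lemma energy_ge0 sigma phi g t : 0 <= energy sigma phi g t.
Proof.
by apply: adde_ge0; apply: word_sum_ge0; [exact: speed_ratio_ge0|exact: s_abs_ge0].
Qed.

Lemma Sk_ray_term T sigma phi g t k : (0 <= t)%R -> t%:E < T -> Ck T 3 g ->
  Ck T 3 (fun t x _ => phi t x) -> Sk 2 (ray_term sigma phi g t k).
Proof.
move=> t0 tT Cg Cp; have Sg := Ck_slice t0 tT Cg.
case: k => [[|[|[|[|[|[|[|[|[|//]]]]]]]]] p]; rewrite /ray_term /=.
- exact: Sk_Tphi tT Cg Cp.
- exact: Sk_S_field tT Cg.
- exact: (Sk_pdx 0%R Sg).
- exact: (Sk_pdx 1%R Sg).
- exact: (Sk_pdx 2%R Sg).
- exact: (Sk_om 0%R 1%R Sg).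
- exact: (Sk_om 0%R 2%R Sg).
- exact: (Sk_om 1%R 2%R Sg).
- exact: (SkS Sg).
Qed.

Lemma rotations_words w f t i j (i' j' : 'I_3) : (forall y v, 0 <= w y v)%R -> (i < j)%N -> (i' < j')%N ->
  Jint w (om i j (f t)) <= word_sum 3 rotations w f t /\
  Jint w (om i j (om i' j' (f t))) <= word_sum 3 rotations w f t.
Proof.
move=> w0 ij ij'; have A := @In_Omega R i j ij; have B := @In_Omega R i' j' ij'.
have I0 : List.In (@id (R -> V -> V -> R)) (compositions rotations 0) by left.
split.
  have := @word_sum_ge R 3 rotations w f t 1 (Omega_hat i j \o id) w0 isT.
  by move=> /(_ (In_compositions A I0)); rewrite /= Omega_slice.
have := @word_sum_ge R 3 rotations w f t 2 (Omega_hat i j \o (Omega_hat i' j' \o id)) w0 isT.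
move=> /(_ (In_compositions A (In_compositions B I0))).
by rewrite /= !Omega_slice.
Qed.

Lemma V_hat_words w f t A i j (i' j' : 'I_3) : (forall y v, 0 <= w y v)%R -> List.In A V_hat ->
  (i < j)%N -> (i' < j')%N ->
  [/\ Jint w (A f t) <= word_sum 4 V_hat w f t, Jint w (om i j (A f t)) <= word_sum 4 V_hat w f t &
  Jint w (om i j (om i' j' (A f t))) <= word_sum 4 V_hat w f t].
Proof.
move=> w0 VA ij ij'; have B := In_rotations (@In_Omega R i j ij).
have C := In_rotations (@In_Omega R i' j' ij'); split.
- exact: words1.
- by have := @words2 R w f t _ _ w0 VA B; rewrite Omega_slice.
- by have := @words3 R w f t _ _ _ w0 VA C B; rewrite !Omega_slice.
Qed.

(** Except for the transport term, each entry is [g] or one field applied to [g], so two more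
    rotations stay within words of length 3. The transport term receives the two rotations only. *)
Lemma ray_term_sphere T sigma phi g t dir (al be : R) k : (0 <= t)%R -> t%:E < T -> Ck T 3 g ->
  Ck T 3 (fun t x _ => phi t x) -> (0 < al)%R -> (\sum_l dir 0 l ^+ 2 = 1)%R ->
  \int[leb]_(rho in `[al, be]) ((rho ^+ 2)%:E *
     Iv (ray_weight t k) (ray_term sigma phi g t k) (rho *: dir)%R)
  <= sphere_cst%:E * energy sigma phi g t.
Proof.
move=> t0 tT Cg Cp al0 dir1.
have S2 := Sk_ray_term sigma k t0 tT Cg Cp.
have w0 := @ray_weight_ge0 R t k.
have cw := @phase_continuous_ray_weight R t k; have iw := @rot_invariant_ray_weight R t k.
have o01 : ((0%R : 'I_3) < (1%R : 'I_3))%N by [].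
pose MT := word_sum 3 rotations (@speed_ratio R) (Tphi sigma phi g) t.
pose MZ := word_sum 4 V_hat (s_abs t) g t.
have MT0 : 0 <= MT by apply: word_sum_ge0; exact: speed_ratio_ge0.
have MZ0 : 0 <= MZ by apply: word_sum_ge0; exact: s_abs_ge0.
have MTE : MT <= energy sigma phi g t by rewrite /energy leeDl.
have MZE : MZ <= energy sigma phi g t by rewrite /energy leeDr.
have Z A : List.In A V_hat -> ray_weight t k = s_abs t -> ray_term sigma phi g t k = A g t ->
    [/\ Jint (ray_weight t k) (ray_term sigma phi g t k) <= energy sigma phi g t,
     forall i j, (i < j)%N -> Jint (ray_weight t k) (om i j (ray_term sigma phi g t k)) <= energy sigma phi g t &
     forall i j (i' j' : 'I_3), (i < j)%N -> (i' < j')%N ->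
       Jint (ray_weight t k) (om i j (om i' j' (ray_term sigma phi g t k))) <= energy sigma phi g t].
  move=> VA -> ->; split.
  - have [h _ _] := @V_hat_words _ g t A _ _ _ _ (@s_abs_ge0 R t) VA o01 o01.
    exact: (le_trans h MZE).
  - move=> i j ij; have [_ h _] := @V_hat_words _ g t A _ _ _ _ (@s_abs_ge0 R t) VA ij ij.
    exact: (le_trans h MZE).
  - move=> i j i' j' ij ij'; have [_ _ h] := @V_hat_words _ g t A _ _ _ _ (@s_abs_ge0 R t) VA ij ij'.
    exact: (le_trans h MZE).
have VS : List.In S_field (@V_hat R) by do 4 right; left.
suff [M0 M1 M2] : [/\ Jint (ray_weight t k) (ray_term sigma phi g t k) <= energy sigma phi g t,
     forall i j, (i < j)%N -> Jint (ray_weight t k) (om i j (ray_term sigma phi g t k)) <= energy sigma phi g t &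
     forall i j (i' j' : 'I_3), (i < j)%N -> (i' < j')%N ->
       Jint (ray_weight t k) (om i j (om i' j' (ray_term sigma phi g t k))) <= energy sigma phi g t].
  exact: (sphere_sobolev be w0 cw iw S2 al0 dir1 M0 M1 M2).
case: k S2 w0 cw iw Z => [[|[|[|[|[|[|[|[|[|//]]]]]]]]] p] _ _ _ _ Z.
- split; rewrite /ray_weight /ray_term /=.
  + exact: (le_trans (@words0 _ 3 rotations (@speed_ratio R) (Tphi sigma phi g) t (@speed_ratio_ge0 R) isT) MTE).
  + move=> i j ij.
    have [h _] := @rotations_words _ (Tphi sigma phi g) t _ _ _ _ (@speed_ratio_ge0 R) ij ij.
    exact: (le_trans h MTE).
  + move=> i j i' j' ij ij'.
    have [_ h] := @rotations_words _ (Tphi sigma phi g) t _ _ _ _ (@speed_ratio_ge0 R) ij ij'.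
    exact: (le_trans h MTE).
- exact: (Z S_field VS).
- exact: (Z (dx 0%R) (In_dx 0%R)).
- exact: (Z (dx 1%R) (In_dx 1%R)).
- exact: (Z (dx 2%R) (In_dx 2%R)).
- exact: (Z _ (In_rotations (@In_Omega R 0%R 1%R isT))).
- exact: (Z _ (In_rotations (@In_Omega R 0%R 2%R isT))).
- exact: (Z _ (In_rotations (@In_Omega R 1%R 2%R isT))).
- have B := word_sum_bounded_words g t (@s_abs_ge0 R t); move: (bounded_wordsS B) => [B0 [_ B1]].
  split; rewrite /ray_weight /ray_term /=.
  + exact: (le_trans B0 MZE).
  + move=> i j ij; have [h _] := B1 i j ij; exact: (le_trans h MZE).
  + move=> i j i' j' ij ij'; have [_ [_ B2]] := B1 i' j' ij'; have [h _] := B2 i j ij.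
    exact: (le_trans h MZE).
Qed.

End ExteriorDecay.

(** * The two regions of the first estimate, and the conclusion *)

Section MainBounds.
Context {R : realType}.
Local Notation leb := (@lebesgue_measure R).
Local Notation V := 'rV[R]_3.
Implicit Types (T : \bar R) (t sigma : R) (g : R -> V -> V -> R) (phi : R -> V -> R) (x dir : V).
Local Open Scope ereal_scope.

Lemma sume_cst_le (n : nat) (F : 'I_n -> \bar R) (c : \bar R) :
  (forall k, F k <= c) -> \sum_(k < n) F k <= n%:R%:E * c.
Proof.
elim: n F => [F _|n IH F Fc]; first by rewrite big_ord0 mul0e.
rewrite big_ord_recl -natr1 EFinD ge0_muleDl ?lee_fin ?ler01 ?ler0n // mul1e addeC.
by apply: leeD => //; exact: IH.
Qed.

Lemma tau_minus_gt0 t x : (0 < tau_minus t x)%R.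
Proof. by rewrite /tau_minus sqrtr_gt0; apply: ltr_pwDl => //; exact: sqr_ge0. Qed.

(** [216 = 8 * 3 * 9]: 8 from [(1 + r)^2 tau_- <= (2 r)^2 (2 d)], 3 from [ray_average], and 9 terms
    in the density. That [d > 1] is what bounds [tau_-] by [2 d]. *)
Lemma exterior_decay T sigma phi g t x : (0 <= t)%R -> t%:E < T -> Ck T 3 g ->
  Ck T 3 (fun t x _ => phi t x) -> v_dominated T g -> (t + 1 < enorm x)%R ->
  int_v (fun v => `|g t x v|%:E) <=
  (216 * sphere_cst / ((1 + enorm x) ^+ 2 * tau_minus t x))%:E * energy sigma phi g t.
Proof.
move=> t0 tT Cg Cp vd tx.
set r := enorm x; pose d := (r - t)%R; pose dir := (r^-1 *: x)%R.
have d1 : (1 < d)%R by rewrite /d ltrBrDr addrC.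
have d0 : (0 < d)%R by exact: lt_trans d1.
have rE : (r = t + d)%R by rewrite /d addrC subrK.
have r1 : (1 < r)%R by apply: le_lt_trans tx; rewrite lerDr.
have r0 : (0 < r)%R by exact: lt_trans r1.
have xE : (r *: dir)%R = x by rewrite /dir scalerA divff ?gt_eqF // scale1r.
have nd : enorm dir = 1%R by rewrite /dir enormZ gtr0_norm ?invr_gt0 // mulVf // gt_eqF.
have dir1 : (\sum_l dir 0 l ^+ 2 = 1)%R by rewrite -enorm_sqr nd expr1n.
have Sg := Ck_slice t0 tT Cg.
have S2 k := Sk_ray_term sigma k t0 tT Cg Cp.
have cT k : phase_continuous (ray_term sigma phi g t k) by exact: Sk_cont (S2 k).
(* The ball of radius [r + d = 2 r - t] contains the whole comparison segment, so a single
   dominating function serves all its points. *)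
have [h [ih hb]] := vd t (r + d)%R t0 tT.
pose H (v : V) : R := `|h v|%R.
have H0 v : (0 <= H v)%R by exact: normr_ge0.
have mH : measurable3 (fun v => (H v)%:E).
  exact: (measurable_int _ (integrable_abse ih)).
have fH : int3 setT (fun v => (H v)%:E) < +oo.
  by have /integrableP[_] := ih; rewrite /int3 preimage_setT.
have gH s v : s \in `[r, (r + d)%R] -> v != 0%R -> (`|g t (s *: dir) v| +
    (1 + enorm v) * (\sum_l `|pdv l (g t) (s *: dir) v|) <= H v)%R.
  rewrite in_itv /= => /andP[rs sd] v0.
  have s0 : (0 <= s)%R by apply: le_trans rs; exact: ltW.
  have sr : (enorm (s *: dir) <= r + d)%R by rewrite enormZ nd mulr1 ger0_norm.
  exact: le_trans (hb _ _ sr v0) (ler_norm _).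
have vb := velocity_average_bound t0 d0 rE dir1 (SkS (SkS Sg)) cT mH H0 fH gH.
rewrite xE in vb.
set I := int_v _ in vb *; set En := energy _ _ _ _.
have En0 : 0 <= En by exact: energy_ge0.
have mD : measurable_fun [set: R] (fun s : R => ray_density sigma phi g t (s *: dir)%R).
  exact: measurable_ray_density.
have D0 s : 0 <= ray_density sigma phi g t (s *: dir)%R by exact: ray_density_ge0.
have sq0 (s : R) : 0 <= (s ^+ 2)%:E by rewrite lee_fin sqr_ge0.
have r20 : (0 < r ^+ 2)%R by rewrite exprn_gt0.
have step1 : (r ^+ 2)%:E * \int[leb]_(s in `[r, (r + d)%R]) ray_density sigma phi g t (s *: dir)%R
   <= \int[leb]_(s in `[r, (r + d)%R]) ((s ^+ 2)%:E * ray_density sigma phi g t (s *: dir)%R).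
  have -> : (r ^+ 2)%:E * \int[leb]_(s in `[r, (r + d)%R]) ray_density sigma phi g t (s *: dir)%R =
     \int[leb]_(s in `[r, (r + d)%R]) ((r ^+ 2)%:E * ray_density sigma phi g t (s *: dir)%R).
    by apply/esym; apply: ge0_integralZl_nomeas; [exact: r20|move=> s _; exact: D0].
  apply: ge0_le_integral_nomeas => s /=; first by move=> _; apply: mule_ge0 => //; exact: D0.
  rewrite in_itv /= => /andP[rs _]; apply: lee_wpmul2r; first exact: D0.
  by rewrite lee_fin ler_pXn2r // nnegrE ltW // (lt_le_trans r0).
have step2 : \int[leb]_(s in `[r, (r + d)%R]) ((s ^+ 2)%:E * ray_density sigma phi g t (s *: dir)%R)
   <= 9%:R%:E * (sphere_cst%:E * En).
  pose F (k : 'I_9) (s : R) := (s ^+ 2)%:E * Iv (ray_weight t k) (ray_term sigma phi g t k) (s *: dir)%R.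
  have F0 k s : 0 <= F k s.
    by apply: mule_ge0; [exact: sq0|apply: Iv_ge0; exact: ray_weight_ge0].
  have mF k : measurable_fun [set: R] (F k).
    exact: (measurable_radial dir (@phase_continuous_ray_weight R t k) (cT k) (@ray_weight_ge0 R t k)).
  have -> : \int[leb]_(s in `[r, (r + d)%R]) ((s ^+ 2)%:E * ray_density sigma phi g t (s *: dir)%R) =
    \int[leb]_(s in `[r, (r + d)%R]) (\sum_(k < 9) F k s).
    apply: eq_integral => s _; rewrite /ray_density ge0_sume_distrr // => k _.
    by apply: Iv_ge0; exact: ray_weight_ge0.
  have mI : measurable ([set` `[r, (r + d)%R]] : set R) by exact: measurable_itv.
  have -> : \int[leb]_(s in `[r, (r + d)%R]) (\sum_(k < 9) F k s) =
     \sum_(k < 9) \int[leb]_(s in `[r, (r + d)%R]) F k s.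
    apply: ge0_integral_sum; [exact: mI|by move=> k; exact: measurable_funTS (mF k)|by move=> k s _; exact: F0].
  by apply: sume_cst_le => k; exact: (@ray_term_sphere R T sigma phi g t dir r (r + d)%R k t0 tT Cg Cp r0 dir1).
have I0 : 0 <= I by apply: integral_ge0 => q _; rewrite lee_fin.
have J0 : 0 <= \int[leb]_(s in `[r, (r + d)%R]) ray_density sigma phi g t (s *: dir)%R.
  by apply: integral_ge0 => s _; exact: D0.
move: vb step1 step2; move: (\int[leb]_(s in _) ray_density _ _ _ _ _) J0 => J J0.
move: (\int[leb]_(s in _) _) => K vb s1 s2.
have main : (r ^+ 2 * d)%:E * I <= 3%:E * (9%:R%:E * (sphere_cst%:E * En)).
  rewrite EFinM -muleA; apply: (@le_trans _ _ ((r ^+ 2)%:E * (3%:E * J))).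
    by apply: lee_wpmul2l => //; rewrite lee_fin ltW.
  rewrite muleCA; apply: lee_wpmul2l; first by rewrite lee_fin ler0n.
  exact: le_trans s1 s2.
have S0 := @sphere_cst_gt0 R; move: (@sphere_cst R) S0 main => S S0 main.
have tau0 := tau_minus_gt0 t x.
have taud : (tau_minus t x <= 2 * d)%R.
  apply: sqr_le_of_sqr; first by rewrite mulr_ge0 // ltW.
  have p1 : (0 <= 1 + (t - enorm x) ^+ 2)%R by rewrite addr_ge0 ?sqr_ge0.
  rewrite sqr_sqrtr // -/r (_ : (t - r = - d)%R) ?sqrrN; last by rewrite rE; ring.
  by have := mulr_ge0 (ltW d0) (ltW d0); nra.
have Q0 : (0 < (1 + r) ^+ 2 * tau_minus t x)%R.
  by rewrite mulr_gt0 // exprn_gt0 // addr_gt0.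
have QQ : ((1 + r) ^+ 2 * tau_minus t x <= 8 * (r ^+ 2 * d))%R.
  apply: (@le_trans _ _ ((2 * r) ^+ 2 * (2 * d))%R); last by rewrite le_eqVlt; apply/orP; left; apply/eqP; ring.
  apply: ler_pM => //; [exact: sqr_ge0|exact: ltW|].
  by rewrite ler_pXn2r ?nnegrE ?addr_ge0 ?mulr_ge0 ?ltW //; lra.
rewrite -(@lee_pmul2l _ ((1 + r) ^+ 2 * tau_minus t x)%:E) ?lte_fin //.
apply: (@le_trans _ _ ((8 * (r ^+ 2 * d))%:E * I)).
  by apply: lee_wpmul2r => //; rewrite lee_fin.
rewrite [leRHS]muleA -EFinM.
have -> : ((1 + r) ^+ 2 * tau_minus t x * (216 * S / ((1 + r) ^+ 2 * tau_minus t x)) = 216 * S)%R.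
  by rewrite [LHS]mulrC divfK // (gt_eqF Q0).
apply: (@le_trans _ _ (8%:E * (3%:E * (9%:R%:E * (S%:E * En))))).
  by rewrite EFinM -muleA; apply: lee_wpmul2l => //; rewrite lee_fin ler0n.
rewrite !muleA -!EFinM le_eqVlt; apply/orP; left; apply/eqP; congr (_%:E * _).
by ring.
Qed.

Lemma decay_weight_gt0 t x (q : R) : (0 < (1 + enorm x) ^+ 2 * tau_minus t x `^ q)%R.
Proof.
apply: mulr_gt0; last exact: powR_gt0 (tau_minus_gt0 t x).
by rewrite exprn_gt0 // ltr_pwDl // enorm_ge0.
Qed.

Lemma le_cst_mul (a b q : R) (M : \bar R) : (a <= b)%R -> (0 < q)%R -> 0 <= M ->
  (a / q)%:E * M <= (b / q)%:E * M.
Proof. by move=> ab q0 M0; apply: lee_wpmul2r => //; rewrite lee_fin ler_pM2r ?invr_gt0. Qed.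

Definition decay_cst : R := (2 * sobolev_cst 2 + 216 * sphere_cst)%R.

Lemma sobolev_cst2_gt0 : (0 < 2 * @sobolev_cst R 2)%R.
Proof. by apply: mulr_gt0; [rewrite ltr0n|apply: sobolev_cst_gt0; rewrite ler1n]. Qed.

Lemma sphere_cst216_gt0 : (0 < 216 * @sphere_cst R)%R.
Proof. by apply: mulr_gt0; [rewrite ltr0n|exact: sphere_cst_gt0]. Qed.

Lemma decay_cst_gt0 : (0 < decay_cst)%R.
Proof. exact: addr_gt0 sobolev_cst2_gt0 sphere_cst216_gt0. Qed.

Lemma decay_s_weight T sigma phi g t x : (0 <= t)%R -> t%:E < T ->
  sufficiently_regular T g phi ->
  int_v (fun v => `|g t x v|%:E) <=
  (decay_cst / ((1 + enorm x) ^+ 2 * tau_minus t x))%:E * energy sigma phi g t.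
Proof.
move=> t0 tT [Cg Cp vd].
have Q0 := decay_weight_gt0 t x 1; rewrite powRr1 ?(ltW (tau_minus_gt0 t x)) // in Q0.
have E0 := energy_ge0 sigma phi g t.
have l1 : (2 * sobolev_cst 2 <= decay_cst)%R by rewrite lerDl; exact: ltW sphere_cst216_gt0.
have l2 : (216 * sphere_cst <= decay_cst)%R by rewrite lerDr; exact: ltW sobolev_cst2_gt0.
have [xt|tx] := leP (enorm x) (t + 1)%R.
  apply: le_trans (interior_decay t0 (Ck_slice t0 tT Cg) xt) _.
  apply: le_trans (le_cst_mul l1 Q0 E0).
  apply: lee_wpmul2l.
    by rewrite lee_fin; apply: divr_ge0; [exact: ltW sobolev_cst2_gt0|exact: ltW].
  by rewrite /energy leeDr // word_sum_ge0 //; exact: speed_ratio_ge0.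
exact: le_trans (exterior_decay sigma t0 tT Cg Cp vd tx) (le_cst_mul l2 Q0 E0).
Qed.

End MainBounds.

Theorem proposition2p11 (R : realType) (p : R) (hp : 0 <= p) :
  exists C : R, 0 < C /\
  forall (sigma : R) (T : \bar R) (g : R -> 'rV[R]_3 -> 'rV[R]_3 -> R)
         (phi : R -> 'rV[R]_3 -> R),
  (sigma = -1 \/ sigma = 1) ->
  sufficiently_regular T g phi ->
  forall (t : R) (x : 'rV[R]_3), 0 <= t -> (t%:E < T)%E ->
  (int_v (fun v => `|g t x v|%:E)
     <= (C / ((1 + enorm x) ^+ 2 * tau_minus t x))%:E *
        (\sum_(k < 3) \sum_(W <- compositions rotations k)
           int_x (fun y => int_v (fun v =>
             (enorm y * `|W (Tphi sigma phi g) t y v| / enorm v)%:E))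
         + \sum_(k < 4) \sum_(Z <- compositions V_hat k)
           int_x (fun y => int_v (fun v =>
             ((1 + `|s_weight t y v|) * `|Z g t y v|)%:E))))%E
  /\
  (int_v (fun v => `|g t x v|%:E)
     <= (C / ((1 + enorm x) ^+ 2 * tau_minus t x `^ (1 + p)))%:E *
        (\sum_(k < 3) \sum_(W <- compositions rotations k)
           int_x (fun y => int_v (fun v =>
             (enorm y * `|z_weight t y v `^ p * W (Tphi sigma phi g) t y v|
              / enorm v)%:E))
         + \sum_(k < 4) \sum_(Z <- compositions V_hat k)
           int_x (fun y => int_v (fun v =>
             `|z_weight t y v `^ (p + 1) * Z g t y v|%:E))))%E.
Proof.
have c0 := @decay_cst_gt0 R.
have q0 : 0 <= p + 1 by rewrite addr_ge0.
have K1 : 1 <= 2 `^ (p + 1) :> R by rewrite -[leLHS](powRr0 2) ler_powR // ler1n.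
have c1 : 0 < @sobolev_cst R (2 `^ (p + 1)) by exact: sobolev_cst_gt0.
(* The sum serves both estimates; [2] to the power [p + 1] is the constant of slow variation of
   [z^(p+1)]. *)
exists (decay_cst + sobolev_cst (2 `^ (p + 1))).
split; first exact: addr_gt0.
move=> sigma T g phi _ reg t x t0 tT.
have ET : (\sum_(k < 3) \sum_(W <- compositions rotations k)
    int_x (fun y => int_v (fun v => (enorm y * `|W (Tphi sigma phi g) t y v| / enorm v)%:E)) =
    word_sum 3 rotations (@speed_ratio R) (Tphi sigma phi g) t)%E.
  apply: eq_bigr => k _; apply: eq_bigr => W _; apply: Jint_int_x => y v _.
  by rewrite /speed_ratio mulrAC.
have ES : (\sum_(k < 4) \sum_(Z <- compositions V_hat k)
    int_x (fun y => int_v (fun v => ((1 + `|s_weight t y v|) * `|Z g t y v|)%:E)) =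
    word_sum 4 V_hat (s_abs t) g t)%E.
  by apply: eq_bigr => k _; apply: eq_bigr => Z _; exact: Jint_int_x.
have EZ : (\sum_(k < 4) \sum_(Z <- compositions V_hat k)
    int_x (fun y => int_v (fun v => `|z_weight t y v `^ (p + 1) * Z g t y v|%:E)) =
    word_sum 4 V_hat (z_power t (p + 1)) g t)%E.
  apply: eq_bigr => k _; apply: eq_bigr => Z _; apply: Jint_int_x => y v _.
  by rewrite normrM /z_power (ger0_norm (powR_ge0 _ _)).
have Q0 q := decay_weight_gt0 t x q.
split.
  rewrite ET ES; apply: le_trans (decay_s_weight sigma x t0 tT reg) _.
  have Q1 := Q0 1; rewrite (powRr1 (ltW (tau_minus_gt0 t x))) in Q1.
  by apply: le_cst_mul Q1 (energy_ge0 sigma phi g t); rewrite lerDl ltW.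
rewrite EZ [1 + p]addrC; have [Cg _ _] := reg.
apply: le_trans (z_decay x t0 q0 (Ck_slice t0 tT Cg)) _.
have Z0 : (0 <= word_sum 4 V_hat (z_power t (p + 1)) g t)%E.
  by apply: word_sum_ge0; exact: z_power_ge0.
(* Being nonnegative, the transport sum can be added to the right-hand side of [z_decay]. *)
have T0 : (0 <= \sum_(k < 3) \sum_(W <- compositions rotations k)
    int_x (fun y => int_v (fun v =>
      (enorm y * `|z_weight t y v `^ p * W (Tphi sigma phi g) t y v| / enorm v)%:E)))%E.
  apply: sume_ge0 => k _; apply: sume_ge0 => W _; apply: int3_ge0 => y.
  rewrite int_v_off0; apply: int3_ge0 => v; rewrite /off0; case: ifP => [_|_]; first exact: lexx.
  by rewrite lee_fin; apply: divr_ge0; [apply: mulr_ge0; [exact: enorm_ge0|exact: normr_ge0]|exact: enorm_ge0].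
have l : sobolev_cst (2 `^ (p + 1)) <= decay_cst + sobolev_cst (2 `^ (p + 1)).
  by rewrite lerDr ltW.
apply: le_trans (le_cst_mul l (Q0 (p + 1)) Z0) _.
apply: lee_wpmul2l; last by rewrite leeDr.
by rewrite lee_fin; apply: divr_ge0; [exact: ltW (addr_gt0 c0 c1)|exact: ltW (Q0 _)].
Qed.
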